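(* Let $(R,\mathfrak{m}_R,k)$, $(S,\mathfrak{m}_S,k)$ and $(T,\mathfrak{m}_T,k)$ be local rings of prime characteristic $p>0$ with the same residue field $k$, let $\epsilon_R:R\to T$ and $\epsilon_S:S\to T$ be surjective ring homomorphisms, assume $\dim R>0$, and let $s>0$ be a real number. Then, with $e_s$ of each ring computed over that ring itself with respect to its own maximal ideal: (i) if $\dim(R)=\dim(S)=\dim(T)$, then $e_s(R\times_T S)=e_s(R)+e_s(S)-e_s(T)$; (ii) if $\dim(R)=\dim(S)>\dim(T)$, then $e_s(R\times_T S)=e_s(R)+e_s(S)$; (iii) if $\dim(R)>\dim(S)>\dim(T)$, then $e_s(R\times_T S)=e_s(R)$.
   Context: All rings are commutative, Noetherian, local, with identity. The fiber product is $R\times_T S=\{(r,s)\in R\times S:\epsilon_R(r)=\epsilon_S(s)\}$; it is a Noetherian local ring with maximal ideal $\mathfrak{m}=\mathfrak{m}_R\times_{\mathfrak{m}_T}\mathfrak{m}_S$ and residue field $k$, of characteristic $p$, with $\dim(R\times_T S)=\max\{\dim R,\dim S\}$. $s$-multiplicity: for a local ring $(A,\mathfrak{n})$ of prime characteristic $p>0$ and dimension $d>0$, and real $s>0$, $$h_s(A)=\lim_{e\to\infty}\frac{\ell_A\big(A/(\mathfrak{n}^{\lceil sp^e\rceil}+\mathfrak{n}^{[p^e]})\big)}{p^{ed}},\qquad e_s(A)=\frac{h_s(A)}{\mathcal{H}_s(d)},\qquad \mathcal{H}_s(d)=\sum_{i=0}^{\lfloor s\rfloor}\frac{(-1)^i}{d!}\binom{d}{i}(s-i)^d,$$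 where $d=\dim A$, $\ell_A$ is length and $\mathfrak{n}^{[p^e]}$ is the ideal generated by the $p^e$-th powers of elements of $\mathfrak{n}$ (the limit is known to exist). *)

(* Defs.v *)
From HB Require Import structures.
From mathcomp Require Import all_boot all_order all_algebra ring_quotient.
From mathcomp Require Import all_classical all_reals all_analysis.

Set Implicit Arguments.
Unset Strict Implicit.
Unset Printing Implicit Defensive.

Import Order.TTheory GRing.Theory Num.Theory.
Import numFieldNormedType.Exports.

Local Open Scope classical_set_scope.
Local Open Scope ring_scope.

(* The largest element of a bounded nonempty set of naturals, with junk value 0
   otherwise. It is only meant for sets known to be bounded: chains of primes
   in a Noetherian local ring, chains of submodules in a module of finite
   length. *)
Definition max_nat (P : set nat) : nat :=
  xget 0%N [set n | P n /\ forall m, P m -> (m <= n)%N].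

Section Modules.
Variables (A : comNzRingType) (V : lmodType A).

Definition strict_chain (n : nat) (N : nat -> {pred V}) : Prop :=
  forall i, (i < n)%N ->
    {subset N i <= N i.+1} /\ ~ {subset N i.+1 <= N i}.

Definition mod_length : nat :=
  max_nat [set n | exists N : nat -> submodClosed V, strict_chain n N].

Section Quotient.
Variable N : submodClosed V.

Lemma submod_zmod_closed : zmod_closed (N : {pred V}).
Proof. exact: (GRing.submod_closedB (submodClosedP N)). Qed.

(* submodClosed predicates have no canonical zmodClosed structure, which the
   library's quotient by a subgroup requires. *)
Definition submod_zmod : zmodClosed V := HB.pack (GRing.SubmodClosed.sort N)
  (GRing.isZmodClosed.Build V (GRing.SubmodClosed.sort N) submod_zmod_closed).

Local Notation qM := (Quotient.quot submod_zmod).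

Definition quot_mod : Type := qM.

HB.instance Definition _ := GRing.Zmodule.on quot_mod.

Definition quot_proj (v : V) : quot_mod := \pi_(qM)%qT v.

Lemma quot_projD : {morph quot_proj : u v / u + v}.
Proof. exact: (raddfD \pi_(qM)%qT). Qed.

Lemma quot_proj_surj (x : quot_mod) : exists v, x = quot_proj v.
Proof. by exists (repr (x : qM)); rewrite /quot_proj reprK. Qed.

Lemma quot_proj_eq (u v : V) : quot_proj u = quot_proj v <-> u - v \in N.
Proof.
have -> : (u - v \in N) = (u - v \in submod_zmod) by [].
by rewrite Quotient.idealrBE; split=> /eqP.
Qed.

Definition quot_mod_scale (a : A) (x : quot_mod) : quot_mod :=
  quot_proj (a *: repr (x : qM)).

Lemma quot_mod_scale_proj a (v : V) :
  quot_mod_scale a (quot_proj v) = quot_proj (a *: v).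
Proof.
rewrite quot_proj_eq -scalerBr; apply: (@rpredZ _ _ N); apply/quot_proj_eq.
by rewrite /quot_proj reprK.
Qed.

Lemma quot_mod_scaleA a b x :
  quot_mod_scale a (quot_mod_scale b x) = quot_mod_scale (a * b) x.
Proof. by have [v ->] := quot_proj_surj x; rewrite !quot_mod_scale_proj scalerA. Qed.

Lemma quot_mod_scale1 : left_id 1 quot_mod_scale.
Proof. by move=> x; have [v ->] := quot_proj_surj x; rewrite quot_mod_scale_proj scale1r. Qed.

Lemma quot_mod_scaleDr : right_distributive quot_mod_scale +%R.
Proof.
move=> a x y; have [u ->] := quot_proj_surj x; have [v ->] := quot_proj_surj y.
by rewrite -quot_projD !quot_mod_scale_proj scalerDr quot_projD.
Qed.

Lemma quot_mod_scaleDl x : {morph quot_mod_scale^~ x : a b / a + b}.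
Proof.
have [v ->] := quot_proj_surj x => a b.
by rewrite !quot_mod_scale_proj scalerDl quot_projD.
Qed.

HB.instance Definition _ := GRing.Zmodule_isLmodule.Build A quot_mod
  quot_mod_scaleA quot_mod_scale1 quot_mod_scaleDr quot_mod_scaleDl.

End Quotient.
End Modules.

(* Not necessarily proper ideals; the library's idealr are the proper ones. *)
Notation ideal A := (submodClosed A^o).

Section Ideals.
Variable A : comNzRingType.

Definition ideal_gen (X : set A) : {pred A^o} :=
  fun x => `[< forall I : ideal A, (forall y, X y -> y \in I) -> x \in I >].

Lemma ideal_gen_closed X : submod_closed (ideal_gen X : {pred A^o}).
Proof.
split; first by apply/asboolP => I _; exact: rpred0.
move=> a x y /asboolP xX /asboolP yX; apply/asboolP => I XI.
by rewrite rpredD ?rpredZ ?xX ?yX.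
Qed.

HB.instance Definition _ X :=
  GRing.isSubmodClosed.Build A A^o (ideal_gen X) (ideal_gen_closed X).

Definition ideal_add (I J : ideal A) : {pred A^o} :=
  fun z => `[< exists x y, [/\ x \in I, y \in J & z = x + y] >].

Lemma ideal_add_closed I J : submod_closed (ideal_add I J : {pred A^o}).
Proof.
split; first by apply/asboolP; exists 0, 0; rewrite !rpred0 addr0.
move=> a _ _ /asboolP[x [y [xI yJ ->]]] /asboolP[x' [y' [xI' yJ' ->]]].
apply/asboolP; exists (a *: x + x'), (a *: y + y').
by split; rewrite ?rpredD ?rpredZ// scalerDr addrACA.
Qed.

HB.instance Definition _ I J :=
  GRing.isSubmodClosed.Build A A^o (ideal_add I J) (ideal_add_closed I J).

Definition ideal_pow (I : {pred A}) (n : nat) : ideal A :=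
  ideal_gen [set x | exists2 f : 'I_n -> A,
    (forall i, f i \in I) & x = \prod_(i < n) f i].

(* I^[q] *)
Definition frobenius_pow (I : {pred A}) (q : nat) : ideal A :=
  ideal_gen [set x ^+ q | x in [set x | x \in I]].

Definition maximal_ideal (I : idealr A) : Prop :=
  forall J : idealr A, {subset I <= J} -> J =i I.

Definition noetherian : Prop :=
  forall I : nat -> ideal A, (forall n, {subset I n <= I n.+1}) ->
    exists n, forall k, (n <= k)%N -> I k =i I n.

Definition krull_dim : nat :=
  max_nat [set n | exists P : nat -> prime_idealr A,
    @strict_chain A A^o n P].

(* (A, m, k) is a Noetherian local ring whose residue field is k by means of
   the residue map r. *)
Definition noetherian_local (m : idealr A) (k : fieldType)
    (r : {rmorphism A -> k}) : Prop :=
  [/\ noetherian,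
      forall I : idealr A, maximal_ideal I <-> I =i m,
      forall c : k, exists x, r x = c
    & forall x, (x \in m) = (r x == 0)].

End Ideals.

Section SMultiplicity.
Variables (K : realType) (p : nat) (s : K) (A : comNzRingType) (m : idealr A).

(* m^(ceil (s p^e)) + m^[p^e] *)
Definition s_ideal (e : nat) : ideal A :=
  ideal_add (ideal_pow m `|Num.ceil (s * p%:R ^+ e)|%N)
            (frobenius_pow m (p ^ e)).

Definition h_mult : K :=
  limn (fun e : nat =>
    (mod_length (quot_mod (s_ideal e)))%:R / p%:R ^+ (e * krull_dim A) : K).

Definition H_norm (d : nat) : K :=
  \sum_(0 <= i < (Num.truncn s).+1)
    (-1) ^+ i / d`!%:R * 'C(d, i)%:R * (s - i%:R) ^+ d.

Definition e_mult : K := h_mult / H_norm (krull_dim A).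

End SMultiplicity.

Section FiberProduct.
Variables (R S T : comNzRingType).
Variables (epsR : {rmorphism R -> T}) (epsS : {rmorphism S -> T}).

Definition fiber_pred : {pred R * S} := fun x => epsR x.1 == epsS x.2.

Lemma fiber_subring_closed : subring_closed fiber_pred.
Proof.
split; rewrite /fiber_pred ?unfold_in /=; first by rewrite !rmorph1.
- by move=> x y /eqP xE /eqP yE; rewrite unfold_in /= !rmorphB xE yE.
- by move=> x y /eqP xE /eqP yE; rewrite unfold_in /= !rmorphM xE yE.
Qed.

HB.instance Definition _ :=
  GRing.isSubringClosed.Build (R * S)%type fiber_pred fiber_subring_closed.

Definition fiber_prod : Type := {x : R * S | fiber_pred x}.

HB.instance Definition _ := [isSub of fiber_prod for @sval _ _].
HB.instance Definition _ := [Choice of fiber_prod by <:].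
HB.instance Definition _ := [SubChoice_isSubComNzRing of fiber_prod by <:].

Variables (mR : idealr R) (mS : idealr S).

(* As a subset of the fiber product this is m_R x_(m_T) m_S. *)
Definition fiber_max : {pred fiber_prod} :=
  fun x => ((val x).1 \in mR) && ((val x).2 \in mS).

Lemma fiber_max_closed : idealr_closed (fiber_max : {pred fiber_prod}).
Proof.
split; rewrite ?unfold_in /fiber_max /=.
- by apply/andP; split; exact: idealr0.
- by apply/negP => /andP[r1 _]; have := idealr1 mR; rewrite [X in X = false]r1.
- move=> a x y; rewrite !unfold_in /= => /andP[x1 x2] /andP[y1 y2].
  apply/andP; split.
    exact: (rpredD (idealMr (val a).1 x1) y1).
  exact: (rpredD (idealMr (val a).2 x2) y2).
Qed.

HB.instance Definition _ :=
  isIdealr.Build fiber_prod fiber_max fiber_max_closed.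

End FiberProduct.

Arguments fiber_max {R S T} epsR epsS mR mS.

(* Main.v *)
Require Import Defs.
From HB Require Import structures.
From mathcomp Require Import all_boot all_order all_algebra ring_quotient.
From mathcomp Require Import ring zify.
From mathcomp Require Import all_classical all_reals all_analysis.

Set Implicit Arguments.
Unset Strict Implicit.
Unset Printing Implicit Defensive.

Import Order.TTheory GRing.Theory Num.Theory.
Import numFieldNormedType.Exports.

Local Open Scope classical_set_scope.
Local Open Scope ring_scope.

(* Let A be the completion of a Noetherian local ring of characteristic p whose
   chains of primes have length at most d. A coefficient field k and a system of
   parameters make A finite over B = k[[X_1, ..., X_d]] (the map B -> A need not
   be injective). Put q = p^e and I_e = m^(ceil (s q)) + m^[q].

   Let C be the B-span of the p^j-th powers of module generators of A. It is a
   ring, and for large j it stabilizes: delta C is contained in the span of the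
   p^(j+1)-st powers, with delta <> 0 in B. As I_(e+j) and I_e^[p^j] agree up to
   multiplication by a fixed power of a parameter, passing from one to the other
   costs O(q^(d-1)), and so does cutting A into cyclic C-modules C/a. With
   J_e = I_e^[p^j] C, Frobenius gives
   l(C/(a + J_(e+1))) <= p^d l(C/(a + J_e)) + O(q^(d-1)), so the normalized
   lengths are decreasing up to a summable error and the limits exist.

   If ideals r, s of A satisfy r cap s = 0, there is a C-linear map A -> A which
   is multiplication by some delta <> 0 of B on r and vanishes on s. It shows that
   l(A/I_e) + l(A/(r + s + I_e)) = l(A/(r + I_e)) + l(A/(s + I_e)) + O(q^(d-1)).
   For the fiber product and the kernels r, s of its two projections the four
   quotients are the fiber product, T, R and S; those of dimension less than d
   contribute O(q^(d-1)). *)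

(** * Linear algebra modulo a subspace *)

(** The main obstacle is that A may have nilpotents and be inseparable over B, and that a B-linear
    map need not respect the ideals I_e. A C-linear map does respect the products I_e^[p^j] M,
    because C contains all p^j-th powers of A; this is why I_(e+j) is traded for I_e^[p^j]. To make
    a B-linear map C-linear, one uses that up to a nonzero factor C is spanned by the p^e-th powers
    of its generators, for every e, and that in characteristic p the commutator with c^(p^e) is the
    p^e-th iterate of the commutator with c. It is then enough to make some iterated commutators
    vanish.

    Completing serves to obtain a coefficient field, which turns lengths into dimensions over k, and
    finiteness over B. Ideals of R are sent to their closures in A, so no flatness of the completion
    is invoked.

    The power series ring enters through two counts of generators, for B/(X_i^n) and for B/(delta,
    X_i^n). The second one controls the comparisons above: each error is a quotient killed by a
    fixed nonzero delta. *)

Definition no_zero_div (B : comNzRingType) : Prop :=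
  forall x y : B, x * y = 0 -> x = 0 \/ y = 0.

(** Fraction-free Gaussian elimination on the last column: cross-multiplication by a pivot replaces
    division. Without a pivot the last column imposes no condition, and one row can be given the
    coefficient 0. *)
Lemma left_kernel (B : comNzRingType) : no_zero_div B ->
  forall (n : nat) (M : 'I_n.+1 -> 'I_n -> B),
  exists v : 'I_n.+1 -> B, (exists i, v i <> 0) /\
    forall j, \sum_i v i * M i j = 0.
Proof.
move=> domB; elim=> [|n IHn] M.
  by exists (fun=> 1); split; [exists ord0; apply/eqP/oner_neq0 | case].
case: (pselect (exists r, M r ord_max <> 0)) => [[r Mr]|M0].
  have [v [[i vi] vM]] := IHn (fun i j => M r ord_max * M (lift r i) (lift ord_max j)
     - M (lift r i) ord_max * M r (lift ord_max j)).
  exists (fun i => if unlift r i is Some i' then M r ord_max * v i'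
     else - \sum_i' v i' * M (lift r i') ord_max).
  split.
    exists (lift r i); cbv beta; rewrite liftK => /domB[] //.
  move=> j; rewrite (bigD1_ord r)//= unlift_none.
  under [X in _ + X]eq_bigr do rewrite liftK.
  rewrite mulNr mulr_suml -sumrN -big_split/=.
  case: (unliftP ord_max j) => [j'|] ->; last first.
    by rewrite big1// => i' _; ring.
  rewrite -[RHS](vM j'); apply: eq_bigr => i' _.
  by ring.
have [v [[i vi] vM]] := IHn (fun i j => M (lift ord_max i) (lift ord_max j)).
exists (fun i => if unlift ord_max i is Some i' then v i' else 0).
split; first by exists (lift ord_max i); cbv beta; rewrite liftK.
move=> j; case: (unliftP ord_max j) => [j'|] ->; last first.
  rewrite big1// => i' _; case: (pselect (M i' ord_max = 0)) => [->|?]; rewrite ?mulr0//.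
  by case: M0; exists i'.
rewrite (bigD1_ord ord_max)//= unlift_none mul0r add0r.
by under eq_bigr do rewrite liftK.
Qed.

Section Span.
Variables (k A : comNzRingType) (sg : {rmorphism k -> A}).
Implicit Types (U V W : set A) (t : seq A).

(** The scalars act through an arbitrary ring morphism, so that one notion covers k-subspaces,
    B-submodules and, for the identity, ideals. *)
Definition subsp U : Prop :=
  [/\ U 0, forall x y, U x -> U y -> U (x + y) & forall c x, U x -> U (sg c * x)].

Fixpoint inspan t (x : A) : Prop :=
  if t is y :: t' then exists a, inspan t' (x - sg a * y) else x = 0.

Lemma subspN U x : subsp U -> U x -> U (- x).
Proof. by case=> _ _ UZ Ux; rewrite -mulN1r -(rmorph1 sg) -rmorphN; apply: UZ. Qed.

Lemma subsp_sum (I : Type) (r : seq I) (P : pred I) (F : I -> A) U : subsp U ->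
  (forall i, P i -> U (F i)) -> U (\sum_(i <- r | P i) F i).
Proof. by move=> [U0 UD _] UF; elim/big_ind: _. Qed.

Lemma subspB U x y : subsp U -> U x -> U y -> U (x - y).
Proof. by move=> sU Ux Uy; have [_ UD _] := sU; apply: UD => //; apply: subspN. Qed.

Lemma inspan0 t : inspan t 0.
Proof. by elim: t => [//|y t IH] /=; exists 0; rewrite rmorph0 mul0r subr0. Qed.

Lemma inspanD t x y : inspan t x -> inspan t y -> inspan t (x + y).
Proof.
elim: t x y => [|z t IH] x y /=; first by move=> -> ->; rewrite addr0.
move=> [a xa] [b yb]; exists (a + b).
by rewrite rmorphD mulrDl opprD addrACA; apply: IH.
Qed.

Lemma inspanZ t c x : inspan t x -> inspan t (sg c * x).
Proof.
elim: t x => [|z t IH] x /=; first by move=> ->; rewrite mulr0.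
by move=> [a xa]; exists (c * a); rewrite rmorphM -mulrA -mulrBr; apply: IH.
Qed.

Lemma inspan_subsp t : subsp (inspan t).
Proof. by split; [exact: inspan0 | exact: inspanD | exact: inspanZ]. Qed.

Lemma inspan_cons y t x : inspan t x -> inspan (y :: t) x.
Proof. by exists 0; rewrite rmorph0 mul0r subr0. Qed.

Lemma inspan_mem t y : y \in t -> inspan t y.
Proof.
elim: t => [//|z t IH]; rewrite inE => /orP[/eqP->|/IH yt].
  by exists 1; rewrite rmorph1 mul1r subrr; apply: inspan0.
exact: inspan_cons.
Qed.

Lemma inspan_sub t U : subsp U -> (forall y, y \in t -> U y) -> inspan t `<=` U.
Proof.
move=> sU; have [U0 UD UZ] := sU; elim: t => [|y t IH] tU x /=; first by move=> ->.
move=> [a xa]; rewrite -[x](subrK (sg a * y)); apply: UD.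
  by apply: IH xa => z zt; apply: tU; rewrite inE zt orbT.
by apply/UZ/tU; rewrite inE eqxx.
Qed.

Lemma inspan_cat t1 t2 x :
  inspan (t1 ++ t2) x <-> exists y, inspan t1 y /\ inspan t2 (x - y).
Proof.
split; elim: t1 x => [|z t IH] x /=.
- by move=> xt; exists 0; rewrite subr0.
- move=> [a /IH[y [ty txy]]]; exists (y + sg a * z); split.
    by exists a; rewrite addrK.
  by rewrite opprD addrA addrAC.
- by move=> [y [-> ]]; rewrite subr0.
- move=> [y [[a ya] xy]]; exists a; apply: IH; exists (y - sg a * z).
  by rewrite opprB addrA subrK.
Qed.

Definition addsp U V : set A := [set x | exists u v, [/\ U u, V v & x = u + v]].

Lemma addsp_subsp U V : subsp U -> subsp V -> subsp (addsp U V).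
Proof.
move=> [U0 UD UZ] [V0 VD VZ]; split.
- by exists 0, 0; rewrite addr0.
- move=> _ _ [u [v [Uu Vv ->]]] [u' [v' [Uu' Vv' ->]]].
  by exists (u + u'), (v + v'); rewrite addrACA; split; [apply: UD | apply: VD |].
- move=> c _ [u [v [Uu Vv ->]]].
  by exists (sg c * u), (sg c * v); rewrite mulrDr; split; [apply: UZ | apply: VZ |].
Qed.

Lemma addspl U V : V 0 -> U `<=` addsp U V.
Proof. by move=> V0 u Uu; exists u, 0; rewrite addr0. Qed.

Lemma addspr U V : U 0 -> V `<=` addsp U V.
Proof. by move=> U0 v Vv; exists 0, v; rewrite add0r. Qed.

Lemma setI_subsp U V : subsp U -> subsp V -> subsp (U `&` V).
Proof.
move=> [U0 UD UZ] [V0 VD VZ]; split => //.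
  by move=> x y [? ?] [? ?]; split; [apply: UD | apply: VD].
by move=> c x [? ?]; split; [apply: UZ | apply: VZ].
Qed.

Lemma subspT : subsp [set: A]. Proof. by []. Qed.

(** The list generates W modulo U but need not lie in W, so it stays valid when W shrinks or U
    grows. *)
Definition spans U W t : Prop := W `<=` addsp U (inspan t).

Lemma inspan_coef t x : inspan t x ->
  exists c : nat -> k, x = \sum_(i < size t) sg (c i) * t`_i.
Proof.
elim: t x => [|y t IH] x /=; first by move=> ->; exists (fun=> 0); rewrite big_ord0.
move=> [a /IH[c xE]]; exists (fun i => if i is i'.+1 then c i' else a).
by rewrite big_ord_recl/= -xE addrC subrK.
Qed.

Lemma inspan_sum t (c : nat -> k) : inspan t (\sum_(i < size t) sg (c i) * t`_i).
Proof.
apply: (@subsp_sum _ _ _ _ (inspan t)) => [|i _]; first exact: inspan_subsp.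
by apply/inspanZ/inspan_mem/mem_nth.
Qed.

Lemma mulset_subsp y U : subsp U -> subsp [set y * a | a in U].
Proof.
move=> [U0 UD UZ]; split; first by exists 0; rewrite ?mulr0.
  by move=> _ _ [a Ua <-] [b Ub <-]; exists (a + b); [apply: UD | rewrite mulrDr].
by move=> c _ [a Ua <-]; exists (sg c * a); [apply: UZ | rewrite mulrCA].
Qed.

Lemma addspS U U' V V' : U `<=` U' -> V `<=` V' -> addsp U V `<=` addsp U' V'.
Proof. by move=> UU' VV' x [u [v [/UU' ? /VV' ? ->]]]; exists u, v. Qed.

Lemma spans_sub U W U' W' t : U `<=` U' -> W' `<=` W -> spans U W t -> spans U' W' t.
Proof. by move=> UU' WW' s x /WW'/s; apply: addspS. Qed.

End Span.

Section Dimension.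
Variables (k : fieldType) (A : comNzRingType) (sg : {rmorphism k -> A}).
Implicit Types (U V W : set A) (t : seq A).
Notation subsp := (subsp sg).
Notation inspan := (inspan sg).
Notation spans := (spans sg).

Definition fin_over U W : Prop := exists t, spans U W t.

Fixpoint indep U t : Prop :=
  if t is y :: t' then ~ addsp U (inspan t') y /\ indep U t' else True.

Definition is_dim U W n : Prop :=
  exists t, [/\ size t = n, forall y, y \in t -> W y, spans U W t & indep U t].

Lemma indep_coef U t (c : nat -> k) : subsp U -> indep U t ->
  U (\sum_(i < size t) sg (c i) * t`_i) -> forall i : 'I_(size t), c i = 0.
Proof.
move=> sU; have [U0 UD UZ] := sU.
elim: t c => [|y t IH] c /=; first by move=> _ _ [].
move=> [ynt it]; rewrite big_ord_recl /= => Us.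
have c0 : c 0%N = 0.
  apply: contrapT => /eqP c0; apply: ynt.
  exists (sg (c 0)^-1 * (sg (c 0%N) * y + \sum_(i < size t) sg (c (bump 0 i)) * t`_i)).
  exists (- sg (c 0)^-1 * (\sum_(i < size t) sg (c (bump 0 i)) * t`_i)); split.
  - exact: UZ.
  - rewrite -rmorphN; apply: inspanZ.
    exact: (inspan_sum sg t (fun i => c (bump 0 i))).
  - by rewrite mulrDr mulNr addrK mulrA -rmorphM mulVf// rmorph1 mul1r.
move: Us; rewrite c0 rmorph0 mul0r add0r => /(IH (fun i => c i.+1) it) cS.
by case=> -[//|i] it'; apply: (cS (Ordinal (it' : (i < size t)%N))).
Qed.

(** If t were longer, its first [size t' + 1] members, expressed through t' modulo U, would give a
    matrix with more rows than columns; a left kernel vector contradicts independence. *)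
Lemma steinitz U W t t' : subsp U -> indep U t ->
  (forall y, y \in t -> addsp U (inspan t') y) -> (size t <= size t')%N.
Proof.
move=> sU it tt'; have [U0 UD UZ] := sU; rewrite leqNgt; apply/negP => ltt.
have tc i : exists c : nat -> k, (i < size t)%N ->
    U (t`_i - \sum_(j < size t') sg (c j) * t'`_j).
  case: (boolP (i < size t)%N) => [ilt|]; last by exists (fun=> 0).
  have [u [v [Uu /inspan_coef[c ->] ->]]] := tt' _ (mem_nth 0 ilt).
  by exists c => _; rewrite addrK.
have [c cE] := choice tc.
have domk : no_zero_div k by move=> x y /eqP; rewrite mulf_eq0 => /orP[]/eqP; auto.
have [v [[i vi] vM]] := left_kernel domk (fun (i : 'I_(size t').+1) (j : 'I_(size t')) => c i j).
(* The kernel vector is extended by 0, so that it becomes a family of coefficients for the whole of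
   t. *)
pose v' (i : nat) : k := if (i < (size t').+1)%N =P true is ReflectT h then v (Ordinal h) else 0.
have v'E (j : 'I_(size t').+1) : v' j = v j.
  by rewrite /v'; case: eqP => [h|]; [congr v; apply: val_inj | rewrite ltn_ord].
apply: vi; rewrite -v'E.
apply: (indep_coef (c := v') sU it _ (Ordinal (leq_trans (ltn_ord i) ltt))).
rewrite -(big_mkord xpredT (fun i => sg (v' i) * t`_i)) (big_cat_nat (n := (size t').+1))//=.
rewrite [X in _ + X]big1_seq ?addr0; last first.
  move=> j /=; rewrite mem_index_iota => /andP[tj _]; rewrite /v'.
  by case: eqP => [h|_]; [exfalso; move: h; rewrite ltnNge tj | rewrite rmorph0 mul0r].
rewrite big_mkord.
have -> : \sum_(i < (size t').+1) sg (v' i) * t`_i =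
   \sum_(i < (size t').+1) sg (v' i) * (t`_i - \sum_(j < size t') sg (c i j) * t'`_j).
  apply/eqP; rewrite -subr_eq0 -sumrB; apply/eqP.
  under eq_bigr do rewrite -mulrBr opprB addrC subrK mulr_sumr.
  rewrite exchange_big big1// => j _.
  under eq_bigr do rewrite mulrA -rmorphM v'E.
  by rewrite -mulr_suml -rmorph_sum vM rmorph0 mul0r.
apply: (subsp_sum _ sU) => j _; apply/UZ/cE.
exact: leq_trans (ltn_ord j) ltt.
Qed.

Lemma is_dim_uniq U W m n : subsp U -> is_dim U W m -> is_dim U W n -> m = n.
Proof.
move=> sU [t [<- tW st it]] [t' [<- tW' st' it']]; apply/eqP; rewrite eqn_leq.
by rewrite (steinitz W sU it (t' := t')) ?(steinitz W sU it' (t' := t))// => y;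
  [move=> /tW'/st | move=> /tW/st'].
Qed.

(** An independent list of maximal length spans; the exchange lemma bounds the lengths by
    [size t]. *)
Lemma is_dim_exists U W t : subsp U -> subsp W -> U `<=` W -> spans U W t ->
  exists2 n, (n <= size t)%N & is_dim U W n.
Proof.
move=> sU sW UW st; have [U0 _ _] := sU.
have ex (n : nat) : (exists t', [/\ size t' = n, forall y, y \in t' -> W y & indep U t']) ->
    (n <= size t)%N.
  by move=> [t' [<- t'W it']]; apply: (steinitz W sU it') => y /t'W/st.
pose Q n := `[< exists t', [/\ size t' = n, forall y, y \in t' -> W y & indep U t'] >].
have Q0 : exists n, Q n by exists 0%N; apply/asboolP; exists [::].
have Qb n : Q n -> (n <= size t)%N by move/asboolP/ex.
case: (ex_maxnP Q0 Qb) => m /asboolP[t' [st' t'W it']] mmax.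
exists m; first by apply: ex; exists t'.
exists t'; split => // w Ww; apply: contrapT => nw.
have : Q m.+1.
  apply/asboolP; exists (w :: t'); split => //=; first by rewrite st'.
  by move=> y; rewrite inE => /orP[/eqP->//|/t'W].
by move/mmax; rewrite ltnn.
Qed.

Lemma is_dim_add U V W a b : subsp U -> subsp V -> subsp W -> U `<=` V -> V `<=` W ->
  is_dim U V a -> is_dim V W b -> is_dim U W (a + b).
Proof.
move=> sU sV sW UV VW [t [<- tV st it]] [t' [<- t'W st' it']].
exists (t' ++ t); split.
- by rewrite size_cat addnC.
- by move=> y; rewrite mem_cat => /orP[/t'W|/tV/VW].
- move=> w /st'[v [x [/st[u [z [Uu tz ->]]] t'x ->]]].
  exists u, (z + x); rewrite addrA; split => //.
  by apply/inspan_cat; exists x; rewrite addrK.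
- elim: t' it' {t'W st'} => [//|y t' IH] /= [ny /IH ?]; split => //.
  move=> [u [v [Uu /inspan_cat[z [t'z tvz]] yE]]]; apply: ny.
  exists (u + (v - z)), z; split => //; last by rewrite yE -addrA subrK.
  have [_ VD _] := sV; apply: VD; first exact: UV.
  exact: inspan_sub tvz.
Qed.

(* The dimension of W/U, and 0 when it is infinite. *)
Definition dq U W : nat := xget 0%N [set n | is_dim U W n].

Lemma dq_uniq U W n : subsp U -> is_dim U W n -> dq U W = n.
Proof.
move=> sU Un; apply: (is_dim_uniq (W := W) sU) => //.
exact: (@xgetPex _ 0%N [set n | is_dim U W n] (ex_intro _ n Un)).
Qed.

Lemma dqP U W : subsp U -> subsp W -> U `<=` W -> fin_over U W -> is_dim U W (dq U W).
Proof.
move=> sU sW UW [t /(is_dim_exists sU sW UW)[n _ Un]].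
exact: (@xgetPex _ 0%N [set n | is_dim U W n] (ex_intro _ n Un)).
Qed.

Lemma dq_le U W t : subsp U -> subsp W -> U `<=` W -> spans U W t -> (dq U W <= size t)%N.
Proof. by move=> sU sW UW /(is_dim_exists sU sW UW)[n nt /(dq_uniq sU)->]. Qed.

Lemma fin_sub U W U' W' : U `<=` U' -> W' `<=` W -> fin_over U W -> fin_over U' W'.
Proof. by move=> UU' WW' [t st]; exists t; apply: spans_sub st. Qed.

Lemma dq_add U V W : subsp U -> subsp V -> subsp W -> U `<=` V -> V `<=` W ->
  fin_over U W -> dq U W = (dq U V + dq V W)%N.
Proof.
move=> sU sV sW UV VW fUW; apply: dq_uniq => //; apply: (is_dim_add (V := V)) => //; apply: dqP => //.
  exact: fin_sub fUW.
exact: fin_sub fUW.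
Qed.

Lemma dq_eq0 U : subsp U -> dq U U = 0%N.
Proof.
by move=> sU; apply: dq_uniq => //; exists [::]; split => // x Ux; exists x, 0; rewrite addr0.
Qed.

(* A linear map g inducing an isomorphism W/U -> W'/U'. *)
Lemma dq_iso (g : A -> A) U W U' W' : subsp U -> subsp W -> subsp U' -> subsp W' ->
  U `<=` W -> U' `<=` W' -> fin_over U W ->
  (forall x y, W x -> W y -> g (x + y) = g x + g y) ->
  (forall c x, W x -> g (sg c * x) = sg c * g x) ->
  (forall x, W x -> W' (g x)) ->
  (forall x, W x -> U' (g x) -> U x) -> (forall x, U x -> U' (g x)) ->
  (forall y, W' y -> exists2 x, W x & U' (y - g x)) ->
  dq U' W' = dq U W.
Proof.
move=> sU sW sU' sW' UW UW' fUW gD gZ gW gU' gU gsurj.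
have [W0 WD WZ] := sW; have [U0' UD' UZ'] := sU'.
have g0 : g 0 = 0 by have := gZ 0 0 W0; rewrite rmorph0 !mul0r.
have [t [st tW tsp ti]] := dqP sU sW UW fUW.
have gspan t' : (forall y, y \in t' -> W y) -> forall x, inspan t' x -> inspan (map g t') (g x).
  elim: t' => [|y t' IH] /= t'W x; first by move=> ->.
  move=> [a xa]; have yW := t'W _ (mem_head _ _).
  have t'W' z : z \in t' -> W z by move=> zt; apply: t'W; rewrite inE zt orbT.
  have xaW := inspan_sub sW t'W' xa.
  exists a; rewrite -[x](subrK (sg a * y)) gD ?gZ//; last exact: WZ.
  by rewrite addrK; apply: IH.
have gspan' t' : (forall y, y \in t' -> W y) -> forall z, inspan (map g t') z ->
    exists2 x, inspan t' x & z = g x.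
  elim: t' => [|y t' IH] /= t'W z; first by move=> ->; exists 0.
  move=> [a za]; have yW := t'W _ (mem_head _ _).
  have t'W' u : u \in t' -> W u by move=> ut; apply: t'W; rewrite inE ut orbT.
  have [x t'x zE] := IH t'W' _ za.
  exists (x + sg a * y); first by exists a; rewrite addrK.
  by rewrite gD ?gZ//; [rewrite -zE subrK | exact: inspan_sub t'x | exact: WZ].
apply: dq_uniq => //; exists (map g t); split.
- by rewrite size_map.
- by move=> y /mapP[x /tW Wx ->]; apply: gW.
- move=> y /gsurj[x Wx yx]; have [u [v [Uu tv xE]]] := tsp _ Wx.
  have vW := inspan_sub sW tW tv.
  exists (y - g x + g u), (g v); split.
  + by apply: UD' => //; apply: gU.
  + exact: gspan.
  + by rewrite -addrA -gD ?subrK -?xE ?subrK//; apply: UW.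
- elim: t tW ti {st tsp} => [//|y t IH] tW /= [ny it].
  have yW := tW _ (mem_head _ _).
  have tW' u : u \in t -> W u by move=> ut; apply: tW; rewrite inE ut orbT.
  split; last exact: IH.
  move=> [u [v [Uu /(gspan' _ tW')[x tx ->] gy]]]; apply: ny.
  have xW := inspan_sub sW tW' tx.
  exists (y - x), x; split => //; last by rewrite subrK.
  apply: gU'; first exact: (subspB sW).
  have -> : g (y - x) = u; last by [].
  have : g (y - x + x) = g y by rewrite subrK.
  by rewrite gD ?gy//; [move/addIr | exact: (subspB sW)].
Qed.

(** Second isomorphism theorem, with the identity as the map. *)
Lemma dq_addsp V W : subsp V -> subsp W -> fin_over (V `&` W) W ->
  dq V (addsp V W) = dq (V `&` W) W.
Proof.
move=> sV sW fW; have [W0 _ _] := sW; have [V0 _ _] := sV.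
apply: (dq_iso (g := id)) => //.
- exact: setI_subsp.
- exact: addsp_subsp.
- exact: addspl.
- by move=> x Wx; apply: addspr.
- by move=> x [].
- by move=> _ [v [w [Vv Ww ->]]]; exists w; rewrite ?addrK.
Qed.

(* Kernel and cokernel of the endomorphism of W/U induced by g. *)
Lemma dq_ker_coker (g : A -> A) U W : subsp U -> subsp W -> U `<=` W -> fin_over U W ->
  (forall x y, W x -> W y -> g (x + y) = g x + g y) ->
  (forall c x, W x -> g (sg c * x) = sg c * g x) ->
  (forall x, W x -> W (g x)) -> (forall x, U x -> U (g x)) ->
  dq U [set x | W x /\ U (g x)] = dq (addsp U (g @` W)) W.
Proof.
move=> sU sW UW fUW gD gZ gW gU.
have [U0 UD UZ] := sU; have [W0 WD WZ] := sW.
have g0 : g 0 = 0 by have := gZ 0 0 W0; rewrite rmorph0 !mul0r.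
have sK : subsp [set x | W x /\ U (g x)].
  split; first by rewrite /= g0.
    by move=> x y [Wx Ux] [Wy Uy]; split; [apply: WD | rewrite gD//; apply: UD].
  by move=> c x [Wx Ux]; split; [apply: WZ | rewrite gZ//; apply: UZ].
have sG : subsp (g @` W).
  split; first by exists 0.
    by move=> _ _ [x Wx <-] [y Wy <-]; exists (x + y); [apply: WD | apply: gD].
  by move=> c _ [x Wx <-]; exists (sg c * x); [apply: WZ | apply: gZ].
have sUG := addsp_subsp sU sG.
have UK : U `<=` [set x | W x /\ U (g x)] by move=> x Ux; split; [apply: UW | apply: gU].
have UGW : addsp U (g @` W) `<=` W.
  by move=> _ [u [_ [Uu [x Wx <-] ->]]]; apply: WD; [apply: UW | apply: gW].
have UUG : U `<=` addsp U (g @` W) by apply: addspl; exists 0.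
(* With K the kernel, both W/K and (U + g(W))/U are the image of the induced endomorphism;
   cancelling their common dimension leaves the kernel against the cokernel. *)
have e1 := dq_add sU sK sW UK (fun x => @proj1 _ _) fUW.
have e2 := dq_add sU sUG sW UUG UGW fUW.
have e3 : dq U (addsp U (g @` W)) = dq [set x | W x /\ U (g x)] W.
  apply: (dq_iso (g := g)) => //.
  - by move=> x [].
  - exact: fin_sub UK (@subset_refl _ _) fUW.
  - by move=> x Wx; apply: addspr => //; exists x.
  - by move=> x [].
  - by move=> _ [u [_ [Uu [x Wx <-] ->]]]; exists x; rewrite ?addrK.
apply/eqP; rewrite -(eqn_add2r (dq U (addsp U (g @` W)))) -[X in _ == X]addnC -e2 e3.
by rewrite -e1.
Qed.

End Dimension.

Notation lideal := (inspan idfun).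
Notation is_ideal := (subsp idfun).

Lemma addsp0l (T : comNzRingType) (V : set T) : addsp [set 0] V = V.
Proof.
apply/seteqP; split => [_ [u [v [-> Vv ->]]]|v Vv]; first by rewrite add0r.
by exists 0, v; rewrite add0r.
Qed.

Lemma addspA (T : comNzRingType) : associative (@addsp T).
Proof.
move=> U V W; apply/seteqP; split.
  move=> _ [u [_ [Uu [v [w [Vv Ww ->]]] ->]]]; exists (u + v), w; rewrite addrA; split => //.
  by exists u, v.
move=> _ [_ [w [[u [v [Uu Vv ->]]] Ww ->]]]; exists u, (v + w); rewrite addrA; split => //.
by exists v, w.
Qed.

Section Ideals.
Variable A : comNzRingType.
Implicit Types (I J : set A).

Lemma is_idealMl I a x : is_ideal I -> I x -> I (a * x).
Proof. by case=> _ _; apply. Qed.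

Lemma is_idealMr I a x : is_ideal I -> I x -> I (x * a).
Proof. by rewrite mulrC; apply: is_idealMl. Qed.

Lemma ideal_subsp (k : comNzRingType) (sg : {rmorphism k -> A}) I : is_ideal I -> subsp sg I.
Proof. by move=> [I0 ID IM]; split => // c x; apply: IM. Qed.

Lemma inspan_rmorph (k B : comNzRingType) (io : {rmorphism k -> B}) (be : {rmorphism B -> A})
    (sg : {rmorphism k -> A}) t x : (forall c, be (io c) = sg c) ->
  inspan io t x -> inspan sg (map be t) (be x).
Proof.
move=> bi; elim: t x => [|y t IH] x /=; first by move=> ->; rewrite rmorph0.
by move=> [a /IH]; rewrite rmorphB rmorphM bi => ?; exists a.
Qed.

Lemma inspan_mull (k : comNzRingType) (sg : {rmorphism k -> A}) t a x :
  inspan sg t x -> inspan sg (map (fun y => a * y) t) (a * x).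
Proof.
elim: t x => [|y t IH] x /=; first by move=> ->; rewrite mulr0.
by move=> [c /IH]; rewrite mulrBr mulrCA => ?; exists c.
Qed.

(** Successive approximation: if t_i accounts for G_i modulo U and G_(i+1), then the t_i together
    account for G_0 modulo U. It is applied to the filtration of a power series ring by the powers
    of its variable. *)
Lemma filt_span (k : comNzRingType) (sg : {rmorphism k -> A}) U (G : nat -> set A)
    (t : nat -> seq A) n : subsp sg U ->
  (forall i x, (i < n)%N -> G i x ->
     exists v u, [/\ inspan sg (t i) v, U u & G i.+1 (x - v - u)]) ->
  G n `<=` U -> G 0%N `<=` addsp U (inspan sg (flatten [seq t i | i <- iota 0 n])).
Proof.
move=> sU; have [U0 UD _] := sU.
elim: n G t => [|n IH] G t Gt GU x Gx; first by exists x, 0; split => //; [apply: GU | rewrite addr0].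
have [v [u [tv Uu Gx']]] := Gt 0%N x isT Gx.
have [u' [v' [Uu' tv' xE]]] := IH (fun i => G i.+1) (fun i => t i.+1) (fun i y => Gt i.+1 y) GU _ Gx'.
exists (u + u'), (v + v'); split.
- exact: UD.
- rewrite /= (iotaDl 1 0) -map_comp; apply/inspan_cat; exists v.
  by rewrite addrAC subrr add0r.
- by rewrite -[x](subrK v) -[x - v](subrK u) xE; ring.
Qed.

End Ideals.

(** * Power series *)

Section PowerSeries.
Variable R : comNzRingType.

Definition ps : Type := nat -> R.
HB.instance Definition _ := GRing.Zmodule.copy ps (nat -> R).

Definition ps_mul (f g : ps) : ps := fun n => \sum_(i < n.+1) f i * g (n - i)%N.
Definition ps_const (c : R) : ps := fun n => if n is 0%N then c else 0.
Definition ps_trunc n (f : ps) : {poly R} := \poly_(i < n) f i.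

(** A coefficient of a product only sees truncations, so associativity and commutativity are
    inherited from polynomials. *)
Lemma ps_mulE N n (f g : ps) : (n < N)%N -> ps_mul f g n = (ps_trunc N f * ps_trunc N g)`_n.
Proof.
move=> nN; rewrite coefM; apply: eq_bigr => i _.
by rewrite !coef_poly !ifT//; have := ltn_ord i; lia.
Qed.

Lemma coefM_eq n (p q p' q' : {poly R}) : (forall i, (i <= n)%N -> p`_i = p'`_i) ->
  (forall i, (i <= n)%N -> q`_i = q'`_i) -> (p * q)`_n = (p' * q')`_n.
Proof.
move=> pp qq; rewrite !coefM; apply: eq_bigr => i _.
by rewrite pp ?qq//; have := ltn_ord i; lia.
Qed.

Lemma ps_trunc_mul N n (f g : ps) : (n < N)%N ->
  (ps_trunc N (ps_mul f g))`_n = (ps_trunc N f * ps_trunc N g)`_n.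
Proof. by move=> nN; rewrite coef_poly nN; apply: ps_mulE. Qed.

Fact ps_mulA : associative ps_mul.
Proof.
move=> f g h; apply/funext => n; rewrite !(@ps_mulE n.+1)//.
transitivity ((ps_trunc n.+1 f * (ps_trunc n.+1 g * ps_trunc n.+1 h))`_n).
  by apply: coefM_eq => // i ni; apply: ps_trunc_mul.
by rewrite mulrA; apply: coefM_eq => // i ni; rewrite ps_trunc_mul.
Qed.

Fact ps_mulC : commutative ps_mul.
Proof. by move=> f g; apply/funext => n; rewrite !(@ps_mulE n.+1)// mulrC. Qed.

Fact ps_mul1 : left_id (ps_const 1) ps_mul.
Proof.
move=> f; apply/funext => n; rewrite /ps_mul big_ord_recl/= mul1r subn0.
by rewrite big1 ?addr0// => i _; rewrite mul0r.
Qed.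

Fact ps_mulDl : left_distributive ps_mul +%R.
Proof.
by move=> f g h; apply/funext => n; rewrite /ps_mul -[RHS]big_split; apply: eq_bigr => i _; exact: mulrDl.
Qed.

Fact ps_1neq0 : ps_const 1 != 0 :> ps.
Proof. by apply/eqP => /(congr1 (fun f : ps => f 0%N))/= /eqP; rewrite oner_eq0. Qed.

HB.instance Definition _ :=
  GRing.Zmodule_isComNzRing.Build ps ps_mulA ps_mulC ps_mul1 ps_mulDl ps_1neq0.

Lemma psD (f g : ps) n : (f + g) n = f n + g n. Proof. by []. Qed.
Lemma psB (f g : ps) n : (f - g) n = f n - g n. Proof. by []. Qed.
Lemma psM (f g : ps) n : (f * g) n = \sum_(i < n.+1) f i * g (n - i)%N. Proof. by []. Qed.
Lemma ps1 n : (1 : ps) n = (n == 0%N)%:R. Proof. by case: n. Qed.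

Lemma ps_const_zmod : zmod_morphism ps_const.
Proof. by move=> x y; apply/funext => -[|n] //; rewrite psB/= subr0. Qed.

Lemma ps_const_monoid : monoid_morphism ps_const.
Proof.
split=> // x y; apply/funext => n; rewrite psM big_ord_recl/= subn0.
rewrite big1 ?addr0; first by case: n => [|n] //=; rewrite mulr0.
by move=> i _; rewrite mul0r.
Qed.

HB.instance Definition _ := GRing.isZmodMorphism.Build R ps ps_const ps_const_zmod.
HB.instance Definition _ := GRing.isMonoidMorphism.Build R ps ps_const ps_const_monoid.

Definition psX : ps := fun n => (n == 1%N)%:R.

Definition ps_shift (f : ps) : ps := fun n => f n.+1.

Lemma psXM (f : ps) n : (psX * f) n = if n is n'.+1 then f n' else 0.
Proof.
rewrite psM big_ord_recl/= mul0r add0r; case: n => [|n]; first by rewrite big_ord0.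
rewrite big_ord_recl/= mul1r subn1 big1 ?addr0// => i _.
by rewrite mul0r.
Qed.

Lemma psXnM (f : ps) m n : (psX ^+ m * f) n = if (m <= n)%N then f (n - m)%N else 0.
Proof.
elim: m n => [|m IH] n; first by rewrite mul1r subn0.
by rewrite exprS -mulrA psXM; case: n => [|n] //; rewrite IH.
Qed.

Lemma ps_split (f : ps) : f = ps_const (f 0%N) + psX * ps_shift f.
Proof. by apply/funext => -[|n]; rewrite psD psXM/= ?addr0 ?add0r. Qed.

(** Here v is the order of f; the nonzero coefficient [g 0] is what induction on the number of
    variables is applied to. *)
Lemma ps_factor (f : ps) : f <> 0 -> exists v g, f = psX ^+ v * g /\ g 0%N <> 0.
Proof.
move=> f0; have [n fn] : exists n, f n != 0.
  by apply: contrapT => h; apply: f0; apply/funext => n; apply/eqP/negPn/negP => fn; apply: h; exists n.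
case: (ex_minnP (ex_intro (fun n => f n != 0) n fn)) => v fv vmin.
exists v, (fun n => f (v + n)%N); split; last by rewrite addn0; apply/eqP.
apply/funext => i; rewrite psXnM; case: leqP => vi; first by rewrite subnKC.
by apply/eqP/negPn/negP => /vmin; rewrite leqNgt vi.
Qed.

Lemma ps_no_zero_div : no_zero_div R -> no_zero_div ps.
Proof.
move=> dom f g; case: (pselect (f = 0)) => [|f0 fg]; first by left.
right; apply: contrapT => g0.
have [v [f' [fE f'0]]] := ps_factor f0; have [w [g' [gE g'0]]] := ps_factor g0.
have := congr1 (fun f : ps => f (v + w)%N) fg.
rewrite fE gE mulrACA -exprD psXnM leqnn subnn psM big_ord1 => /dom[].
  exact: f'0.
exact: g'0.
Qed.

Lemma psX_neq0 : psX <> 0.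
Proof. by move/(congr1 (fun f : ps => f 1%N))/eqP; rewrite [_ 1%N]/(1) oner_eq0. Qed.

End PowerSeries.

Section RegularLike.
Variables (k B : comNzRingType) (io : {rmorphism k -> B}).

Definition box n (X : seq B) : set B := lideal [seq x ^+ n | x <- X].

(* The two numerical properties of k[[X_1, ..., X_d]] on which the asymptotic
   estimates rest: B/(X_i^n) is spanned by n^d elements, and B/(delta, X_i^n)
   by O(n^(d-1)) elements as soon as delta is nonzero. *)
Definition regular_like (X : seq B) : Prop :=
  [/\ no_zero_div B, forall x, x \in X -> x <> 0,
      forall n, exists t, size t = (n ^ size X)%N /\ spans io (box n X) setT t
    & forall de, de <> 0 -> exists K, forall n, exists t,
        (size t * n <= K * n ^ size X)%N /\
        spans io (addsp (box n X) (lideal [:: de])) setT t].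

End RegularLike.

(** Every nonzero delta is a unit here, so B/(delta) needs no generator and the constant 0 works.
    The torsion bound is stated after multiplication by n so that it makes sense in this case d =
    0. *)
Lemma regular_like_field (k : fieldType) : regular_like (idfun : {rmorphism k -> k}) [::].
Proof.
split => //.
- by move=> x y /eqP; rewrite mulf_eq0 => /orP[]/eqP; auto.
- move=> n; exists [:: 1]; rewrite expn0; split => // x _; exists 0, x.
  by rewrite add0r; split => //=; exists x; rewrite mulr1 subrr.
- move=> de de0; exists 0%N => n; exists [::]; split => // x _; exists x, 0.
  rewrite addr0; split => //; exists 0, x; rewrite add0r; split => //=.
  by exists (x / de); rewrite divfK ?subrr//; apply/eqP.
Qed.

Lemma lideal1E (A : comNzRingType) (a x : A) : lideal [:: a] x <-> exists b, x = b * a.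
Proof.
split=> /= -[b]; first by move/eqP; rewrite subr_eq0 => /eqP ->; exists b.
by move=> ->; exists b; rewrite subrr.
Qed.

Lemma lideal_ideal (A : comNzRingType) (s : seq A) : is_ideal (lideal s).
Proof. exact: inspan_subsp. Qed.

Section RegularStep.
Variables (k B : comNzRingType) (io : {rmorphism k -> B}) (X : seq B).
Hypothesis regX : regular_like io X.

Let io' : {rmorphism k -> ps B} := (@ps_const B) \o io.
Let X' : seq (ps B) := psX B :: map (@ps_const B) X.

Lemma box_const n x : box n X x -> box n X' (ps_const x).
Proof.
move=> bx; rewrite /box /X' map_cons; apply: inspan_cons; rewrite -map_comp.
have -> : [seq ((fun x0 => x0 ^+ n) \o (@ps_const B)) i | i <- X] =
   map (@ps_const B) [seq y ^+ n | y <- X].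
  by rewrite -map_comp; apply: eq_map => y /=; rewrite rmorphXn.
move: bx; rewrite /box; move: [seq y ^+ n | y <- X] => t.
elim: t x => [|y t IH] x /=; first by move=> ->; rewrite rmorph0.
by move=> [a /IH]; rewrite rmorphB rmorphM; exists (ps_const a).
Qed.

Lemma inspan_const a t v : inspan io t v ->
  inspan io' [seq a * ps_const y | y <- t] (a * ps_const v).
Proof.
elim: t v => [|y t IH] v /=; first by move=> ->; rewrite rmorph0 mulr0.
by move=> [c /IH]; rewrite rmorphB rmorphM mulrBr mulrCA => ?; exists c.
Qed.

Lemma box_psX n f : box n X' (psX B ^+ n * f).
Proof.
apply: (is_idealMr (I := box n X')); first exact: lideal_ideal.
by rewrite /box /X' map_cons; apply/inspan_mem/mem_head.
Qed.

(** The series are filtered by the n layers X^i B. For the box each layer costs n^d generators, with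
    d the former number of variables. If delta = X^v g with g(0) nonzero, the layers i < v still
    cost n^d each, while for i >= v the multiples of X^(i-v) delta = X^i g kill g(0) in layer i,
    leaving K n^(d-1) generators. The total is at most (v + K) n^d. *)
Lemma regular_like_ps : regular_like io' X'.
Proof.
have [dom X0 boxX torX] := regX.
have sX' : size X' = (size X).+1 by rewrite /= size_map.
split.
- exact: ps_no_zero_div.
- move=> x; rewrite inE => /orP[/eqP->|/mapP[y yX ->]]; first exact: psX_neq0.
  by move/(congr1 (fun f : ps B => f 0%N)); apply: X0.
- move=> n; have [t [st tsp]] := boxX n.
  pose t' i := [seq psX B ^+ i * ps_const y | y <- t].
  exists (flatten [seq t' i | i <- iota 0 n]); split.
    rewrite size_flatten /shape -map_comp (eq_map (g := fun=> (n ^ size X)%N)); last first.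
      by move=> i /=; rewrite size_map.
    by rewrite sX' expnS sumnE big_map big_const_seq count_predT size_iota iter_addn_0 mulnC.
  move=> f _.
  apply: (@filt_span _ _ io' _ (fun i => [set psX B ^+ i * g | g in setT]) t' n).
  + exact/ideal_subsp/lideal_ideal.
  + move=> i _ _ [g _ <-]; have [u [v [Uu tv gE]]] := tsp (g 0%N) I.
    exists (psX B ^+ i * ps_const v), (psX B ^+ i * ps_const u); split.
    * exact: inspan_const.
    * by apply: (is_idealMl (I := box n X')); [exact: lideal_ideal | apply: box_const].
    * exists (ps_shift g) => //; rewrite [in RHS](ps_split g) gE rmorphD exprSr; ring.
  + by move=> _ [g _ <-]; apply: box_psX.
  + by exists f => //; rewrite mul1r.
- move=> de de0; have [v [g [deE g0]]] := ps_factor de0.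
  have [K torK] := torX _ g0.
  exists (v + K)%N => n; have [t [st tsp]] := torK n; have [t1 [st1 tsp1]] := boxX n.
  pose t' i := [seq psX B ^+ i * ps_const y | y <- if (i < v)%N then t1 else t].
  have sU : is_ideal (addsp (box n X') (lideal [:: de])) by apply: addsp_subsp; apply: lideal_ideal.
  exists (flatten [seq t' i | i <- iota 0 n]); split.
    rewrite size_flatten /shape -map_comp sumnE big_map.
    have st' i : size (t' i) = if (i < v)%N then (n ^ size X)%N else size t.
      by rewrite size_map; case: ifP.
    under eq_bigr do rewrite /= st'.
    apply: (@leq_trans ((v * n ^ size X + n * size t) * n)); last first.
      rewrite sX' expnS; move: st; set m := (n ^ size X)%N => st.
      have := leq_mul (leqnn n) st; lia.
    rewrite leq_mul2r; apply/orP; right.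
    apply: (@leq_trans (\sum_(j <- iota 0 n) ((if (j < v)%N then n ^ size X else 0) + size t))%N).
      by apply: leq_sum => i _; case: ifP => _; rewrite ?leq_addr.
    rewrite big_split/= leq_add//; last first.
      by rewrite big_const_seq count_predT size_iota iter_addn_0 mulnC.
    rewrite -big_mkcond/= big_const_seq iter_addn_0 mulnC leq_mul2r; apply/orP; right.
    rewrite -size_filter -[X in (_ <= X)%N](size_iota 0).
    apply: uniq_leq_size => [|i]; first by rewrite filter_uniq// iota_uniq.
    by rewrite mem_filter !mem_iota => /andP[].
  move=> f _.
  apply: (@filt_span _ _ io' _ (fun i => [set psX B ^+ i * g | g in setT]) t' n).
  + exact: ideal_subsp.
  + move=> i _ _ [h _ <-].
    have bU : box n X' `<=` addsp (box n X') (lideal [:: de]) by apply: addspl; exact: inspan0.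
    rewrite /t'; case: ifPn => iv.
      have [u [w [Uu tw hE]]] := tsp1 (h 0%N) I.
      exists (psX B ^+ i * ps_const w), (psX B ^+ i * ps_const u); split.
      * exact: inspan_const.
      * by apply: (is_idealMl _ sU); apply/bU/box_const.
      * exists (ps_shift h) => //; rewrite [in RHS](ps_split h) hE rmorphD exprSr; ring.
    have [_ [w [[u [_ [Uu /lideal1E[b ->] ->]] tw hE]]]] := tsp (h 0%N) I.
    exists (psX B ^+ i * ps_const w),
       (psX B ^+ i * ps_const u + psX B ^+ (i - v) * ps_const b * de); split.
    * exact: inspan_const.
    * have [_ UD _] := sU; apply: UD.
        by apply: (is_idealMl _ sU); apply/bU/box_const.
      apply: (is_idealMl _ sU); apply: addspr; first exact: inspan0.
      by apply/inspan_mem/mem_head.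
    * exists (ps_shift h - ps_const b * ps_shift g) => //.
      have -> : psX B ^+ (i - v) * ps_const b * de = psX B ^+ i * ps_const b * g.
        rewrite deE; have -> : psX B ^+ i = psX B ^+ (i - v) * psX B ^+ v.
          by rewrite -exprD subnK// leqNgt.
        by ring.
      rewrite [in RHS](ps_split h) hE !rmorphD rmorphM exprSr.
      have gE := ps_split g; set c := g 0%N in gE *.
      by set g1 := ps_shift g in gE *; rewrite gE; ring.
  + by move=> _ [h _ <-]; apply: addspl; [exact: inspan0 | exact: box_psX].
  + by exists f => //; rewrite mul1r.
Qed.

End RegularStep.

(** * Complete filtered rings *)

Record complete_filtration (A : comNzRingType) (F : nat -> set A) : Prop := {
  cf_ideal n : is_ideal (F n);
  cf_top a : F 0%N a;
  cf_succ n a : F n.+1 a -> F n a;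
  cf_mul m n a b : F m a -> F n b -> F (m + n)%N (a * b);
  cf_separated a : (forall n, F n a) -> a = 0;
  cf_sum (c : nat -> A) : (forall n, F n (c n)) ->
    exists S, forall n, F n (S - \sum_(i < n) c i)
}.

Section Complete.
Variables (A : comNzRingType) (F : nat -> set A).
Hypothesis cF : complete_filtration F.

Lemma cf0 n : F n 0. Proof. by have [] := cf_ideal cF n. Qed.
Lemma cfD n a b : F n a -> F n b -> F n (a + b). Proof. by have [_ + _] := cf_ideal cF n; apply. Qed.
Lemma cfM n a b : F n b -> F n (a * b). Proof. by have [_ _] := cf_ideal cF n; apply. Qed.
Lemma cfMr n a b : F n a -> F n (a * b). Proof. by rewrite mulrC; apply: cfM. Qed.
Lemma cfN n a : F n a -> F n (- a). Proof. by rewrite -mulN1r; apply: cfM. Qed.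
Lemma cfB n a b : F n a -> F n b -> F n (a - b).
Proof. by move=> Fa Fb; apply: cfD => //; apply: cfN. Qed.

Lemma cf_le m n a : (m <= n)%N -> F n a -> F m a.
Proof. by move=> /subnK <-; elim: (n - m)%N => [//|d IH] /(cf_succ cF). Qed.

Lemma cfX n a : F 1%N a -> F n (a ^+ n).
Proof.
move=> Fa; elim: n => [|n IH]; first exact: cf_top.
by rewrite exprS -add1n; apply: cf_mul.
Qed.

Lemma cf_eq a b : (forall n, F n (a - b)) -> a = b.
Proof. by move/(cf_separated cF)/eqP; rewrite subr_eq0 => /eqP. Qed.

Lemma cf_sumr (I : Type) (r : seq I) (P : pred I) (G : I -> A) n :
  (forall i, P i -> F n (G i)) -> F n (\sum_(i <- r | P i) G i).
Proof. by move=> FG; elim/big_ind: _ => //; [exact: cf0 | exact: cfD]. Qed.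

Section Series.
Variable x : A.
Hypothesis Fx : F 1%N x.

Definition series (c : nat -> A) : A :=
  xget 0 [set S | forall n, F n (S - \sum_(i < n) c i * x ^+ i)].

Lemma seriesP (c : nat -> A) n : F n (series c - \sum_(i < n) c i * x ^+ i).
Proof.
have [S HS] : exists S, forall n, F n (S - \sum_(i < n) c i * x ^+ i).
  by apply: (@cf_sum _ _ cF (fun i => c i * x ^+ i)) => i; apply: cfM; apply: cfX.
exact: (@xgetPex _ 0 [set S | forall n, F n (S - \sum_(i < n) c i * x ^+ i)] (ex_intro _ S HS)).
Qed.

Lemma series_uniq (c : nat -> A) S : (forall n, F n (S - \sum_(i < n) c i * x ^+ i)) -> series c = S.
Proof.
move=> HS; apply: cf_eq => n.
set u := \sum_(i < n) c i * x ^+ i.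
have -> : series c - S = (series c - u) - (S - u) by ring.
by apply: cfB; [apply: seriesP | apply: HS].
Qed.

End Series.

Section Extension.
Variables (B : comNzRingType) (be : {rmorphism B -> A}) (x : A).
Hypothesis Fx : F 1%N x.

Definition ps_ext (f : ps B) : A := series x (fun i => be (f i)).

Lemma ps_ext_zmod : zmod_morphism ps_ext.
Proof.
move=> f g; apply: series_uniq => // n.
have -> : \sum_(i < n) be ((f - g) i) * x ^+ i =
   \sum_(i < n) be (f i) * x ^+ i - \sum_(i < n) be (g i) * x ^+ i.
  by rewrite -sumrB; apply: eq_bigr => i _; rewrite psB rmorphB mulrBl.
set u := \sum_(i < n) be (f i) * x ^+ i; set v := \sum_(i < n) be (g i) * x ^+ i.
have -> : ps_ext f - ps_ext g - (u - v) = (ps_ext f - u) - (ps_ext g - v) by ring.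
by apply: cfB; apply: seriesP.
Qed.

Lemma ps_ext_monoid : monoid_morphism ps_ext.
Proof.
split.
  apply: series_uniq => // -[|n]; first exact: cf_top.
  rewrite big_ord_recl/= ps1 eqxx !rmorph1 mulr1 big1 ?addr0 ?subrr; first exact: cf0.
  by move=> i _; rewrite ps1 rmorph0 mul0r.
move=> f g; apply: series_uniq => // n.
pose P (h : ps B) := (map_poly be (ps_trunc n h)).
have PE h : (P h).[x] = \sum_(i < n) be (h i) * x ^+ i.
  rewrite (@horner_coef_wide _ n); last by rewrite (leq_trans (size_poly _ _))// size_poly.
  by apply: eq_bigr => i _; rewrite coef_map coef_poly ltn_ord.
(* The product of the truncations is the truncation of the product plus a multiple of X^n, and x^n
   lies in F_n. *)
have PM : P f * P g = P (f * g) + drop_poly n (P f * P g) * 'X^n.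
  rewrite -[LHS](poly_take_drop n); congr (_ + _); apply/polyP => i.
  have -> : (P (f * g))`_i = if (i < n)%N then be ((f * g) i) else 0.
    by rewrite /P coef_map /ps_trunc coef_poly; case: ifP => // _; exact: (raddf0 be).
  rewrite coef_take_poly; case: ltnP => // ni.
  by rewrite -rmorphM coef_map; congr (be _); rewrite -(ps_mulE f g ni).
rewrite -PE.
have -> : ps_ext f * ps_ext g - (P (f * g)).[x] =
   (ps_ext f - (P f).[x]) * ps_ext g + (P f).[x] * (ps_ext g - (P g).[x])
   + (drop_poly n (P f * P g)).[x] * x ^+ n.
  have := congr1 (horner^~ x) PM; rewrite hornerD !hornerM hornerXn => e.
  by rewrite mulrBl mulrBr e; ring.
apply: cfD; last by apply: cfM; apply: cfX.
by apply: cfD; [apply: cfMr | apply: cfM]; rewrite PE; apply: seriesP.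
Qed.

Definition ps_ext_rmorphism : {rmorphism ps B -> A} := HB.pack ps_ext
  (GRing.isZmodMorphism.Build (ps B) A ps_ext ps_ext_zmod)
  (GRing.isMonoidMorphism.Build (ps B) A ps_ext ps_ext_monoid).

Lemma ps_ext_const b : ps_ext (ps_const b) = be b.
Proof.
apply: series_uniq => // -[|n]; first exact: cf_top.
rewrite big_ord_recl/= mulr1 big1 ?addr0 ?subrr; first exact: cf0.
by move=> i _; rewrite rmorph0 mul0r.
Qed.

Lemma ps_extX : ps_ext (psX B) = x.
Proof.
apply: series_uniq => // -[|[|n]].
- exact: cf_top.
- rewrite big_ord1 (_ : psX B _ = 0)// rmorph0 mul0r subr0; exact: Fx.
- rewrite !big_ord_recl big1 ?addr0; last first.
    by move=> i _; rewrite -[psX B _]/(0 : B) rmorph0 mul0r.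
  rewrite (_ : psX B _ = 0)// rmorph0 mul0r (_ : psX B _ = 1)// rmorph1 mul1r.
  by rewrite add0r subrr; exact: cf0.
Qed.

End Extension.

(** The parameters are adjoined one at a time. The extra ideal generated by ys makes the induction
    possible: the tail of xs is treated modulo x and ys, and then the generators are lifted from B
    to B[[X]], with X sent to x, by successive approximation in powers of x. *)
Lemma tower (k : fieldType) (sg : {rmorphism k -> A}) (xs w ys : seq A) :
  (forall x, x \in xs -> F 1%N x) ->
  (forall a, addsp (lideal ys) (addsp (lideal xs) (inspan sg w)) a) ->
  exists (B : comNzRingType) (io : {rmorphism k -> B}) (be : {rmorphism B -> A}) (X : seq B),
    [/\ regular_like io X, forall c, be (io c) = sg c, map be X = xs &
        forall a, addsp (lideal ys) (inspan be w) a].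
Proof.
elim: xs ys => [|x xs IH] ys Fxs gen.
  exists k, idfun, sg, [::]; split => //; first exact: regular_like_field.
  move=> a; have [y [z [ty [z1 [z2 [-> tz2 ->]]] ->]]] := gen a.
  by exists y, z2; rewrite add0r.
have [|a|B [io [be [X [regX bi bX genB]]]]] := IH (x :: ys).
- by move=> z zxs; apply: Fxs; rewrite inE zxs orbT.
- have [y [_ [yy [z1 [z2 [[b zb] wz2 ->]]] ->]]] := gen a.
  exists (b * x + y), (z1 - b * x + z2); split.
  + by exists b; rewrite addrC addKr.
  + by exists (z1 - b * x), z2.
  + by ring.
have Fx : F 1%N x by apply: Fxs; rewrite mem_head.
have st a : exists (cbh : (nat -> B) * A * (nat -> A)),
    a = \sum_(i < size w) be (cbh.1.1 i) * w`_i + cbh.1.2 * x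
       + \sum_(j < size ys) cbh.2 j * ys`_j.
  have [u [v [[b /inspan_coef[h hE]] /inspan_coef[c vE] aE]]] := genB a.
  exists (c, b, h); rewrite /= -vE -[\sum_(j < size ys) _]hE aE /=; ring.
have [f fE] := choice st.
(* Modulo ys, a is a B-combination of w plus x times t(a); the iterates of t produce the
   coefficients of all the series below. *)
pose t a := (f a).1.2.
exists (ps B), (@ps_const B \o io), (ps_ext_rmorphism be Fx), (psX B :: map (@ps_const B) X); split.
- exact: regular_like_ps.
- by move=> c /=; rewrite ps_ext_const.
- rewrite /= ps_extX// -map_comp; congr (_ :: _); rewrite -bX.
  by apply: eq_map => b /=; rewrite ps_ext_const.
move=> a.
exists (\sum_(j < size ys) series x (fun n => (f (iter n t a)).2 j) * ys`_j).
exists (\sum_(i < size w) ps_ext_rmorphism be Fx (fun n => (f (iter n t a)).1.1 i) * w`_i).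
split.
- exact: (inspan_sum idfun ys (fun j => series x (fun n => (f (iter n t a)).2 j))).
- exact: (inspan_sum (ps_ext_rmorphism be Fx) w (fun i => (fun n => (f (iter n t a)).1.1 i) : ps B)).
apply: cf_eq => n.
pose Sy n := \sum_(j < size ys) (\sum_(m < n) (f (iter m t a)).2 j * x ^+ m) * ys`_j.
pose Sw n := \sum_(i < size w) (\sum_(m < n) be ((f (iter m t a)).1.1 i) * x ^+ m) * w`_i.
have aE : a = Sy n + Sw n + iter n t a * x ^+ n.
  elim: n => [|n IHn].
    by rewrite /Sy /Sw !big1 ?add0r ?mulr1// => i _; rewrite big_ord0 mul0r.
  have SyE : Sy n.+1 = Sy n + (\sum_(j < size ys) (f (iter n t a)).2 j * ys`_j) * x ^+ n.
    rewrite /Sy mulr_suml -big_split; apply: eq_bigr => j _.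
    by rewrite big_ord_recr/= mulrDl; congr (_ + _); ring.
  have SwE : Sw n.+1 = Sw n + (\sum_(i < size w) be ((f (iter n t a)).1.1 i) * w`_i) * x ^+ n.
    rewrite /Sw mulr_suml -big_split; apply: eq_bigr => j _.
    by rewrite big_ord_recr/= mulrDl; congr (_ + _); ring.
  rewrite {1}IHn {1}(fE (iter n t a)) SyE SwE/= exprS.
  by rewrite -[(f (iter n t a)).1.2]/(t (iter n t a)); ring.
rewrite {1}aE.
set u := \sum_(j < _) series _ _ * _; set v := \sum_(i < _) ps_ext _ _ _ * _.
have -> : Sy n + Sw n + iter n t a * x ^+ n - (u + v) =
   iter n t a * x ^+ n - ((u - Sy n) + (v - Sw n)) by ring.
apply: cfB; first by apply: cfM; apply: cfX.
by apply: cfD; rewrite -sumrB; apply: cf_sumr => i _; rewrite -mulrBl; apply: cfMr; apply: seriesP.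
Qed.

End Complete.

(** * Coefficient fields *)

Lemma pchar_pnat (R : comNzRingType) p e : p \in [pchar R] -> [pchar R].-nat (p ^ e)%N.
Proof. by move=> cp; rewrite pnatX pnatE ?(pcharf_prime cp)// cp. Qed.

Lemma frobD (R : comNzRingType) p e (x y : R) : p \in [pchar R] ->
  (x + y) ^+ (p ^ e) = x ^+ (p ^ e) + y ^+ (p ^ e).
Proof. by move=> cp; apply/exprDn_pchar/pchar_pnat. Qed.

Lemma frobB (R : comNzRingType) p e (x y : R) : p \in [pchar R] ->
  (x - y) ^+ (p ^ e) = x ^+ (p ^ e) - y ^+ (p ^ e).
Proof. by move=> cp; rewrite (frobD _ _ _ cp) exprNn_pchar//; apply: pchar_pnat. Qed.

Lemma frob_sum (R : comNzRingType) p e (I : Type) (r : seq I) (P : pred I) (G : I -> R) :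
  p \in [pchar R] ->
  (\sum_(i <- r | P i) G i) ^+ (p ^ e) = \sum_(i <- r | P i) G i ^+ (p ^ e).
Proof.
move=> cp; elim/big_rec2: _ => [|i x y _ <-]; last by rewrite (frobD _ _ _ cp).
by rewrite expr0n expn_eq0 -leqn0 leqNgt prime_gt0 ?(pcharf_prime cp).
Qed.

Section PthRoot.
Variables (k : fieldType) (p : nat) (D : set k) (b : k).
Hypothesis pk : p \in [pchar k].
Hypothesis D1 : D 1.
Hypothesis DB : forall x y, D x -> D y -> D (x - y).
Hypothesis DM : forall x y, D x -> D y -> D (x * y).
Hypothesis Dp : forall x, D (x ^+ p).
Hypothesis Db : ~ D b.

Let D0 : D 0. Proof. by rewrite -(subrr 1); apply: DB. Qed.
Let DN x : D x -> D (- x). Proof. by rewrite -[- x]add0r; apply: DB. Qed.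
Let DD x y : D x -> D y -> D (x + y). Proof. by move=> Dx /DN; rewrite -{2}[y]opprK; apply: DB. Qed.
Let DX x n : D x -> D (x ^+ n).
Proof. by move=> Dx; elim: n => [|n IH] //; rewrite exprS; apply: DM. Qed.
Let Dn n : D n%:R. Proof. by elim: n => [|n IH] //; rewrite -natr1; apply: DD. Qed.
Let DV x : D x -> D x^-1.
Proof.
move=> Dx; have [->|x0] := eqVneq x 0; first by rewrite invr0.
have -> : x^-1 = x ^+ p.-1 * (x^-1) ^+ p.
  rewrite exprVn -{2}(prednK (prime_gt0 (pcharf_prime pk))) exprS invfM.
  by rewrite mulrCA mulfV ?mulr1// expf_neq0.
by apply: DM => //; apply: DX.
Qed.

Let overD (f : {poly k}) := forall i, D f`_i.

Let overDB f g : overD f -> overD g -> overD (f - g).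
Proof. by move=> Df Dg i; rewrite coefB; apply: DB. Qed.

(* A vanishing polynomial of minimal degree t < p with coefficients in D would
   divide X^p - b^p = (X - b)^p, hence be (X - b)^t, and its second coefficient
   would put b in D. *)
Lemma pth_root_indep (c : nat -> k) : (forall i, (i < p)%N -> D (c i)) ->
  \sum_(i < p) c i * b ^+ i = 0 -> forall i, (i < p)%N -> c i = 0.
Proof.
move=> Dc cb.
have p0 : (0 < p)%N := prime_gt0 (pcharf_prime pk).
pose Q n := `[< exists f : {poly k}, [/\ size f = n, overD f, f != 0 & root f b] >].
suff noQ n : (n <= p)%N -> ~ Q n.
  move=> i ip; apply: contrapT => ci.
  apply: (noQ (size (\poly_(i < p) c i)) (size_poly _ _)); apply/asboolP.
  exists (\poly_(i < p) c i); split=> //.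
  - by move=> j; rewrite coef_poly; case: ifP => // /Dc.
  - by apply/eqP => /(congr1 (fun f : {poly k} => f`_i)); rewrite coef_poly ip coef0.
  - rewrite /root horner_poly; apply/eqP; exact: cb.
move=> np Qn; have exQ : exists n, Q n by exists n.
case: (ex_minnP exQ) => m /asboolP[f [sf Df f0 fb]] mmin.
have mp : (m <= p)%N := leq_trans (mmin _ Qn) np.
wlog lf : f sf Df f0 fb / lead_coef f = 1.
  have lf0 : lead_coef f != 0 by rewrite lead_coef_eq0.
  move=> /(_ ((lead_coef f)^-1 *: f)); apply.
  - by rewrite size_scale// invr_eq0.
  - by move=> i; rewrite coefZ; apply: DM => //; apply: DV; apply: Df.
  - by rewrite scaler_eq0 invr_eq0 negb_or lf0.
  - by rewrite rootZ// invr_eq0.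
  - by rewrite lead_coefZ mulVf.
have m1 : (1 < m)%N.
  have := size_poly_eq0 f; rewrite (negbTE f0) sf leqNgt ltnS => m0.
  apply/negP; rewrite leq_eqVlt ltnS leqn0 m0 orbF -sf => /size_poly1P[c' c'0 fE].
  by move: fb; rewrite fE rootC (negbTE c'0).
(* Division by the monic f keeps the coefficients in D, so minimality of its size makes f divide
   every polynomial over D that vanishes at b. *)
have fdvd g : overD g -> root g b -> f %| g.
  elim: (size g) {-2}g (leqnn (size g)) => [|n' IH] {}g.
    by rewrite leqn0 size_poly_eq0 => /eqP->; rewrite dvdp0.
  move=> sg Dg gb; have [g0|g0] := eqVneq g 0; first by rewrite g0 dvdp0.
  have mg : (m <= size g)%N by apply: mmin; apply/asboolP; exists g.
  pose h := (lead_coef g *: 'X^(size g - m)) * f.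
  have sh : size h = size g.
    rewrite size_proper_mul.
      by rewrite size_scale ?lead_coef_eq0// size_polyXn sf addSn /= subnK.
    by rewrite lead_coefZ lead_coefXn mulr1 lf mulr1 lead_coef_eq0.
  have lh : lead_coef h = lead_coef g by rewrite lead_coefM lead_coefZ lead_coefXn lf !mulr1.
  have Dh : overD h.
    move=> i; rewrite /h -scalerAl coefZ coefXnM; apply: DM; first exact: Dg.
    by case: ifP => // _; apply: Df.
  have -> : g = (g - h) + h by rewrite subrK.
  rewrite dvdp_addl ?dvdp_mulIr//; apply: IH.
  - rewrite -ltnS; apply: leq_trans sg; have [->|gh0] := eqVneq (g - h) 0.
      by rewrite size_poly0 lt0n size_poly_eq0.
    rewrite ltn_neqAle; apply/andP; split; last first.
      by rewrite (leq_trans (size_polyD _ _))// size_polyN sh maxnn.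
    apply/eqP => sgh; move: gh0; rewrite -lead_coef_eq0 lead_coefE sgh coefB.
    by rewrite -lead_coefE -{1}sh -lead_coefE lh subrr eqxx.
  - exact: overDB.
  - by rewrite rootE hornerD hornerN hornerM (eqP fb) (eqP gb) mulr0 subr0.
have : f %| ('X - b%:P) ^+ p.
  have -> : ('X - b%:P) ^+ p = 'X^p - (b ^+ p)%:P.
    have pP : p \in [pchar {poly k}] by rewrite pchar_poly.
    by rewrite -[p]expn1 (frobB _ _ _ pP) polyC_exp.
  apply: fdvd; last by rewrite rootE hornerD hornerN hornerXn hornerC subrr.
  move=> i; rewrite coefB coefXn coefC; apply: DB => //.
  by case: ifP.
move=> /dvdp_exp_XsubCP[t tp]; rewrite eqp_monic ?monicE ?lf ?lead_coef_exp ?lead_coefXsubC ?expr1n//.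
move=> /eqP fE.
have tm : m = t.+1 by rewrite -sf fE size_exp_XsubC.
have : f`_t.-1 = - (t%:R * b).
  have t0 : (t != 0)%N by rewrite -lt0n -ltnS -tm.
  have := @coefPn_prod_XsubC _ (nseq t b); rewrite size_nseq => /(_ t0).
  rewrite !big_nseq -!Monoid.iteropE -/(GRing.exp _ _) => e.
  by rewrite fE mulr_natl -e.
move=> e; apply: Db.
have tk : t%:R != 0 :> k.
  rewrite -(dvdn_pcharf pk) gtnNdvd//; first by rewrite -ltnS -tm.
  by rewrite -tm.
have -> : b = - f`_t.-1 / t%:R by rewrite e opprK mulrAC mulfV// mul1r.
by apply: DM; [apply: DN; apply: Df | apply: DV].
Qed.

End PthRoot.

Section CoefficientField.
Variables (A : comNzRingType) (F : nat -> set A) (k : fieldType) (r : {rmorphism A -> k}) (p : nat).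
Hypothesis cF : complete_filtration F.
Hypothesis r_surj : forall c, exists a, r a = c.
Hypothesis r_ker : forall a, r a = 0 -> F 1%N a.
Hypothesis F_ker : forall a, F 1%N a -> r a = 0.
Hypothesis pk : p \in [pchar k].
Hypothesis pA : p \in [pchar A].

Definition hom_mod n (s : k -> A) : Prop :=
  [/\ F n (s 1 - 1), forall x y, F n (s (x - y) - (s x - s y))
    & forall x y, F n (s (x * y) - s x * s y)].

Section Lift.
Variables (n : nat) (s : k -> A).
Hypothesis n0 : (0 < n)%N.
Hypothesis sh : hom_mod n s.

Let pP : p \in [pchar (k * A)%type].
Proof.
rewrite inE (pcharf_prime pk)/=; apply/eqP/injective_projections.
  by rewrite (rmorph_nat fst) (pcharf0 pk).
by rewrite (rmorph_nat snd) (pcharf0 pA).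
Qed.

(** Since n >= 1 and p >= 2, a p-th power gains a level. Hence s(c)^p modulo F_(n+1) only depends on
    s(c) modulo F_n. *)
Let Fp a : F n a -> F n.+1 (a ^+ p).
Proof.
move=> Fa; have p2 := prime_gt1 (pcharf_prime pk).
apply: (cf_le cF (m := n.+1) (n := (n + n)%N)); first by rewrite -addn1 leq_add2l.
rewrite -(subnK p2) addn2 2!exprS mulrA; apply: (cfMr cF).
exact: (cf_mul cF).
Qed.

(* Partial lifts of s modulo F (n+1) are encoded by their graphs. *)
Definition partial_lift (G : set (k * A)) : Prop :=
  [/\ [/\ G 1, forall x y, G x -> G y -> G (x - y) & forall x y, G x -> G y -> G (x * y)],
      forall c a, F n.+1 (a - s c ^+ p) -> G (c ^+ p, a),
      forall c a, G (c, a) -> F n (a - s c)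
    & forall a, G (0, a) -> F n.+1 a].

Let s1 : F n (s 1 - 1). Proof. by case: sh. Qed.
Let sB x y : F n (s (x - y) - (s x - s y)). Proof. by case: sh. Qed.
Let sM x y : F n (s (x * y) - s x * s y). Proof. by case: sh. Qed.
Let s0 : F n (s 0).
Proof. by have := sB 0 0; rewrite subr0 subrr subr0. Qed.
Let sD x y : F n (s (x + y) - (s x + s y)).
Proof.
have := cfD cF (sB (x + y) y) (cf0 cF n); rewrite addr0 addrK => h.
by have := cfN cF h; congr (F n _); ring.
Qed.
Let sX x i : F n (s (x ^+ i) - s x ^+ i).
Proof.
elim: i => [//|i IH]; rewrite !exprS.
have := cfD cF (sM x (x ^+ i)) (cfM cF (s x) IH); congr (F n _); ring.
Qed.

Let frob1 (R : comNzRingType) (x y : R) : p \in [pchar R] -> (x - y) ^+ p = x ^+ p - y ^+ p.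
Proof. by move=> cp; have := frobB 1 x y cp; rewrite expn1. Qed.

(** On the subfield of p-th powers the lift is forced to be c^p -> s(c)^p. This is the smallest
    partial lift. *)
Let G0 : set (k * A) := [set x | exists c a, x = (c ^+ p, a) /\ F n.+1 (a - s c ^+ p)].

Lemma partial_lift0 : partial_lift G0.
Proof.
split; first split.
- exists 1, 1; split; first by rewrite expr1n.
  have := cfN cF (Fp s1); rewrite frob1// expr1n; congr (F _ _); ring.
- move=> _ _ [c [a [-> ac]]] [d [b [-> bd]]]; exists (c - d), (a - b).
  split; first by rewrite frob1.
  have := cfB cF (cfB cF ac bd) (Fp (sB c d)); rewrite !frob1//; congr (F _ _); ring.
- move=> _ _ [c [a [-> ac]]] [d [b [-> bd]]]; exists (c * d), (a * b).
  split; first by rewrite exprMn.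
  have := cfB cF (cfD cF (cfMr cF b ac) (cfM cF (s c ^+ p) bd)) (Fp (sM c d)).
  rewrite !frob1// exprMn; congr (F _ _); ring.
- by move=> c a ac; exists c, a.
- move=> _ a [c [_ [[-> <-] ac]]].
  have := cfB cF (cf_succ cF ac) (sX c p); congr (F _ _); ring.
- move=> a [c [_ [[/esym/eqP + <-] ac]]]; rewrite expf_eq0 => /andP[_ /eqP c0].
  have := cfD cF ac (Fp s0); rewrite c0; congr (F _ _); ring.
Qed.

Lemma partial_lift_max : exists G, partial_lift G /\
  forall G', partial_lift G' -> G `<=` G' -> G' `<=` G.
Proof.
(* [G0] is joined to every member so that the empty chain, whose union is empty, causes no
   exception. *)
have [C CP totC|X [PX Xmax]] := @Zorn_bigcup _ [set X | partial_lift (X `|` G0)].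
  case: (pselect (exists X, C X)) => [[X CX]|noC]; last first.
    rewrite /= (_ : \bigcup_(X in C) X = set0) ?set0U; first exact: partial_lift0.
    by rewrite -subset0 => x [Y CY _]; apply: noC; exists Y.
  have sub Y : C Y -> Y `|` G0 `<=` (\bigcup_(X in C) X) `|` G0.
    by move=> CY x [Yx|]; [left; exists Y | right].
  have two x y : ((\bigcup_(X in C) X) `|` G0) x -> ((\bigcup_(X in C) X) `|` G0) y ->
      exists Y, [/\ C Y, (Y `|` G0) x & (Y `|` G0) y].
    move=> [[Y CY Yx]|Gx] [[Z CZ Zy]|Gy].
    - have [YZ|ZY] := totC _ _ CY CZ; [exists Z | exists Y]; split => //; left => //.
        exact: YZ.
      exact: ZY.
    - by exists Y; split => //; [left | right].
    - by exists Z; split => //; [right | left].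
    - by exists X; split => //; right.
  split; first split.
  - by apply: (sub X CX); have [[? _ _] _ _ _] := CP X CX.
  - move=> x y Gx Gy; have [Y [CY Yx Yy]] := two x y Gx Gy.
    by apply: (sub Y CY); have [[_ YB _] _ _ _] := CP Y CY; apply: YB.
  - move=> x y Gx Gy; have [Y [CY Yx Yy]] := two x y Gx Gy.
    by apply: (sub Y CY); have [[_ _ YM] _ _ _] := CP Y CY; apply: YM.
  - by move=> c a ac; right; exists c, a.
  - by move=> c a Ga; have [Y [CY Ya _]] := two _ _ Ga Ga; have [_ _ Ys _] := CP Y CY; apply: Ys.
  - by move=> a Ga; have [Y [CY Ya _]] := two _ _ Ga Ga; have [_ _ _ Y0] := CP Y CY; apply: Y0.
exists (X `|` G0); split => // G' G'P sub.
have G'G : G' `|` G0 = G' by apply: setUidl => x G0x; apply: sub; right.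
apply: contrapT => nsub; apply: (Xmax G'); last by rewrite /= G'G.
split; first by move=> x Xx; apply: sub; left.
by move=> h; apply: nsub => x /h; left.
Qed.

(** A maximal partial lift is defined on all of k. If b were outside its domain D, then 1, b, ...,
    b^(p-1) would be independent over D while b^p lies in D, so the lift would extend to D[b] by
    sending b to s(b). *)
Lemma hom_lift : exists s' : k -> A, hom_mod n.+1 s' /\ forall c, F n (s' c - s c).
Proof.
have [G [[[G1 GB GM] Gp Gs G0F] Gmax]] := partial_lift_max.
have G00 : G 0 by rewrite -(subrr 1); apply: GB.
have GN x : G x -> G (- x) by rewrite -[- x]add0r; apply: GB.
have GD x y : G x -> G y -> G (x + y) by move=> Gx /GN; rewrite -{2}[y]opprK; apply: GB.
have GX x i : G x -> G (x ^+ i) by move=> Gx; elim: i => [|i IH] //; rewrite exprS; apply: GM.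
pose D := [set c | exists a, G (c, a)].
suff DT c : D c.
  have [s' Gs'] := choice DT; exists s'; split; last by move=> c; apply: Gs.
  split=> [|x y|x y]; apply: G0F.
  - by have := GB _ _ (Gs' 1) G1; congr (G _); congr (_, _); rewrite /= subrr.
  - have := GB _ _ (Gs' (x - y)) (GB _ _ (Gs' x) (Gs' y)).
    by congr (G _); congr (_, _); rewrite /= subrr.
  - have := GB _ _ (Gs' (x * y)) (GM _ _ (Gs' x) (Gs' y)).
    by congr (G _); congr (_, _); rewrite /= subrr.
move: c => b; apply: contrapT => Db.
have p0 : (0 < p)%N := prime_gt0 (pcharf_prime pk).
pose be : k * A := (b, s b).
pose G' := [set x | exists g : nat -> k * A, (forall i, G (g i)) /\ x = \sum_(i < p) g i * be ^+ i].
have pairX1 i : (be ^+ i).1 = b ^+ i by elim: i => [//|i IH]; rewrite !exprS /= IH.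
have pairX2 i : (be ^+ i).2 = s b ^+ i by elim: i => [//|i IH]; rewrite !exprS /= IH.
have G'D x y : G' x -> G' y -> G' (x + y).
  move=> [g [Gg ->]] [h [Gh ->]]; exists (fun i => g i + h i); split; first by move=> i; apply: GD.
  by rewrite -big_split; apply: eq_bigr => i _; rewrite mulrDl.
have G'0 : G' 0 by exists (fun=> 0); split=> //; rewrite big1// => i _; rewrite mul0r.
have G'N x : G' x -> G' (- x).
  move=> [g [Gg ->]]; exists (fun i => - g i); split; first by move=> i; apply: GN.
  by rewrite -sumrN; apply: eq_bigr => i _; rewrite mulNr.
have Gbep : G (be ^+ p).
  have -> : be ^+ p = (b ^+ p, s b ^+ p).
    by rewrite /be; elim: p => [//|m IH]; rewrite !exprS IH.
  by apply: Gp; rewrite subrr; apply: cf0.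
have G'be g m : G g -> G' (g * be ^+ m).
  move=> Gg; exists (fun i => if i == (m %% p)%N then g * (be ^+ p) ^+ (m %/ p) else 0).
  split; first by move=> i; case: ifP => // _; apply: GM => //; apply: GX.
  rewrite (bigD1 (Ordinal (ltn_pmod m p0)))//= eqxx big1 ?addr0; last first.
    move=> i; rewrite -val_eqE/= => /negbTE ->; exact: mul0r.
  by rewrite -mulrA -exprM -exprD mulnC -divn_eq.
have GG' : G `<=` G' by move=> g Gg; rewrite -[g]mulr1; apply: (G'be g 0%N).
have G'be1 : G' be by have := G'be 1 1%N G1; rewrite mul1r.
apply: (Db); exists (s b); apply: (Gmax G'); last exact: G'be1; last exact: GG'.
split; first split.
- exact: GG'.
- by move=> x y G'x /G'N; apply: G'D.
- move=> _ _ [g [Gg ->]] [h [Gh ->]]; rewrite mulr_suml.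
  elim/big_ind: _ => // i _; rewrite mulr_sumr; elim/big_ind: _ => // j _.
  by rewrite mulrACA -exprD; apply/G'be/GM.
- by move=> c a ac; apply/GG'/Gp.
- move=> c a [g [Gg gE]].
  have cE : c = \sum_(i < p) (g i).1 * b ^+ i.
    transitivity (fst (\sum_(i < p) g i * be ^+ i)); first by rewrite -gE.
    by rewrite (raddf_sum fst); apply: eq_bigr => i _; rewrite -pairX1.
  have aE : a = \sum_(i < p) (g i).2 * s b ^+ i.
    transitivity (snd (\sum_(i < p) g i * be ^+ i)); first by rewrite -gE.
    by rewrite (raddf_sum snd); apply: eq_bigr => i _; rewrite -pairX2.
  have Fq q : F n (\sum_(i < q) (g i).2 * s b ^+ i - s (\sum_(i < q) (g i).1 * b ^+ i)).
    elim: q => [|q IH]; first by rewrite !big_ord0 sub0r; apply: cfN.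
    rewrite !big_ord_recr/=.
    set u := \sum_(i < q) _ in IH *; set v := \sum_(i < q) _ in IH *.
    have h1 : F n ((g q).2 - s (g q).1) by apply: Gs; have := Gg q; case: (g q).
    have h2 := cfB cF (cfD cF IH (cfMr cF (s b ^+ q) h1))
      (cfD cF (sD v ((g q).1 * b ^+ q)) (sM (g q).1 (b ^+ q))).
    have := cfB cF h2 (cfM cF (s (g q).1) (sX b q)); congr (F _ _); ring.
  by rewrite aE cE; apply: Fq.
- move=> a [g [Gg gE]].
  have cE : \sum_(i < p) (g i).1 * b ^+ i = 0.
    transitivity (fst (\sum_(i < p) g i * be ^+ i)); last by rewrite -gE.
    by rewrite (raddf_sum fst); apply: eq_bigr => i _; rewrite -pairX1.
  have -> : a = \sum_(i < p) (g i).2 * s b ^+ i.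
    transitivity (snd (\sum_(i < p) g i * be ^+ i)); first by rewrite -gE.
    by rewrite (raddf_sum snd); apply: eq_bigr => i _; rewrite -pairX2.
  (* Independence of the powers of b makes the extension single-valued modulo F_(n+1). *)
  have g0 i : (i < p)%N -> (g i).1 = 0.
    apply: (@pth_root_indep k p D b pk _ _ _ _ Db (fun i => (g i).1)) cE i.
    - by exists 1.
    - by move=> x y [x' Gx] [y' Gy]; exists (x' - y'); apply: (GB _ _ Gx Gy).
    - by move=> x y [x' Gx] [y' Gy]; exists (x' * y'); apply: (GM _ _ Gx Gy).
    - by move=> x; exists (s x ^+ p); apply: Gp; rewrite subrr; apply: cf0.
    - by move=> i _; exists (g i).2; have := Gg i; case: (g i).
  apply: (cf_sumr cF) => i _; apply: (cfMr cF); apply: G0F.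
  by rewrite -(g0 i (ltn_ord i)); have := Gg i; case: (g i).
Qed.

End Lift.

(** Any set-theoretic section of r is a homomorphism modulo F_1. Its successive lifts agree to
    increasing precision, so they converge as telescoping series, and separatedness makes the limit
    a ring morphism. *)
Theorem coefficient_field : exists sg : {rmorphism k -> A}, forall c, r (sg c) = c.
Proof.
have [t0 t0E] := choice r_surj.
have t0h : hom_mod 1 t0.
  by split=> [|x y|x y]; apply: r_ker; rewrite ?rmorphB ?rmorphM !t0E ?rmorph1 ?rmorphB ?rmorphM ?subrr.
have st (n : nat) (s : k -> A) : exists s' : k -> A, hom_mod n.+1 s ->
    hom_mod n.+2 s' /\ forall c, F n.+1 (s' c - s c).
  case: (pselect (hom_mod n.+1 s)) => [hs|]; last by exists s.
  by have [s' hs'] := @hom_lift n.+1 s isT hs; exists s'.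
have [f fP] := choice (fun ns : nat * (k -> A) => st ns.1 ns.2).
pose t := fix t n := if n is n'.+1 then f (n', t n') else t0.
have th n : hom_mod n.+1 (t n).
  by elim: n => [|n IH] //=; have [] := fP (n, t n) IH.
have tS n c : F n.+1 (t n.+1 c - t n c) by have [_] := fP (n, t n) (th n); apply.
have lim c : exists S, forall n, F n.+1 (S - t n c).
  have [n|S SE] := @cf_sum _ _ cF (fun n => if n is n'.+1 then t n'.+1 c - t n' c else t0 c).
    by case: n => [|n]; [exact: cf_top | exact: tS].
  exists S => n; have := SE n.+1.
  rewrite big_ord_recl /= (_ : \sum_(i < n) _ = t n c - t0 c).
    by congr (F _ _); ring.
  elim: n => [|n IH]; first by rewrite big_ord0 subrr.
  by rewrite big_ord_recr IH/=; ring.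
have [sg sgE] := choice lim.
have close n (x y : A) (H : F n.+1 (x - y)) : F n (x - y) by exact: cf_succ H.
have sgB : zmod_morphism sg.
  move=> x y; apply: (cf_eq cF) => n; apply: (cf_succ cF).
  have [_ hB _] := th n.
  have := cfB cF (cfD cF (sgE (x - y) n) (hB x y)) (cfB cF (sgE x n) (sgE y n)).
  congr (F _ _); ring.
have sgM : monoid_morphism sg.
  split.
    apply: (cf_eq cF) => n; apply: (cf_succ cF); have [h1 _ _] := th n.
    have := cfD cF (sgE 1 n) h1; congr (F _ _); ring.
  move=> x y; apply: (cf_eq cF) => n; apply: (cf_succ cF).
  have [_ _ hM] := th n.
  have := cfB cF (cfD cF (sgE (x * y) n) (hM x y))
    (cfD cF (cfMr cF (sg y) (sgE x n)) (cfM cF (t n x) (sgE y n))).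
  congr (F _ _); ring.
pose sg' : {rmorphism k -> A} := HB.pack sg (GRing.isZmodMorphism.Build k A sg sgB)
  (GRing.isMonoidMorphism.Build k A sg sgM).
exists sg' => c; rewrite /sg' /=.
have := F_ker (sgE c 0%N); rewrite rmorphB /= t0E => /eqP.
by rewrite subr_eq0 => /eqP.
Qed.

End CoefficientField.

(** * Spans of p-th powers *)

Lemma no_zero_divX (B : comNzRingType) (x : B) n : no_zero_div B -> x <> 0 -> x ^+ n <> 0.
Proof.
move=> dom x0; elim: n => [|n IH]; first by apply/eqP/oner_neq0.
by rewrite exprS => /dom[].
Qed.

Section Estimates.
Variables (k A B : comNzRingType) (sg : {rmorphism k -> A}).
Variables (io : {rmorphism k -> B}) (be : {rmorphism B -> A}).
Hypothesis bi : forall c, be (io c) = sg c.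

Lemma subsp_restr U : subsp be U -> subsp sg U.
Proof. by move=> [U0 UD UZ]; split => // c x; rewrite -bi; apply: UZ. Qed.

Lemma span_transfer (J : set B) (tB : seq B) (U : set A) (m : seq A) : subsp be U ->
  spans io J setT tB -> (forall b y, J b -> y \in m -> U (be b * y)) ->
  exists t, size t = (size m * size tB)%N /\ spans sg U (inspan be m) t.
Proof.
move=> sU sJ; have [U0 UD UZ] := sU.
elim: m => [|y m IH] Jm.
  by exists [::]; split => // x ->; exists 0, 0; rewrite addr0.
have [t [st tsp]] := IH (fun b z Jb zm => Jm b z Jb (mem_behead (s := y :: m) zm)).
exists ([seq be z * y | z <- tB] ++ t); split; first by rewrite size_cat size_map st mulSn.
move=> x [b /tsp[u [v [Uu tv xE]]]]; have [j [b' [Jj tb' bE]]] := sJ b I.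
exists (be j * y + u), (be b' * y + v); split.
- by apply: UD => //; apply: Jm => //; apply: mem_head.
- apply/inspan_cat; exists (be b' * y); rewrite addrC addKr; split => //.
  elim: tB b' tb' {sJ bE IH st} => [|z tB IHt] b' /=; first by move=> ->; rewrite rmorph0 mul0r.
  by move=> [c /IHt]; rewrite rmorphB rmorphM bi mulrBl -mulrA => ?; exists c.
- by rewrite -[x](subrK (be b * y)) xE bE rmorphD; ring.
Qed.

Variable X : seq B.
Hypothesis regX : regular_like io X.

Lemma est_box n (U : set A) (m : seq A) : subsp be U ->
  (forall x y, x \in X -> y \in m -> U (be x ^+ n * y)) ->
  exists t, size t = (size m * n ^ size X)%N /\ spans sg U (inspan be m) t.
Proof.
move=> sU Um; have [_ _ boxX _] := regX; have [tB [<- sB]] := boxX n.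
apply: span_transfer sB _ => // b y bb ym.
have [U0 UD UZ] := sU.
apply: (@inspan_sub _ _ _ _ [set b | U (be b * y)] _ _ b bb).
  split; rewrite /= ?rmorph0 ?mul0r//.
    by move=> c c' Uc Uc'; rewrite rmorphD mulrDl; apply: UD.
  by move=> c c' Uc; rewrite rmorphM -mulrA; apply: UZ.
by move=> _ /mapP[x xX ->]; rewrite /= rmorphXn; apply: Um.
Qed.

(** The constant K depends on delta alone. This uniformity in n and U is what makes error terms
    indexed by e of order q^(d-1). *)
Lemma est_tor de : de <> 0 -> exists K, forall n (U : set A) (m : seq A), subsp be U ->
  (forall x y, x \in X -> y \in m -> U (be x ^+ n * y)) ->
  (forall y, y \in m -> U (be de * y)) ->
  exists t, (size t * n <= size m * K * n ^ size X)%N /\ spans sg U (inspan be m) t.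
Proof.
move=> de0; have [_ _ _ torX] := regX; have [K HK] := torX de de0; exists K => n U m sU Um Ud.
have [tB [stB sB]] := HK n.
have [|t [st ts]] := @span_transfer _ tB U m sU sB.
  have [U0 UD UZ] := sU.
  move=> _ y [b [c [bb /lideal1E[c' ->] ->]]] ym; rewrite rmorphD mulrDl; apply: (UD).
    apply: (@inspan_sub _ _ _ _ [set b | U (be b * y)] _ _ b bb).
      split; rewrite /= ?rmorph0 ?mul0r//.
        by move=> d d' Uc Uc'; rewrite rmorphD mulrDl; apply: UD.
      by move=> d d' Uc; rewrite rmorphM -mulrA; apply: UZ.
    by move=> _ /mapP[x xX ->]; rewrite /= rmorphXn; apply: Um.
  by rewrite rmorphM -mulrA; apply/UZ/Ud.
by exists t; split => //; rewrite st -!mulnA leq_mul2l stB orbT.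
Qed.

End Estimates.

Section Stabilization.
Variables (A B : comNzRingType) (be : {rmorphism B -> A}) (w : seq A) (p : nat).
Hypothesis domB : no_zero_div B.
Hypothesis pA : p \in [pchar A].
Hypothesis gen : forall a, inspan be w a.

Definition frob_list j (t : seq A) : seq A := [seq y ^+ (p ^ j) | y <- t].

Lemma inspan_frob j t x : inspan be t x -> inspan be (frob_list j t) (x ^+ (p ^ j)).
Proof.
move=> /inspan_coef[c ->]; rewrite (frob_sum _ _ _ _ pA).
apply: (subsp_sum _ (inspan_subsp be _)) => i _.
rewrite exprMn -rmorphXn; apply/inspanZ/inspan_mem.
by apply/mapP; exists t`_i => //; apply: mem_nth.
Qed.

Lemma frob_list_comp i j t : frob_list i (frob_list j t) = frob_list (j + i) t.
Proof. by rewrite /frob_list -map_comp; apply: eq_map => y /=; rewrite -exprM -expnD. Qed.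

(** The product of two p^j-th powers is the p^j-th power of an element of A, and all of those lie in
    the span, because w generates A and Frobenius is additive. *)
Lemma frob_span_mul j a b : inspan be (frob_list j w) a -> inspan be (frob_list j w) b ->
  inspan be (frob_list j w) (a * b).
Proof.
move=> sa sb; have ss := inspan_subsp be (frob_list j w); have [_ SD SZ] := ss.
apply: (@inspan_sub _ _ be _ [set a | inspan be (frob_list j w) (a * b)] _ _ a sa).
  split; rewrite /= ?mul0r; first exact: inspan0.
    by move=> x y ? ?; rewrite mulrDl; apply: SD.
  by move=> c x ?; rewrite -mulrA; apply: SZ.
move=> _ /mapP[x _ ->] /=; rewrite mulrC.
apply: (@inspan_sub _ _ be _ [set b | inspan be (frob_list j w) (b * x ^+ (p ^ j))] _ _ b sb).
  split; rewrite /= ?mul0r; first exact: inspan0.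
    by move=> y z ? ?; rewrite mulrDl; apply: SD.
  by move=> c y ?; rewrite -mulrA; apply: SZ.
by move=> _ /mapP[y _ ->] /=; rewrite -exprMn; apply: inspan_frob.
Qed.

Lemma frob_span1 j : inspan be (frob_list j w) 1.
Proof. by rewrite -(expr1n _ (p ^ j)); apply: inspan_frob. Qed.

(** The spans N_j decrease. If no N_j stabilized, one could pick u_j in N_j with no nonzero
    B-multiple in N_(j+1). Among the first [size w + 1] of the u_j there is a nontrivial B-relation,
    because w generates A; its lowest nonzero term would put a nonzero multiple of some u_m in
    N_(m+1). *)
Lemma frob_span_stab : exists j de, de <> 0 /\
  forall u, inspan be (frob_list j w) u -> inspan be (frob_list j.+1 w) (be de * u).
Proof.
apply: contrapT => nostab.
pose Nj j := inspan be (frob_list j w).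
have Nsucc j i : (j <= i)%N -> Nj i `<=` Nj j.
  move=> /subnK <-; apply: inspan_sub; first exact: inspan_subsp.
  move=> _ /mapP[y _ ->]; rewrite expnD exprM; exact: inspan_frob.
have nt j : exists u, Nj j u /\ forall b, b <> 0 -> ~ Nj j.+1 (be b * u).
  apply: contrapT => h; apply: nostab; exists j.
  (* Otherwise each generator has a nonzero multiple in the next span, and the product of these
     multipliers stabilizes the whole of N_j. *)
  have {}h y : y \in frob_list j w -> exists b, b <> 0 /\ Nj j.+1 (be b * y).
    move=> yw; apply: contrapT => nb; apply: h; exists y; split; first exact: inspan_mem.
    by move=> b b0 nyb; apply: nb; exists b.
  rewrite /Nj in h; elim: (frob_list j w) h => [|y t IH] h.
    exists 1; split; first by apply/eqP/oner_neq0.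
    by move=> _ ->; rewrite mulr0; apply: inspan0.
  have [de [de0 deP]] := IH (fun z zt => h z (mem_behead (s := y :: t) zt)).
  have [b [b0 by_]] := h y (mem_head _ _).
  exists (de * b); split; first by move=> /domB[].
  move=> u [c cu]; rewrite -[u](subrK (be c * y)) mulrDr.
  apply: inspanD.
    by rewrite rmorphM [_ * be b]mulrC -mulrA; apply/inspanZ/deP.
  have -> : be (de * b) * (be c * y) = be (de * c) * (be b * y) by rewrite !rmorphM; ring.
  exact: inspanZ.
have [u uP] := choice nt.
have uc i : exists c : nat -> B, u i = \sum_(j < size w) be (c j) * w`_j by apply: inspan_coef.
have [c cE] := choice uc.
have [v [[i0 vi0] vM]] := left_kernel domB (fun (i : 'I_(size w).+1) (j : 'I_(size w)) => c i j).
have rel : \sum_i be (v i) * u i = 0.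
  under eq_bigr do rewrite cE mulr_sumr.
  rewrite exchange_big big1// => j _.
  under eq_bigr do rewrite mulrA -rmorphM.
  by rewrite -mulr_suml -rmorph_sum vM rmorph0 mul0r.
pose Q i := `[< exists h : (i < (size w).+1)%N, v (Ordinal h) <> 0 >].
have exQ : exists i, Q i.
  exists i0; apply/asboolP; exists (ltn_ord i0).
  by rewrite (_ : Ordinal _ = i0)//; apply: val_inj.
case: (ex_minnP exQ) => m /asboolP[h vm] mmin.
have [_ /(_ _ vm)] := uP m; apply.
have := rel; rewrite (bigD1 (Ordinal h))//= => /eqP; rewrite addr_eq0 => /eqP ->.
apply: (subspN (inspan_subsp be _)); apply: (subsp_sum _ (inspan_subsp be _)) => i im.
have [vi|vi] := pselect (v i = 0); first by rewrite vi rmorph0 mul0r; apply: inspan0.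
apply: inspanZ; apply: (Nsucc m.+1 i); last by have [] := uP i.
rewrite ltn_neqAle eq_sym -(inj_eq val_inj) in im *; rewrite im /=.
apply: mmin; apply/asboolP; exists (ltn_ord i).
by rewrite (_ : Ordinal _ = i)//; apply: val_inj.
Qed.

(** One more step first writes de u through p-th powers y^p, and then applies Frobenius to the
    relation for de' y; hence the factor de'^p de. *)
Lemma frob_span_iter t de : de <> 0 ->
  (forall u, inspan be t u -> inspan be (frob_list 1 t) (be de * u)) ->
  forall e, exists de', de' <> 0 /\ forall u, inspan be t u -> inspan be (frob_list e t) (be de' * u).
Proof.
move=> de0 deP; elim=> [|e [de' [de'0 IH]]].
  exists 1; split; first by apply/eqP/oner_neq0.
  by move=> u tu; rewrite rmorph1 mul1r /frob_list (eq_map (g := id)) ?map_id//.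
exists (de' ^+ p * de); split.
  by move=> /domB[]; [apply: no_zero_divX | apply: de0].
move=> u /deP su; rewrite rmorphM -mulrA.
apply: (@inspan_sub _ _ be _ [set a | inspan be (frob_list e.+1 t) (be (de' ^+ p) * a)] _ _ _ su).
  split; rewrite /= ?mulr0; first exact: inspan0.
    by move=> x y ? ?; rewrite mulrDr; apply: inspanD.
  by move=> c x ?; rewrite mulrCA; apply: inspanZ.
move=> _ /mapP[y yt ->] /=; rewrite expn1 rmorphXn -exprMn.
have := inspan_frob 1 (IH y (inspan_mem be yt)).
by rewrite expn1 frob_list_comp addn1.
Qed.

End Stabilization.

(** * Extension of linear maps up to a factor *)

Section LinearOn.
Variables (A B : comNzRingType) (be : {rmorphism B -> A}).

Definition lin_on (M W : set A) (f : A -> A) : Prop :=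
  [/\ forall x y, M x -> M y -> f (x + y) = f x + f y,
      forall b x, M x -> f (be b * x) = be b * f x
    & forall x, M x -> W (f x)].

(** One generator y is added at a time. If some b y with b nonzero lies in M, then u -> f(b u)
    extends b f. Otherwise the M-component of an element of M + B y is well defined, and f is
    extended by 0 on y. *)
Lemma lin_on_ext (M W : set A) (f : A -> A) (m : seq A) : no_zero_div B ->
  subsp be M -> subsp be W -> lin_on M W f ->
  exists b g, [/\ b <> 0, lin_on (addsp M (inspan be m)) W g & forall x, M x -> g x = be b * f x].
Proof.
move=> dom; elim: m M f => [|y m IH] M f sM sW fl; have [M0 MD MZ] := sM; have [W0 WD WZ] := sW.
  have e : addsp M (inspan be [::]) = M.
    apply/seteqP; split=> [_ [u [v [Mu -> ->]]]|u Mu]; first by rewrite addr0.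
    by exists u, 0; rewrite addr0.
  by exists 1, f; split; [apply/eqP/oner_neq0 | rewrite e | move=> x _; rewrite rmorph1 mul1r].
have [fD fZ fW] := fl.
pose M' : set A := [set x | exists u c, M u /\ x = u + be c * y].
have sM' : subsp be M'.
  split; first by exists 0, 0; rewrite rmorph0 mul0r addr0.
    move=> _ _ [u [c [Mu ->]]] [u' [c' [Mu' ->]]]; exists (u + u'), (c + c').
    by rewrite rmorphD; split; [apply: MD | ring].
  move=> b _ [u [c [Mu ->]]]; exists (be b * u), (b * c).
  by rewrite rmorphM; split; [apply: MZ | ring].
have MM' : M `<=` M' by move=> u Mu; exists u, 0; rewrite rmorph0 mul0r addr0.
have e : addsp M (inspan be (y :: m)) = addsp M' (inspan be m).
  apply/seteqP; split=> [_ [u [v [Mu [c mv] ->]]]|_ [_ [v [[u [c [Mu ->]]] mv ->]]]].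
    by exists (u + be c * y), (v - be c * y); split => //; [exists u, c | ring].
  by exists u, (be c * y + v); split => //; [exists c; rewrite addrC addKr | ring].
suff [b [g [b0 gl gE]]] : exists b g, [/\ b <> 0, lin_on M' W g & forall x, M x -> g x = be b * f x].
  have [b' [g' [b'0 g'l g'E]]] := IH M' g sM' sW gl.
  exists (b' * b), g'; split; [by move=> /dom[] | by rewrite e |].
  by move=> x Mx; rewrite g'E ?gE//; [rewrite rmorphM mulrA | apply: MM'].
have [[b [b0 Mb]]|nM] := pselect (exists b, b <> 0 /\ M (be b * y)).
  have Mb' u : M' u -> M (be b * u).
    move=> [v [c [Mv ->]]]; rewrite mulrDr; apply: MD; first exact: MZ.
    by rewrite mulrCA; apply: MZ.
  exists b, (fun u => f (be b * u)); split => //; last by move=> x Mx; rewrite fZ.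
  split=> [u v /Mb' Mu /Mb' Mv|c u /Mb' Mu|u /Mb' Mu].
  - by rewrite mulrDr fD.
  - rewrite mulrCA; exact: (fZ c _ Mu).
  - exact: fW.
have uniq u u' c c' : M u -> M u' -> u + be c * y = u' + be c' * y -> u = u'.
  move=> Mu Mu' uu'; have e1 : be (c - c') * y = u' - u.
    rewrite rmorphB mulrBl; apply/eqP; rewrite subr_eq addrAC -uu'; apply/eqP; ring.
  have cc : c - c' = 0.
    apply: contrapT => cc; apply: nM; exists (c - c'); split => //; rewrite e1.
    exact: (subspB sM).
  by move: e1; rewrite cc rmorph0 mul0r => /esym/eqP; rewrite subr_eq0 => /eqP.
pose nf u := xget 0 [set v | M v /\ exists c, u = v + be c * y].
have nfE v c : M v -> nf (v + be c * y) = v.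
  move=> Mv; rewrite /nf; apply: xget_subset1; first by split => //; exists c.
  move=> v1 v2 [Mv1 [c1 e1]] [Mv2 [c2 e2]]; apply: (uniq v1 v2 c1 c2) => //.
  by rewrite -e1.
exists 1, (fun u => f (nf u)); split; first by apply/eqP/oner_neq0.
  split.
  - move=> _ _ [u [c [Mu ->]]] [u' [c' [Mu' ->]]].
    have -> : u + be c * y + (u' + be c' * y) = (u + u') + be (c + c') * y by rewrite rmorphD; ring.
    by rewrite !nfE ?fD//; apply: MD.
  - move=> b _ [u [c [Mu ->]]].
    have -> : be b * (u + be c * y) = be b * u + be (b * c) * y by rewrite rmorphM; ring.
    by rewrite !nfE ?fZ//; apply: MZ.
  - by move=> _ [u [c [Mu ->]]]; rewrite nfE//; apply: fW.
move=> x Mx; rewrite rmorph1 mul1r.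
by have := nfE x 0 Mx; rewrite rmorph0 mul0r addr0 => ->.
Qed.

End LinearOn.

(** * Commutators with multiplications *)

Section Commutator.
Variable A : comNzRingType.
Implicit Types (f g : A -> A) (c u : A).

Definition comm c f : A -> A := fun u => c * f u - f (c * u).

Lemma comm_comm c d f : comm c (comm d f) = comm d (comm c f).
Proof. by apply/funext => u; rewrite /comm [d * (c * u)]mulrCA; ring. Qed.

Lemma iter_comm_comm m c d f : iter m (comm c) (comm d f) = comm d (iter m (comm c) f).
Proof. by elim: m => [//|m IH]; rewrite iterS IH comm_comm. Qed.

(** A[X] acts on functions: coefficients multiply the values, and X multiplies the argument by c.
    Thus c - X acts as [comm c], and its powers can be computed in the commutative ring A[X]. *)
Definition poly_act c f (P : {poly A}) : A -> A := fun u => \sum_(i < size P) P`_i * f (c ^+ i * u).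

Lemma poly_actE N c f (P : {poly A}) u : (size P <= N)%N ->
  poly_act c f P u = \sum_(i < N) P`_i * f (c ^+ i * u).
Proof.
move=> sP; rewrite /poly_act (big_ord_widen _ (fun i => P`_i * f (c ^+ i * u)) sP).
rewrite big_mkcond; apply: eq_bigr => i _; case: ltnP => // Pi.
by rewrite nth_default// mul0r.
Qed.

Lemma poly_act_comm c f m : poly_act c f ((c%:P - 'X) ^+ m) = iter m (comm c) f.
Proof.
elim: m => [|m IH].
  apply/funext => u. rewrite (poly_actE (N := 1)) ?size_poly1// big_ord1 coefC/=; by rewrite !mul1r.
rewrite iterS -IH; apply/funext => u; set P := _ ^+ m.
have sP : (size ((c%:P - 'X) ^+ m.+1 : {poly A}) <= (size P).+1)%N.
  rewrite exprS -/P mulrBl (leq_trans (size_polyD _ _))// size_polyN geq_max.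
  rewrite mul_polyC (leq_trans (size_scale_leq _ _))//= mulrC.
  have [P0|P0] := eqVneq P 0; first by rewrite P0 mul0r size_poly0.
  by rewrite size_mulX.
rewrite (poly_actE _ _ _ sP) /comm /poly_act mulr_sumr big_ord_recr/=.
have -> : \sum_(i < size P) P`_i * f (c ^+ i * (c * u)) = \sum_(i < size P) P`_i * f (c ^+ i.+1 * u).
  by apply: eq_bigr => i _; rewrite exprSr mulrA.
have cE i : ((c%:P - 'X) ^+ m.+1)`_i = c * P`_i - (if i is i'.+1 then P`_i' else 0).
  by rewrite exprS -/P mulrBl coefB coefCM coefXM; case: i.
have -> : \sum_(i < size P) ((c%:P - 'X) ^+ m.+1)`_i * f (c ^+ i * u) =
    \sum_(i < size P) c * (P`_i * f (c ^+ i * u)) -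
    \sum_(i < size P) (if nat_of_ord i is i'.+1 then P`_i' else 0) * f (c ^+ i * u).
  by rewrite -sumrB; apply: eq_bigr => i _; rewrite cE mulrBl mulrA.
rewrite -addrA; congr (_ + _).
rewrite cE [P`_(size P)]nth_default// mulr0 sub0r mulNr -opprD; congr (- _).
case: (size P) => [|n]; first by rewrite !big_ord0 mul0r add0r.
by rewrite [X in X + _]big_ord_recl/= mul0r add0r big_ord_recr.
Qed.

(* In characteristic p the left and right multiplications by c commute, so
   the p^e-th power of their difference is the commutator with c^(p^e). *)
Lemma iter_comm_frob p e c f : p \in [pchar A] ->
  iter (p ^ e) (comm c) f = comm (c ^+ (p ^ e)) f.
Proof.
move=> pA; rewrite -poly_act_comm.
have pP : p \in [pchar {poly A}] by rewrite pchar_poly.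
have pe : (0 < p ^ e)%N by rewrite expn_gt0 prime_gt0 ?(pcharf_prime pA).
rewrite (frobB _ _ _ pP) -polyC_exp; move: (p ^ e)%N pe => [//|q] _; apply/funext => u.
set P := _ - _; have PE i : P`_i = (if i == 0%N then c ^+ q.+1 else 0) - (i == q.+1)%:R.
  by rewrite coefB coefC coefXn.
have sP : (size P <= q.+2)%N.
  rewrite (leq_trans (size_polyD _ _))// size_polyN geq_max size_polyXn leqnn andbT.
  by rewrite (leq_trans (size_polyC_leq1 _)).
rewrite (poly_actE _ _ _ sP) big_ord_recr big_ord_recl /= !PE/= eqxx sub0r mulN1r.
congr (_ - _); rewrite subr0 expr0 mul1r big1 ?addr0// => i _.
by rewrite PE /bump/= add1n eqSS ltn_eqF// subrr mul0r.
Qed.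

End Commutator.

(** * Linear maps over the span C of p-th powers *)

Section Retraction.
Variables (A B : comNzRingType) (be : {rmorphism B -> A}) (ga : seq A) (p : nat).
Hypothesis domB : no_zero_div B.
Hypothesis pA : p \in [pchar A].
Let C := inspan be ga.
Hypothesis C1 : C 1.
Hypothesis CM : forall x y, C x -> C y -> C (x * y).
Hypothesis stabC : forall e, exists de, de <> 0 /\
  forall u, C u -> inspan be (frob_list p e ga) (be de * u).

Definition Csub (U : set A) : Prop :=
  [/\ U 0, forall x y, U x -> U y -> U (x + y) & forall c x, C c -> U x -> U (c * x)].

Lemma C_be b : C (be b).
Proof. by rewrite -[be b]mulr1; apply: inspanZ. Qed.

Lemma Csub_subsp U : Csub U -> subsp be U.
Proof. by move=> [U0 UD UC]; split => // b x; apply: UC; apply: C_be. Qed.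

Lemma lin_on_sum M W f (I : Type) (r : seq I) (b : I -> B) (x : I -> A) : subsp be M ->
  lin_on be M W f -> (forall i, M (x i)) ->
  f (\sum_(i <- r) be (b i) * x i) = \sum_(i <- r) be (b i) * f (x i).
Proof.
move=> sM [fD fZ fW] Mx; have [M0 MD MZ] := sM.
have f0 : f 0 = 0 by have := fZ 0 0 M0; rewrite rmorph0 !mul0r.
elim: r => [|i r IH]; first by rewrite !big_nil.
rewrite !big_cons fD ?fZ ?IH//; first exact: MZ.
by apply: (subsp_sum _ sM) => j _; apply: MZ.
Qed.

Section Fix.
Variables (M N W : set A).
Hypothesis CsM : Csub M.
Hypothesis CsN : Csub N.
Hypothesis CsW : Csub W.
Hypothesis NM : N `<=` M.

Let zero_on (f : A -> A) := forall u, M u -> f u = 0.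

Lemma comm_lin_on c f : C c -> lin_on be M W f -> lin_on be M W (comm c f).
Proof.
move=> Cc [fD fZ fW]; have [M0 MD MC] := CsM; have [W0 WD WC] := CsW; rewrite /comm.
split=> [x y Mx My|b x Mx|x Mx].
- by rewrite mulrDr !fD//; [ring | apply: MC | apply: MC].
- by rewrite mulrCA fZ ?fZ//; [ring | apply: MC].
- by apply: (subspB (Csub_subsp CsW)); [apply/WC/fW | apply/fW/MC].
Qed.

Lemma iter_comm_lin_on c f i : C c -> lin_on be M W f -> lin_on be M W (iter i (comm c) f).
Proof. by move=> Cc fl; elim: i => [//|i IH]; apply: comm_lin_on. Qed.

Lemma zero_on_iter c f m n : C c -> (m <= n)%N ->
  zero_on (iter m (comm c) f) -> zero_on (iter n (comm c) f).
Proof.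
have [_ _ MC] := CsM.
move=> Cc /subnK <- z; elim: (n - m)%N => [//|i IH] u Mu.
by rewrite addSn iterS /comm !IH ?mulr0 ?subrr//; apply: MC.
Qed.

(** With l generators g_a of C, the B-combinations of the l^2 maps u -> g_a f(g_b u) contain f,
    since 1 is in C, and are stable under [comm c], since c g_a is again a combination. Hence l^2 +
    1 iterated commutators are dependent over B. *)
Lemma comm_relation c f : C c -> lin_on be M W f ->
  exists n (v : nat -> B), (exists2 i, (i < n)%N & v i <> 0) /\
    forall u, M u -> \sum_(i < n) be (v i) * iter i (comm c) f u = 0.
Proof.
move=> Cc fl; have [M0 MD MC] := CsM; have sM := Csub_subsp CsM.
set l := size ga.
pose inS (g : A -> A) := exists T : 'I_l -> 'I_l -> B, forall u, M u ->
   g u = \sum_a \sum_b be (T a b) * (ga`_a * f (ga`_b * u)).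
have Mga (b : 'I_l) u : M u -> M (ga`_b * u) by move=> Mu; apply: MC => //; apply/inspan_mem/mem_nth.
have Lc a : exists L : nat -> B, c * ga`_a = \sum_(a' < l) be (L a') * ga`_a'.
  have [al|la] := ltnP a l; last first.
    exists (fun=> 0); rewrite nth_default// mulr0 big1// => i _; by rewrite rmorph0 mul0r.
  by apply: inspan_coef; apply: CM => //; apply/inspan_mem/mem_nth.
have [L LE] := choice Lc.
have fS : inS f.
  have [e eE] := inspan_coef C1.
  exists (fun a b => e a * e b) => u Mu.
  have fuE : f u = \sum_(b < l) be (e b) * f (ga`_b * u).
    rewrite -[in LHS](mul1r u) eE mulr_suml.
    under eq_bigr do rewrite -mulrA.
    by rewrite (lin_on_sum _ _ sM fl)// => b; apply: Mga.
  rewrite -[LHS]mul1r eE mulr_suml; apply: eq_bigr => a _.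
  by rewrite fuE mulr_sumr; apply: eq_bigr => b _; rewrite rmorphM; ring.
have cS g : inS g -> inS (comm c g).
  move=> [T TE].
  exists (fun a b : 'I_l => \sum_(a1 < l) T a1 b * L a1 a - \sum_(b1 < l) T a b1 * L b1 b) => u Mu.
  have -> : \sum_(a < l) \sum_(b < l) be (\sum_(a1 < l) T a1 b * L a1 a - \sum_(b1 < l) T a b1 * L b1 b) *
       (ga`_a * f (ga`_b * u)) =
     \sum_(a < l) \sum_(b < l) be (\sum_(a1 < l) T a1 b * L a1 a) * (ga`_a * f (ga`_b * u)) -
     \sum_(a < l) \sum_(b < l) be (\sum_(b1 < l) T a b1 * L b1 b) * (ga`_a * f (ga`_b * u)).
    by rewrite -sumrB; apply: eq_bigr => a _; rewrite -sumrB; apply: eq_bigr => b _; rewrite rmorphB mulrBl.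
  rewrite /comm; congr (_ - _).
    rewrite TE// mulr_sumr.
    rewrite [RHS]exchange_big [LHS](eq_bigr (fun a => \sum_b be (T a b) * (c * ga`_a) * f (ga`_b * u))); last first.
      by move=> a _; rewrite mulr_sumr; apply: eq_bigr => b _; ring.
    rewrite [LHS]exchange_big; apply: eq_bigr => b _.
    under eq_bigr do rewrite LE mulr_sumr mulr_suml.
    rewrite exchange_big; apply: eq_bigr => a _.
    rewrite rmorph_sum mulr_suml; apply: eq_bigr => a1 _; rewrite rmorphM; ring.
  rewrite TE; last exact: MC.
  apply: eq_bigr => a _.
  have fE (b : 'I_l) : f (ga`_b * (c * u)) = \sum_(b1 < l) be (L b b1) * f (ga`_b1 * u).
    rewrite mulrCA mulrA LE mulr_suml.
    under eq_bigr do rewrite -mulrA.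
    by rewrite (lin_on_sum _ _ sM fl)// => b1; apply: Mga.
  under eq_bigr do rewrite fE !mulr_sumr.
  rewrite exchange_big; apply: eq_bigr => b _.
  rewrite rmorph_sum mulr_suml; apply: eq_bigr => b1 _; rewrite rmorphM; ring.
have iS i : inS (iter i (comm c) f) by elim: i => [//|i IH]; apply: cS.
have [T TE] := choice iS.
have [v [[i vi] vM]] := left_kernel domB
  (fun (i : 'I_#|{: 'I_l * 'I_l}|.+1) j => T i (enum_val j).1 (enum_val j).2).
exists #|{: 'I_l * 'I_l}|.+1, (fun i => v (inord i)); split.
  by exists i; [exact: ltn_ord | rewrite inord_val].
move=> u Mu; under eq_bigr do rewrite inord_val TE// pair_big/= mulr_sumr.
rewrite exchange_big big1// => -[a b] _ /=.
under eq_bigr do rewrite mulrA -rmorphM.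
rewrite -mulr_suml -rmorph_sum.
have := vM (enum_rank (a, b)); under eq_bigr do rewrite enum_rankK.
by move=> ->; rewrite rmorph0 mul0r.
Qed.

(** Let v_a be the lowest nonzero coefficient of a relation between the iterates. Factoring out a
    commutators leaves f' = v_a f + v_(a+1) [c, f] + ..., which a commutators with c annihilate. On
    N, where f is already C-linear, only v_a f survives. As commutators commute, nothing killed
    before reappears. *)
Lemma comm_kill c f : C c -> lin_on be M W f ->
  (forall d u, C d -> N u -> comm d f u = 0) ->
  exists b f' a, [/\ b <> 0, lin_on be M W f', forall u, N u -> f' u = be b * f u,
    zero_on (iter a (comm c) f') &
    forall d m, C d -> zero_on (iter m (comm d) f) -> zero_on (iter m (comm d) f')].
Proof.
move=> Cc fl fN; have [M0 MD MC] := CsM.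
have [n [v [[i0 i0n vi0] rel]]] := comm_relation Cc fl.
pose Q i := (i < n)%N && `[< v i <> 0 >].
have exQ : exists i, Q i by exists i0; rewrite /Q i0n; apply/asboolP.
case: (ex_minnP exQ) => a /andP[an /asboolP va] amin.
pose f' u := \sum_(j < n - a) be (v (a + j)%N) * iter j (comm c) f u.
have iter_f' d m u : iter m (comm d) f' u =
    \sum_(j < n - a) be (v (a + j)%N) * iter j (comm c) (iter m (comm d) f) u.
  elim: m u => [//|m IH] u.
  rewrite iterS /comm !IH mulr_sumr -sumrB; apply: eq_bigr => j _.
  by rewrite iterS iter_comm_comm /comm; ring.
exists (v a), f', a; split => //.
- split=> [x y Mx My|b x Mx|x Mx].
  + rewrite /f' -big_split; apply: eq_bigr => j _; rewrite /= -mulrDr; congr (_ * _).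
    by have [fD _ _] := iter_comm_lin_on j Cc fl; apply: fD.
  + rewrite /f' mulr_sumr; apply: eq_bigr => j _; rewrite mulrCA; congr (_ * _).
    by have [_ fZ _] := iter_comm_lin_on j Cc fl; apply: fZ.
  + apply: (subsp_sum _ (Csub_subsp CsW)) => j _.
    have [_ _ WZ] := Csub_subsp CsW; apply: WZ.
    by have [_ _ fW] := iter_comm_lin_on j Cc fl; apply: fW.
- move=> u Nu; rewrite /f' -(subnSK an) big_ord_recl/= addn0 big1 ?addr0// => j _.
  have [_ _ NC] := CsN.
  rewrite -[RHS](mulr0 (be (v (a + bump 0 j)%N))); congr (_ * _).
  have z i x : N x -> iter i.+1 (comm c) f x = 0; last exact: z.
  elim: i x => [|m IH] x Nx; first exact: fN.
  by rewrite iterS /comm !IH ?mulr0 ?subrr//; apply: NC.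
- move=> u Mu; rewrite iter_f'.
  rewrite -[RHS](rel u Mu) [RHS](bigID (fun i : 'I_n => (i < a)%N))/= [X in _ = X + _]big1 ?add0r; last first.
    move=> i ia; rewrite (_ : v i = 0) ?rmorph0 ?mul0r//; apply: contrapT => vi.
    have := amin i; rewrite /Q ltn_ord/= => /(_ (introT (asboolP _) vi)).
    by rewrite leqNgt ia.
  rewrite -(big_mkord xpredT (fun j => be (v (a + j)%N) * iter j (comm c) (iter a (comm c) f) u)).
  rewrite -(big_mkord (fun i => ~~ (i < a)%N) (fun i => be (v i) * iter i (comm c) f u)).
  rewrite [RHS](big_cat_nat (n := a))//=; last exact: ltnW.
  rewrite [X in _ = X + _]big_nat_cond [X in _ = X + _]big1 ?add0r; last first.
    by move=> i /andP[/andP[_ ->]].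
  rewrite -[X in _ = \big[_/_]_(X <= _ < _ | _) _]add0n big_addn big_nat_cond [RHS]big_nat_cond; apply: eq_big => [i|i _].
    by rewrite -leqNgt leq_addl.
  by rewrite -iterD addnC.
- move=> d m Cd zf u Mu; rewrite iter_f' big1// => j _.
  suff -> : iter j (comm c) (iter m (comm d) f) u = 0 by rewrite mulr0.
  elim: (nat_of_ord j) u Mu => [|i IH] u Mu; first exact: zf.
  by rewrite iterS /comm !IH ?mulr0 ?subrr//; apply: MC.
Qed.

Lemma comm_kill_list (s : seq A) f : (forall c, c \in s -> C c) -> lin_on be M W f ->
  (forall d u, C d -> N u -> comm d f u = 0) ->
  exists b f' a, [/\ b <> 0, lin_on be M W f', forall u, N u -> f' u = be b * f u &
    forall c, c \in s -> zero_on (iter a (comm c) f')].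
Proof.
elim: s f => [|c s IH] f sC fl fN.
  exists 1, f, 0%N; split => //; first by apply/eqP/oner_neq0.
  by move=> u _; rewrite rmorph1 mul1r.
have Cc : C c by apply: sC; apply: mem_head.
have [_ _ NC] := CsN.
have sC' d : d \in s -> C d by move=> ds; apply: sC; rewrite inE ds orbT.
have [b [f1 [a [b0 f1l f1N f1z]]]] := IH f sC' fl fN.
have [|b' [f2 [a' [b'0 f2l f2N f2z f2d]]]] := comm_kill Cc f1l.
  move=> d u Cd Nu; rewrite /comm !f1N//; last exact: NC.
  by rewrite mulrCA -mulrBr -/(comm d f u) fN ?mulr0.
exists (b' * b), f2, (maxn a a'); split => //.
- by move=> /domB[].
- by move=> u Nu; rewrite f2N// f1N// rmorphM mulrA.
- move=> d; rewrite inE => /orP[/eqP->|ds].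
    exact: (zero_on_iter Cc (leq_maxr _ _)).
  apply: (zero_on_iter (sC' _ ds) (leq_maxl _ _)); apply: f2d; [exact: sC' | exact: f1z].
Qed.

(* A C-linear map on N extends to M up to a nonzero factor: an extension that is
   linear over B is made C-linear by killing the commutators. *)
Theorem C_linear_ext (m : seq A) f :
  M `<=` addsp N (inspan be m) ->
  (forall x y, N x -> N y -> f (x + y) = f x + f y) ->
  (forall c x, C c -> N x -> f (c * x) = c * f x) -> (forall x, N x -> W (f x)) ->
  exists b g, [/\ b <> 0, lin_on be M W g,
    forall c x, C c -> M x -> g (c * x) = c * g x & forall x, N x -> g x = be b * f x].
Proof.
move=> MNm fD fC fW; have [M0 MD MC] := CsM; have [N0 ND NC] := CsN.
have fl : lin_on be N W f by split => // b x; apply: fC; apply: C_be.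
have [b1 [f1 [b10 f1l f1N]]] := lin_on_ext m domB (Csub_subsp CsN) (Csub_subsp CsW) fl.
have {}f1l : lin_on be M W f1.
  have [h1 h2 h3] := f1l; split; [move=> x y Mx My; apply: h1 | move=> b x Mx; apply: h2 | move=> x Mx; apply: h3];
  exact: MNm.
have f1C d u : C d -> N u -> comm d f1 u = 0.
  by move=> Cd Nu; rewrite /comm !f1N ?fC//; [rewrite mulrCA subrr | apply: NC].
have [|b2 [f2 [a [b20 f2l f2N f2z]]]] := @comm_kill_list ga f1 _ f1l f1C.
  by move=> c; apply: inspan_mem.
have [de [de0 deP]] := stabC a.
have [f2D f2Z f2W] := f2l.
exists (de * (b2 * b1)), (fun u => be de * f2 u); split.
- by move=> /domB[// | /domB[]].
- split=> [x y Mx My|b x Mx|x Mx].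
  + by rewrite f2D// mulrDr.
  + by rewrite f2Z// mulrCA.
  + by have [_ _ WZ] := Csub_subsp CsW; apply/WZ/f2W.
- move=> c x Cc Mx.
  (* The commutator with g^(p^a) is the p^a-th iterate of the commutator with g, hence zero on f2
     for each generator g. The multiple de c is a B-combination of such powers. *)
  have a_le : (a <= p ^ a)%N by apply/ltnW/ltn_expl/prime_gt1/(pcharf_prime pA).
  have frob0 u : inspan be (frob_list p a ga) u -> comm u f2 x = 0.
    move=> /inspan_coef[c' ->]; rewrite /comm !mulr_suml.
    rewrite [X in _ - f2 X](eq_bigr (fun i : 'I_(size (frob_list p a ga)) =>
      be (c' i) * ((frob_list p a ga)`_i * x))); last by move=> i _; rewrite mulrA.
    have ga_in (i : 'I_(size (frob_list p a ga))) :
        exists2 y, y \in ga & (frob_list p a ga)`_i = y ^+ (p ^ a).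
      have : (frob_list p a ga)`_i \in frob_list p a ga by apply: mem_nth.
      by move=> /mapP[y yg ->]; exists y.
    rewrite (lin_on_sum _ _ (Csub_subsp CsM) f2l); last first.
      move=> i; have [y yg ->] := ga_in i; elim: (p ^ a)%N => [|n IH]; first by rewrite mul1r.
      by rewrite exprS -mulrA; apply: MC => //; apply: inspan_mem.
    rewrite -sumrB big1// => i _; have [y yg ->] := ga_in i.
    rewrite -mulrA -mulrBr -/(comm (y ^+ (p ^ a)) f2 x) -(iter_comm_frob _ _ _ pA).
    by rewrite (zero_on_iter (inspan_mem be yg) a_le)// ?mulr0//; apply: f2z.
  rewrite -f2Z; last exact: MC.
  have := frob0 _ (deP c Cc); rewrite /comm mulrA => /eqP.
  by rewrite subr_eq0 => /eqP <-; ring.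
- by move=> x Nx; rewrite f2N ?f1N// !rmorphM; ring.
Qed.

End Fix.
End Retraction.

(** * Growth of lengths *)

(* r e = O(q^(d-1)) for q = p^e, written so that it makes sense when d = 0. *)
Definition negligible (p d : nat) (r : nat -> nat) : Prop :=
  exists K, forall e, (r e * p ^ e <= K * (p ^ e) ^ d)%N.

Section Negligible.
Variables (p d : nat).

Lemma negligible_le r r' : (forall e, (r e <= r' e)%N) -> negligible p d r' -> negligible p d r.
Proof.
by move=> rr' [K HK]; exists K => e; apply: leq_trans (HK e); rewrite leq_mul2r rr' orbT.
Qed.

Lemma negligibleD r r' : negligible p d r -> negligible p d r' ->
  negligible p d (fun e => r e + r' e)%N.
Proof.
by move=> [K HK] [K' HK']; exists (K + K')%N => e; rewrite !mulnDl leq_add.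
Qed.

Lemma negligible_level j r : (0 < p)%N ->
  (exists K, forall e, (r e * p ^ (e + j) <= K * (p ^ (e + j)) ^ d)%N) -> negligible p d r.
Proof.
move=> p0 [K HK]; exists (K * (p ^ j) ^ d)%N => e.
rewrite -mulnA -expnMn (mulnC (p ^ j)%N) -expnD; apply: leq_trans (HK e).
by rewrite leq_mul2l leq_pexp2l ?leq_addr ?orbT.
Qed.

End Negligible.

Section Pmul.
Variables (A : comNzRingType) (I : set A) (q : nat).

(* The products I^[q] M, for a subset M. *)
Inductive pmul (M : set A) : A -> Prop :=
| pmul_zero : pmul M 0
| pmul_add u m a of I u & M m & pmul M a : pmul M (u ^+ q * m + a).

Lemma pmulD M a b : pmul M a -> pmul M b -> pmul M (a + b).
Proof.
move=> + Mb; elim=> [|u m c Iu Mm _ IH]; first by rewrite add0r.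
by rewrite -addrA; apply: pmul_add.
Qed.

Lemma pmul_mul M u m : I u -> M m -> pmul M (u ^+ q * m).
Proof. by move=> Iu Mm; rewrite -[_ * _]addr0; apply: pmul_add => //; apply: pmul_zero. Qed.

Lemma pmulS M M' : M `<=` M' -> pmul M `<=` pmul M'.
Proof. by move=> MM' a; elim=> [|u m c Iu /MM' Mm _]; [exact: pmul_zero | exact: pmul_add]. Qed.

Lemma pmulZ M c a : (forall m, M m -> M (c * m)) -> pmul M a -> pmul M (c * a).
Proof.
move=> Mc; elim=> [|u m b Iu Mm _ IH]; first by rewrite mulr0; apply: pmul_zero.
by rewrite mulrDr mulrCA; apply: pmul_add => //; apply: Mc.
Qed.

Lemma pmul_map (M N : set A) g a : (forall m, M m -> N (g m)) -> g 0 = 0 ->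
  (forall u m b, I u -> M m -> pmul M b -> g (u ^+ q * m + b) = u ^+ q * g m + g b) ->
  pmul M a -> pmul N (g a).
Proof.
move=> MN g0 gE; elim=> [|u m b Iu Mm pb IH]; first by rewrite g0; apply: pmul_zero.
by rewrite gE//; apply: pmul_add => //; apply: MN.
Qed.

Lemma pmul_subl (M N : set A) a : N 0 -> (forall x y, N x -> N y -> N (x + y)) ->
  (forall u m, I u -> M m -> N (u ^+ q * m)) -> pmul M a -> N a.
Proof. by move=> N0 ND NM; elim=> // u m b Iu Mm _ Nb; apply: ND => //; apply: NM. Qed.

End Pmul.

(** * Dimension counts up to lower order *)

Section Asymptotics.
Variables (k : fieldType) (A B : comNzRingType) (sg : {rmorphism k -> A}).
Variables (io : {rmorphism k -> B}) (be : {rmorphism B -> A}) (X : seq B) (w : seq A) (p : nat).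
Hypothesis bi : forall c, be (io c) = sg c.
Hypothesis regX : regular_like io X.
Hypothesis pA : p \in [pchar A].
Hypothesis gen : forall a, inspan be w a.

Let d := size X.
Let domB : no_zero_div B. Proof. by case: regX. Qed.
Let p0 : (0 < p)%N. Proof. exact/prime_gt0/(pcharf_prime pA). Qed.

Variable I : nat -> set A.
Hypothesis Iid : forall e, is_ideal (I e).
Hypothesis IX : forall e x, x \in X -> I e (be x ^+ (p ^ e)).
Hypothesis Ip : forall e u, I e u -> I e.+1 (u ^+ p).

Section FixLevel.
Variables (j0 : nat) (de : B).
Hypothesis de0 : de <> 0.
Hypothesis deP : forall u, inspan be (frob_list p j0 w) u -> inspan be (frob_list p j0.+1 w) (be de * u).

Let ga := frob_list p j0 w.
Let C := inspan be ga.
Let q0 := (p ^ j0)%N.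
(** The q0-th powers of elements of I_e are scalars in C, so a C-linear map M -> N carries [J e M]
    into [J e N]. *)
Let J e (M : set A) := pmul (I e) q0 M.

Let C1 : C 1. Proof. exact: frob_span1. Qed.
Let CM x y : C x -> C y -> C (x * y). Proof. exact: frob_span_mul. Qed.
Let Cq a : C (a ^+ q0). Proof. exact: inspan_frob. Qed.
Let CX x n : C x -> C (x ^+ n).
Proof. by move=> Cx; elim: n => [//|n IH]; rewrite exprS; apply: CM. Qed.
Let stabC : forall e, exists de, de <> 0 /\
  forall u, C u -> inspan be (frob_list p e ga) (be de * u).
Proof.
apply: (frob_span_iter domB pA de0) => u /deP.
by rewrite /ga frob_list_comp addn1.
Qed.
Let sC : subsp be C. Proof. exact: inspan_subsp. Qed.
Let CsC : Csub be ga C. Proof. by have [? ? ?] := sC; split => //; apply: CM. Qed.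

Lemma J_Csub e M : Csub be ga M -> Csub be ga (J e M).
Proof.
move=> [M0 MD MC]; split; [exact: pmul_zero | exact: pmulD |].
by move=> c x Cc; apply: pmulZ => m; apply: MC.
Qed.

Lemma J_sub e M : Csub be ga M -> J e M `<=` M.
Proof.
move=> [M0 MD MC] a; apply: pmul_subl => // u m _; apply: MC; exact: Cq.
Qed.

Let CsB U : Csub be ga U -> subsp be U. Proof. exact: (Csub_subsp C1). Qed.
Let sub_sg U : Csub be ga U -> subsp sg U.
Proof. by move=> /CsB; apply: (subsp_restr bi). Qed.

Lemma J_X e x (m : A) (M : set A) : x \in X -> M m -> J e M (be x ^+ (p ^ (e + j0)) * m).
Proof. by move=> xX Mm; rewrite expnD exprM; apply: pmul_mul => //; apply: IX. Qed.

Lemma J_fin e (nu : seq A) : Csub be ga (inspan be nu) -> fin_over sg (J e (inspan be nu)) (inspan be nu).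
Proof.
move=> CsM; have [|x y xX ynu|t [_ st]] := @est_box _ _ _ sg io be bi X regX (p ^ (e + j0)) (J e (inspan be nu)) nu.
- exact/CsB/J_Csub.
- by apply: J_X => //; apply: inspan_mem.
- by exists t.
Qed.

(** The common form of the error terms: a fixed number of generators, modulo a submodule containing
    their multiples by a fixed nonzero de' and by the X_i^(p^(e+j0)). *)
Lemma tor_negligible (de' : B) (V M : nat -> set A) (nu : seq A) : de' <> 0 ->
  (forall e, subsp be (V e)) -> (forall e, subsp sg (M e)) -> (forall e, V e `<=` M e) ->
  (forall e, M e `<=` addsp (V e) (inspan be nu)) ->
  (forall e x y, x \in X -> y \in nu -> V e (be x ^+ (p ^ (e + j0)) * y)) ->
  (forall e y, y \in nu -> V e (be de' * y)) ->
  negligible p d (fun e => dq sg (V e) (M e)).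
Proof.
move=> de'0 sV sM VM MV VX Vd; have [K HK] := est_tor bi regX de'0.
apply: (negligible_level (j := j0)) => //; exists (size nu * K)%N => e.
have [t [st ts]] := HK _ _ nu (sV e) (VX e) (Vd e).
apply: leq_trans st; rewrite leq_mul2r; apply/orP; right.
have sVe := subsp_restr bi (sV e).
apply: dq_le => // x /MV[v [u [Vv /ts[v' [u' [Vv' tu' ->]]] ->]]].
exists (v + v'), u'; split => //; last by rewrite addrA.
by have [_ VD _] := sVe; apply: VD.
Qed.

Section Step.
Variables (nu : seq A) (y : A).
Let N := inspan be nu.
Hypothesis CsN : Csub be ga N.
Let M : set A := [set x | exists n c, [/\ N n, C c & x = n + c * y]].
Let aa : set A := [set c | C c /\ N (c * y)].

Lemma step_Csub : Csub be ga M.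
Proof.
have [N0 ND NC] := CsN; have [C0 CD _] := CsC; split.
- by exists 0, 0; rewrite mul0r addr0.
- move=> _ _ [n [c [Nn Cc ->]]] [n' [c' [Nn' Cc' ->]]]; exists (n + n'), (c + c').
  by split; [apply: ND | apply: CD | ring].
- move=> b _ Cb [n [c [Nn Cc ->]]]; exists (b * n), (b * c).
  by split; [apply: NC | apply: CM | ring].
Qed.

Lemma step_aa : Csub be ga aa.
Proof.
have [N0 ND NC] := CsN; have [C0 CD _] := CsC; split.
- by split; rewrite ?mul0r.
- by move=> c c' [Cc Nc] [Cc' Nc']; split; [apply: CD | rewrite mulrDl; apply: ND].
- by move=> b c Cb [Cc Nc]; split; [apply: CM | rewrite -mulrA; apply: NC].
Qed.

Lemma step_span : M = inspan be (nu ++ [seq g * y | g <- ga]).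
Proof.
apply/seteqP; split => [_ [n [c [Nn Cc ->]]]|x /inspan_cat[n [Nn xn]]].
  apply/inspan_cat; exists n; split => //; rewrite addrC addKr mulrC.
  rewrite (eq_map (g := fun g => y * g)); first exact: inspan_mull.
  by move=> g; rewrite mulrC.
suff [c [Cc cE]] : exists c, C c /\ x - n = c * y.
  by exists n, c; split => //; rewrite -cE addrC subrK.
rewrite /C; elim: ga (x - n) xn => [|g t IH] z /=; first by move=> ->; exists 0; rewrite mul0r.
move=> [b /IH[c [tc cE]]]; exists (c + be b * g); split; first by exists b; rewrite addrK.
by rewrite mulrDl -cE -mulrA subrK.
Qed.

(** As M/N is isomorphic to C/aa, the count for M differs from the sum of the counts for N and C/aa
    by the dimension of (J_e M cap N)/J_e N. A C-linear map M -> N that is multiplication by b on N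
    sends J_e M into J_e N, so b kills this defect. *)
Lemma step_dim : exists r, negligible p d r /\ forall e,
  let h := dq sg (addsp aa (J e C)) C in
  (dq sg (J e M) M <= dq sg (J e N) N + h)%N /\
  (dq sg (J e N) N + h <= dq sg (J e M) M + r e)%N.
Proof.
have CsM := step_Csub; have Csa := step_aa.
have [N0 ND NC] := CsN; have [M0 MD MC] := CsM; have [C0 CD _] := CsC.
have NM : N `<=` M by move=> n Nn; exists n, 0; rewrite mul0r addr0.
have CyM c : C c -> M (c * y) by exists 0, c; rewrite add0r.
have sJ e U : Csub be ga U -> subsp sg (J e U) by move=> CsU; apply/sub_sg/J_Csub.
have sub_add U V : subsp sg U -> subsp sg V -> subsp sg (addsp U V) by apply: addsp_subsp.
have finM e : fin_over sg (J e M) M by rewrite step_span; apply: J_fin; rewrite -step_span.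
have finN e : fin_over sg (J e N) N by exact: J_fin.
have JNM e : J e N `<=` J e M by exact: pmulS.
have JMM e := J_sub (e := e) CsM; have JNN e := J_sub (e := e) CsN.
have [b [g [b0 gl gC gN]]] : exists b g, [/\ b <> 0, lin_on be M N g,
    forall c x, C c -> M x -> g (c * x) = c * g x & forall x, N x -> g x = be b * x].
  apply: (@C_linear_ext A B be ga p domB pA C1 CM stabC M N N CsM CsN CsN (map (fun g => g * y) ga) id) => //.
  rewrite step_span => x /inspan_cat[n [Nn xn]]; exists n, (x - n); split => //; ring.
have [gD gZ gW] := gl.
have JM_N e x : J e M x -> exists n c, [/\ N n, J e C c & x = n + c * y].
  apply: (@pmul_subl _ _ _ M [set x | exists n c, [/\ N n, J e C c & x = n + c * y]]).
  - by exists 0, 0; rewrite mul0r addr0; split => //; exact: pmul_zero.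
  - move=> _ _ [n [c [Nn Cc ->]]] [n' [c' [Nn' Cc' ->]]]; exists (n + n'), (c + c').
    by split; [apply: ND | apply: pmulD | ring].
  - move=> u _ Iu [n [c [Nn Cc ->]]]; exists (u ^+ q0 * n), (u ^+ q0 * c).
    by split; [apply: NC => //; apply: Cq | apply: pmul_mul | ring].
pose V e := addsp (J e N) [set be b * x | x in N].
have sbN : subsp sg [set be b * x | x in N] by apply/mulset_subsp/sub_sg.
exists (fun e => dq sg (V e) N); split.
  apply: (tor_negligible (de' := b) (nu := nu)) => //.
  - by move=> e; apply: addsp_subsp; [exact/CsB/J_Csub | exact/mulset_subsp/CsB].
  - by move=> e; apply: sub_sg.
  - move=> e _ [u [_ [/JNN Nu [x Nx <-] ->]]]; apply: ND => //; apply: NC => //.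
    exact: (C_be C1).
  - by move=> e x Nx; exists 0, x; rewrite add0r; split => //; exists 0, 0; rewrite addr0; split => //; [exact: pmul_zero | exists 0; rewrite ?mulr0].
  - move=> e x z xX znu; apply: addspl; first by exists 0; rewrite ?mulr0.
    by apply: J_X => //; apply: inspan_mem.
  - move=> e z znu; apply: addspr; first exact: pmul_zero.
    by exists z => //; apply: inspan_mem.
move=> e h.
have sN := sub_sg CsN; have sM := sub_sg CsM.
have sJM := sJ e M CsM; have sJN := sJ e N CsN.
have e1 : dq sg (J e M) M = (dq sg (J e M) (addsp (J e M) N) + dq sg (addsp (J e M) N) M)%N.
  apply: dq_add => //; first exact: sub_add.
    by apply: addspl.
  by move=> _ [u [n [/JMM Mu /NM Mn ->]]]; apply: MD.
have e2 : dq sg (addsp (J e M) N) M = h.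
  apply: (dq_iso (g := fun c => c * y)) => //.
  - by apply: sub_add; [apply: sub_sg | apply: sJ].
  - exact: sub_sg.
  - exact: sub_add.
  - by move=> _ [u [v [[Cu _] /(J_sub CsC) Cv ->]]]; apply: CD.
  - by move=> _ [u [n [/JMM Mu /NM Mn ->]]]; apply: MD.
  - apply: fin_sub (J_fin e CsC) => //.
    by apply: addspr; split; rewrite ?mul0r.
  - by move=> c c' _ _; rewrite mulrDl.
  - by move=> c c' _; rewrite mulrA.
  - move=> c Cc [_ [n [/JM_N[n' [c' [Nn' Jc' ->]]] Nn cE]]].
    exists (c - c'), c'; split => //; last by rewrite subrK.
    have Cc' := J_sub CsC Jc'.
    split; first exact: (subspB (sub_sg CsC)).
    have -> : (c - c') * y = n' + n by rewrite mulrBl cE; ring.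
    exact: ND.
  - move=> _ [u [v [[_ Nu] Jv ->]]]; rewrite mulrDl addrC; exists (v * y), (u * y); split => //.
    apply: (@pmul_map _ _ _ C M (fun c => c * y)) Jv => //; first by rewrite mul0r.
    by move=> u' m b' _ _ _; ring.
  - move=> _ [n [c [Nn Cc ->]]]; exists c => //; rewrite addrK; apply: addspr => //.
    exact: pmul_zero.
have JMN_fin : fin_over sg (J e M `&` N) N.
  by apply: fin_sub (finN e) => // x Jx; split; [apply: JNM | apply: (JNN e)].
have e3 : dq sg (J e M) (addsp (J e M) N) = dq sg (J e M `&` N) N by exact: dq_addsp.
have JNMN : J e N `<=` J e M `&` N by move=> x Jx; split; [apply: JNM | apply: (JNN e)].
have sJMN : subsp sg (J e M `&` N) by apply: setI_subsp.
have e4 : dq sg (J e N) N = (dq sg (J e N) (J e M `&` N) + dq sg (J e M `&` N) N)%N.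
  by apply: dq_add => //; try by move=> x [].
pose Kr := [set x | N x /\ J e N (be b * x)].
have e5 : dq sg (J e N) Kr = dq sg (V e) N.
  apply: dq_ker_coker => //.
  - by move=> x z _ _; rewrite mulrDr.
  - by move=> c x _; rewrite mulrCA.
  - by move=> x; apply: NC; apply: C_be.
  - by move=> x; have [_ _ JC] := J_Csub e CsN; apply: JC; apply: C_be.
have JK : J e M `&` N `<=` Kr.
  move=> x [Jx Nx]; split => //; rewrite -gN//.
  apply: (@pmul_map _ _ _ M N g) Jx => //.
    by have := gZ 0 0 M0; rewrite rmorph0 !mul0r.
  move=> u m z Iu Mm /JMM Mz; have Cu := Cq u.
  by rewrite gD ?gC//; apply: MC.
have sK : subsp sg Kr.
  have [_ JD JC] := J_Csub e CsN; have [_ _ NZ] := sN; have [_ _ JZ] := sJN.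
  split; first by split; rewrite ?mulr0//; exact: pmul_zero.
    by move=> x z [Nx Jx] [Nz Jz]; split; [apply: ND | rewrite mulrDr; apply: JD].
  by move=> c x [Nx Jx]; split; [apply: NZ | rewrite mulrCA; apply: JZ].
have e6 : dq sg (J e N) Kr = (dq sg (J e N) (J e M `&` N) + dq sg (J e M `&` N) Kr)%N.
  apply: dq_add => //.
  by apply: fin_sub (finN e) => // x [].
split; first by rewrite e1 e2 e3 e4 leq_add2r leq_addl.
by rewrite e1 e2 e3 e4 -e5 e6; lia.
Qed.

End Step.

Section Frobenius.
Variable aa : set A.
Hypothesis Csa : Csub be ga aa.
Hypothesis aC : aa `<=` C.
Let U e := addsp aa (J e C).

Lemma addsp_Csub V V' : Csub be ga V -> Csub be ga V' -> Csub be ga (addsp V V').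
Proof.
move=> [V0 VD VC] [V'0 V'D V'C]; split.
- by exists 0, 0; rewrite addr0.
- move=> _ _ [u [v [Vu Vv ->]]] [u' [v' [Vu' Vv' ->]]].
  by exists (u + u'), (v + v'); split; [apply: VD | apply: V'D | ring].
- move=> c _ Cc [u [v [Vu Vv ->]]].
  by exists (c * u), (c * v); split; [apply: VC | apply: V'C | ring].
Qed.

Lemma U_Csub e : Csub be ga (U e).
Proof. by apply: addsp_Csub => //; apply: J_Csub. Qed.

Lemma U_sub e : U e `<=` C.
Proof.
by have [_ CD _] := CsC; move=> _ [u [v [/aC Cu /(J_sub CsC) Cv ->]]]; apply: CD.
Qed.

Lemma U_frob e u : U e u -> U e.+1 (u ^+ p).
Proof.
move=> [v [j [av Jj ->]]]; have := frobD 1 v j pA; rewrite expn1 => ->.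
have [_ _ aC'] := Csa.
exists (v ^+ p), (j ^+ p); split => //.
  by rewrite -(prednK p0) exprSr; apply: aC' => //; apply/CX/aC.
elim: Jj => [|x m a Ix Cm _ IH]; first by rewrite expr0n gtn_eqF//; exact: pmul_zero.
have := frobD 1 (x ^+ q0 * m) a pA; rewrite expn1 => ->.
rewrite exprMn -exprM mulnC exprM; apply: pmul_add => //; first exact: Ip.
exact: CX.
Qed.

Definition monom (al : nat -> nat) : A := \prod_(i < d) be X`_i ^+ al i.

Lemma monom_C al : C (monom al).
Proof.
rewrite /monom; elim/big_ind: _ => // i _; rewrite -rmorphXn; exact: (C_be C1).
Qed.

Lemma monom_incr al j : (j < d)%N ->
  monom (fun i => al i + (i == j))%N = be X`_j * monom al.
Proof.
move=> jd; rewrite /monom (bigD1 (Ordinal jd))//= [in RHS](bigD1 (Ordinal jd))//=.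
rewrite eqxx addn1 exprS -mulrA; congr (_ * (_ * _)).
apply: eq_bigr => i; rewrite -val_eqE /= => /negbTE ->; by rewrite addn0.
Qed.

(** By the pigeonhole principle some exponent is at least p^(e+j0). *)
Lemma monom_large e (al : nat -> nat) c : C c -> (d * p ^ (e + j0) < \sum_(i < d) al i)%N -> U e (monom al * c).
Proof.
move=> Cc lt; have [i ali] : exists i : 'I_d, (p ^ (e + j0) <= al i)%N.
  apply: contrapT => h; move: lt; rewrite ltnNge => /negP; apply.
  apply: (@leq_trans (\sum_(i < d) p ^ (e + j0))%N); last by rewrite sum_nat_const card_ord.
  apply: leq_sum => i _.
  by rewrite leqNgt; apply/negP => /ltnW ai; apply: h; exists i.
apply: addspr; first by have [] := Csa.
have [_ _ JC] := J_Csub e CsC.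
rewrite /monom (bigD1 i)//= -(subnK ali) exprD.
set P1 := _ ^+ (_ - _)%N; set P2 := \prod_(_ < _ | _) _; set P3 := _ ^+ _.
have -> : P1 * P3 * P2 * c = (P1 * P2) * (P3 * c) by ring.
apply: JC; last by apply: J_X => //; apply: mem_nth.
apply: CM; first by rewrite /P1 -rmorphXn; apply: (C_be C1).
rewrite /P2; elim/big_ind: _ => // j _.
by rewrite -rmorphXn; apply: (C_be C1).
Qed.

(* C/U_e is spanned by dq (U e) C elements; their p-th powers, multiplied by the
   p^d monomials of exponents less than p, span C/U_(e+1) up to C/E, where E is the
   span of the p^(j0+1)-st powers. *)
Lemma frobenius_ineq :
  negligible p d (fun e => dq sg (U e.+1) C - p ^ d * dq sg (U e) C)%N.
Proof.
have [C0 CD _] := CsC.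
pose E := inspan be (frob_list p 1 ga).
have EC : E `<=` C.
  by apply: inspan_sub => // _ /mapP[g gga ->]; rewrite expn1; apply/CX/inspan_mem.
have sE : subsp be E by exact: inspan_subsp.
have sU e : subsp be (U e) by apply/CsB/U_Csub.
have sUg e : subsp sg (U e) by apply/(subsp_restr bi)/sU.
have sCg : subsp sg C by exact: sub_sg CsC.
pose V e := addsp (U e.+1) E.
have sV e : subsp be (V e) by apply: addsp_subsp.
have sVg e : subsp sg (V e) by apply: (subsp_restr bi).
have VC e : V e `<=` C by move=> _ [u [v [/U_sub Cu /EC Cv ->]]]; apply: CD.
have UV e : U e.+1 `<=` V e by apply: addspl; exact: inspan0.
have finU e : fin_over sg (U e) C.
  by apply: fin_sub (J_fin e CsC) => //; apply: addspr; have [] := Csa.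
have [de' [de'0 deE]] := stabC 1.
have Vneg : negligible p d (fun e => dq sg (V e) C).
  apply: (negligible_level (j := j0.+1)) => //.
  have [K HK] := est_tor bi regX de'0; exists (size ga * K)%N => e.
  have [|x y xX yga|y yga|t [st ts]] := HK (p ^ (e + j0.+1))%N (V e) ga.
  - exact: sV.
  - apply/UV/addspr; first by have [] := Csa.
    by rewrite addnS -addSn; apply: J_X => //; apply: inspan_mem.
  - apply: addspr; first by have [] := U_Csub e.+1.
    exact/deE/inspan_mem.
  by apply: leq_trans st; rewrite leq_mul2r; apply/orP; right; apply: dq_le.
apply: negligible_le Vneg => e.
rewrite leq_subLR (dq_add (sUg e.+1) (sVg e) sCg (@UV e) (@VC e) (finU e.+1)) leq_add2r.
have [tC [stC tCC tCs _]] := dqP (sUg e) sCg (@U_sub e) (finU e).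
have [_ _ boxX _] := regX; have [tB [stB tBs]] := boxX p.
pose T := [seq be z * y ^+ p | z <- tB, y <- tC].
have sT : size T = (p ^ d * dq sg (U e) C)%N by rewrite size_allpairs stB stC.
rewrite -sT.
pose W := addsp (U e.+1) (inspan sg T).
have sW : subsp sg W by apply: addsp_subsp => //; apply: inspan_subsp.
have [W0 WD WZ] := sW.
have UW : U e.+1 `<=` W by apply: addspl; exact: inspan0.
have spec b y : inspan io tB b -> C y -> W (be b * y ^+ p).
  move=> tb Cy.
  apply: (@inspan_sub _ _ io tB [set b | W (be b * y ^+ p)] _ _ b tb).
    split; rewrite /= ?rmorph0 ?mul0r//.
      by move=> b1 b2 Wb1 Wb2; rewrite rmorphD mulrDl; apply: WD.
    by move=> c b1 Wb1; rewrite rmorphM bi -mulrA; apply: WZ.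
  move=> z ztB /=; have [u [v [Uu tv ->]]] := tCs y Cy.
  have := frobD 1 u v pA; rewrite expn1 => ->; rewrite mulrDr.
  apply: WD; first by apply: UW; have [_ _ UC] := sU e.+1; apply/UC/U_frob.
  apply: addspr; first by have [] := sU e.+1.
  have {tv} : inspan sg (frob_list p 1 tC) (v ^+ p).
    by have := inspan_frob pA 1 tv; rewrite expn1.
  apply: (@inspan_sub _ _ sg _ [set a | inspan sg T (be z * a)]).
    split; rewrite /= ?mulr0; first exact: inspan0.
      by move=> a a' ? ?; rewrite mulrDr; apply: inspanD.
    by move=> c a ?; rewrite mulrCA; apply: inspanZ.
  move=> _ /mapP[y' y'tC ->] /=; rewrite expn1; apply: inspan_mem.
  by apply/allpairsP; exists (z, y').
(* This replaces a use of Nakayama. Modulo the span of [tB], b is a combination of the X_i^p, and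
   X_i^p is absorbed into the p-th power, raising the degree of the monomial by one; m counts the
   steps left until [monom_large] applies. *)
have desc m (al : nat -> nat) b c : C c -> (d * p ^ (e + j0) < \sum_(i < d) al i + m)%N ->
    W (be b * (monom al * c) ^+ p).
  elim: m al b => [|m IH] al b Cc.
    rewrite addn0 => lt; apply: UW; have [_ _ UC] := sU e.+1; apply/UC/U_frob.
    exact: monom_large.
  move=> lt; have [u [v [/inspan_coef[g uE] tv ->]]] := tBs b Logic.I.
  rewrite rmorphD mulrDl; apply: WD; last by apply: spec => //; apply: CM => //; apply: monom_C.
  rewrite uE rmorph_sum mulr_suml; apply: (subsp_sum _ sW) => i _.
  have iltd : (i < d)%N by rewrite /d -(size_map (fun x => x ^+ p) X); exact: ltn_ord.
  rewrite rmorphM (nth_map 0)// rmorphXn -mulrA -exprMn mulrA -monom_incr//.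
  apply: IH => //.
  have s1 : (\sum_(j < d) (j == i :> nat) = 1)%N.
    rewrite (bigD1 (Ordinal iltd))//= eqxx big1// => j.
    by rewrite -val_eqE /= => /negbTE ->.
  by rewrite big_split/= s1 addn1 addSnnS.
have EW x : E x -> W x.
  move=> /inspan_coef[g ->]; apply: (subsp_sum _ sW) => i _.
  have : (frob_list p 1 ga)`_i \in frob_list p 1 ga by apply: mem_nth.
  move=> /mapP[y yga ->]; rewrite expn1.
  have := @desc (d * p ^ (e + j0)).+1 (fun=> 0%N) (g i) y (inspan_mem be yga).
  rewrite (_ : monom _ = 1); last by rewrite /monom big1.
  by rewrite mul1r; apply; rewrite big1.
have VW : V e `<=` W by move=> _ [u [v [/UW Wu /EW Wv ->]]]; apply: WD.
by apply: dq_le => //; apply: UV.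
Qed.

End Frobenius.

(** The Frobenius inequality is available for cyclic C-modules only. Hence G is the sum of the
    counts of the cyclic pieces met while adding generators, and it agrees with the actual dimension
    up to a negligible error. *)
Lemma list_asym (s : seq A) : exists (nu : seq A) (G : nat -> nat),
  [/\ Csub be ga (inspan be nu), forall y, y \in s -> inspan be nu y,
     negligible p d (fun e => G e - dq sg (J e (inspan be nu)) (inspan be nu))%N,
     negligible p d (fun e => dq sg (J e (inspan be nu)) (inspan be nu) - G e)%N &
     negligible p d (fun e => G e.+1 - p ^ d * G e)%N].
Proof.
elim: s => [|y s [nu [G [CsN sN GN NG GG]]]].
  have Cs0 : Csub be ga (inspan be [::]).
    by split => //= [x z -> ->|c x _ ->]; rewrite ?addr0 ?mulr0.
  exists [::], (fun=> 0%N); split => //; last by exists 0%N => e; rewrite muln0.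
    by exists 0%N => e; rewrite sub0n.
  exists 0%N => e; rewrite (_ : dq _ _ _ = 0%N)//; apply/eqP; rewrite -leqn0.
  apply: (@dq_le _ _ _ _ _ [::]); [exact/sub_sg/J_Csub|exact: sub_sg|exact: J_sub|].
  by move=> x /= ->; exists 0, 0; rewrite addr0; split => //; exact: pmul_zero.
have [r [rneg rP]] := step_dim y CsN; have CsM := step_Csub y CsN.
have Csa := step_aa y CsN.
rewrite step_span in rP CsM.
have Fneg := frobenius_ineq Csa (fun c => @proj1 _ _).
set nu' := nu ++ _ in rP CsM.
exists nu', (fun e => G e + dq sg (addsp [set c | C c /\ inspan be nu (c * y)] (J e C)) C)%N.
split => //.
- move=> z; rewrite inE => /orP[/eqP->|/sN zN].
    rewrite /nu' -step_span; exists 0, 1; rewrite mul1r add0r; split => //; exact: inspan0.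
  by rewrite /nu' -step_span; exists z, 0; rewrite mul0r addr0; split => //; exact: inspan0.
- apply: negligible_le (negligibleD GN rneg) => e; have [_] := rP e; lia.
- apply: negligible_le NG => e; have [+ _] := rP e; lia.
- apply: negligible_le (negligibleD GG Fneg) => e.
  rewrite mulnDr; set a := (p ^ d * G e)%N; set b := (p ^ d * _)%N; lia.
Qed.

Let sT : subsp sg [set: A]. Proof. by []. Qed.

Lemma J_ideal e : is_ideal (J e setT).
Proof. by split; [exact: pmul_zero | exact: pmulD | move=> c x; apply: pmulZ]. Qed.

Lemma span_total (nu : seq A) : (forall y, y \in w -> inspan be nu y) -> inspan be nu = setT.
Proof.
move=> wnu; apply/seteqP; split => // a _; move: (gen a).
by apply: inspan_sub => //; apply: inspan_subsp.
Qed.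

Lemma total_asym : exists G : nat -> nat,
  [/\ negligible p d (fun e => G e - dq sg (J e setT) setT)%N,
     negligible p d (fun e => dq sg (J e setT) setT - G e)%N &
     negligible p d (fun e => G e.+1 - p ^ d * G e)%N].
Proof.
have [nu [G [_ /span_total -> GN NG GG]]] := list_asym w.
by exists G.
Qed.

Lemma J_finT e : fin_over sg (J e setT) setT.
Proof.
by have := @J_fin e w; rewrite (span_total (nu := w)); [apply; split | exact: inspan_mem].
Qed.

Variables (x1 : B) (c1 : nat).
Hypothesis x1X : x1 \in X.
Hypothesis Ix1 : forall e a, I (e + j0)%N a -> J e setT (be x1 ^+ c1 * a).

Lemma I_iter e j u : I e u -> I (e + j)%N (u ^+ (p ^ j)).
Proof.
elim: j => [|j IH] Iu; first by rewrite addn0.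
by rewrite addnS expnSr exprM; apply/Ip/IH.
Qed.

Lemma J_I e : J e setT `<=` I (e + j0)%N.
Proof.
have [I0 ID IM] := Iid (e + j0).
by move=> a; apply: pmul_subl => // u m Iu _; apply: (is_idealMr _ (Iid _)); exact: I_iter.
Qed.

(** Put V = U + J_e, V' = U + I_(e+j0) and y = x1^c1, so that y V' lies in V. Then (V + yA)/V is
    isomorphic to A/(V : y), a quotient of A/V', and the excess of A/V over A/V' is at most the
    dimension of A/(V + yA), which y kills. *)
Lemma frob_level_dim (U : set A) : is_ideal U ->
  negligible p d (fun e => dq sg (addsp U (J e setT)) setT - dq sg (addsp U (I (e + j0)%N)) setT)%N /\
  forall e, (dq sg (addsp U (I (e + j0)%N)) setT <= dq sg (addsp U (J e setT)) setT)%N.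
Proof.
move=> idU; have [U0 UD UM] := idU.
pose V e := addsp U (J e setT); pose V' e := addsp U (I (e + j0)%N).
have idV e : is_ideal (V e) by apply: addsp_subsp => //; apply: J_ideal.
have idV' e : is_ideal (V' e) by apply: addsp_subsp.
have VV' e : V e `<=` V' e by apply: addspS => //; exact: J_I.
have sV e : subsp sg (V e) by apply: ideal_subsp.
have sV' e : subsp sg (V' e) by apply: ideal_subsp.
have finV e : fin_over sg (V e) setT.
  by apply: fin_sub (J_finT e) => //; apply: addspr.
split; last first.
  by move=> e; rewrite [X in (_ <= X)%N](dq_add (sV e) (sV' e) sT (VV' e) _ (finV e))// leq_addl.
pose y := be x1 ^+ c1.
pose VY e := addsp (V e) [set y * a | a in setT].
have idY : is_ideal [set y * a | a in setT] by apply: mulset_subsp.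
have idVY e : is_ideal (VY e) by apply: addsp_subsp.
have VVY e : V e `<=` VY e by apply: addspl; exists 0; rewrite ?mulr0.
have sVY e : subsp sg (VY e) by apply: ideal_subsp.
have domX : x1 ^+ c1 <> 0 by apply: no_zero_divX => //; have [_ X0 _ _] := regX; apply: X0.
have tneg : negligible p d (fun e => dq sg (VY e) setT).
  apply: (tor_negligible (de' := x1 ^+ c1) (nu := w)) => //.
  - by move=> e; apply: ideal_subsp.
  - by move=> e x _; exists 0, x; rewrite add0r; split => //; have [] := idVY e.
  - by move=> e x z xX zw; apply/VVY/addspr => //; apply: J_X.
  - move=> e z zw; apply: addspr; first by have [] := idV e.
    by exists z => //; rewrite rmorphXn.
apply: negligible_le tneg => e.
rewrite (dq_add (sV e) (sVY e) sT (VVY e) _ (finV e))//.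
suff h : (dq sg (V e) (VY e) <= dq sg (V' e) setT)%N by rewrite leq_subLR leq_add2r.
pose Kr := [set a | V e (y * a)].
have idK : is_ideal Kr.
  have [V0 VD VM] := idV e; split; first by rewrite /Kr /= mulr0.
    by move=> a b Va Vb; rewrite /Kr /= mulrDr; apply: VD.
  by move=> c a Va; rewrite /Kr /= mulrCA; apply: VM.
have sK : subsp sg Kr by apply: ideal_subsp.
have V'K : V' e `<=` Kr.
  move=> _ [u [v [Uu Iv ->]]]; rewrite /Kr /= mulrDr; exists (y * u), (y * v).
  by split => //; [apply: UM | apply: Ix1].
have finV' : fin_over sg (V' e) setT by apply: fin_sub (finV e).
have -> : dq sg (V e) (VY e) = dq sg Kr setT.
  apply: (dq_iso (g := fun a => y * a)) => //.
  - by apply: fin_sub (finV').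
  - by move=> a b _ _; rewrite mulrDr.
  - by move=> c a _; rewrite mulrCA.
  - by move=> a _; apply: addspr; [have [] := idV e | exists a].
  - by move=> _ [v [_ [Vv [a _ <-] ->]]]; exists a; rewrite ?addrK.
by rewrite (dq_add (sV' e) sK sT V'K _ finV')// leq_addl.
Qed.

Theorem total_limit : exists G : nat -> nat,
  [/\ negligible p d (fun e => G e - dq sg (I (e + j0)%N) setT)%N,
     negligible p d (fun e => dq sg (I (e + j0)%N) setT - G e)%N &
     negligible p d (fun e => G e.+1 - p ^ d * G e)%N].
Proof.
have id0 : is_ideal [set 0 : A].
  by split => // [x y -> ->|c x ->]; rewrite ?addr0 ?mulr0.
have add0 (V : set A) : addsp [set 0] V = V.
  apply/seteqP; split => [_ [u [v [-> Vv ->]]]|v Vv]; first by rewrite add0r.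
  by exists 0, v; rewrite add0r.
have [cneg cle] := frob_level_dim id0; have [G [G1 G2 G3]] := total_asym.
exists G; split => //.
- by apply: negligible_le (negligibleD G1 cneg) => e; rewrite !add0; lia.
- by apply: negligible_le G2 => e; have := cle e; rewrite !add0; lia.
Qed.

(** With J_e in place of I_(e+j0), the isomorphism theorems give the additivity exactly, up to the
    dimension of ((s + J_e) cap (r + J_e))/J_e. The C-linear extension of b times the projection r +
    s -> r shows that b kills this defect. *)
Theorem total_add (r s : set A) : is_ideal r -> is_ideal s -> (forall a, r a -> s a -> a = 0) ->
  let f U e := dq sg (addsp U (I (e + j0)%N)) setT in
  negligible p d (fun e => (f [set 0%R] e + f (addsp r s) e) - (f r e + f s e))%N /\
  negligible p d (fun e => (f r e + f s e) - (f [set 0%R] e + f (addsp r s) e))%N.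
Proof.
move=> idr ids rs0 f.
have id0 : is_ideal [set 0 : A].
  by split => // [x y -> ->|c x ->]; rewrite ?addr0 ?mulr0.
have idrs : is_ideal (addsp r s) by apply: addsp_subsp.
pose g U e := dq sg (addsp U (J e setT)) setT.
have [c0 l0] := frob_level_dim id0; have [cr lr] := frob_level_dim idr.
have [cs ls] := frob_level_dim ids; have [crs lrs] := frob_level_dim idrs.
suff [h1 h2] : negligible p d (fun e => (g [set 0%R] e + g (addsp r s) e) - (g r e + g s e))%N /\
    forall e, (g r e + g s e <= g [set 0%R] e + g (addsp r s) e)%N.
  split.
    apply: negligible_le (negligibleD h1 (negligibleD cr cs)) => e.
    have ar (f0 frs fr fs g0 grs gr gs : nat) : (frs <= grs -> f0 <= g0 -> f0 + frs - (fr + fs) <=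
      g0 + grs - (gr + gs) + (gr - fr + (gs - fs)))%N by lia.
    exact: ar (lrs e) (l0 e).
  apply: negligible_le (negligibleD c0 crs) => e.
  have ar (f0 frs fr fs g0 grs gr gs : nat) : (gr + gs <= g0 + grs -> fr <= gr -> fs <= gs ->
    fr + fs - (f0 + frs) <= (g0 - f0) + (grs - frs))%N by lia.
  exact: ar (h2 e) (lr e) (ls e).
have CsI (U : set A) : is_ideal U -> Csub be ga U by move=> [U0 UD UM]; split => // c x _; apply: UM.
have [r0 rD rM] := idr; have [s0 sD sM] := ids.
have CsT : Csub be ga setT by [].
pose dec a := xget 0 [set x | r x /\ s (a - x)].
have decE x y : r x -> s y -> dec (x + y) = x.
  move=> rx sy; rewrite /dec; apply: xget_subset1; first by split => //; rewrite addrC addKr.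
  move=> u v [ru su] [rv sv]; apply/eqP; rewrite -subr_eq0; apply/eqP/rs0.
    exact: (subspB idr).
  have -> : u - v = (x + y - v) - (x + y - u) by ring.
  exact: (subspB ids).
have [b [psi [b0 [psiD psiZ _] psiC psiE]]] : exists b g, [/\ b <> 0, lin_on be setT setT g,
    forall c x, C c -> setT x -> g (c * x) = c * g x & forall x, addsp r s x -> g x = be b * dec x].
  apply: (@C_linear_ext A B be ga p domB pA C1 CM stabC setT (addsp r s) setT CsT (CsI _ idrs) CsT w dec) => //.
  - by move=> a _; exists 0, a; rewrite add0r; split => //; exists 0, 0; rewrite addr0.
  - move=> _ _ [x [y [rx sy ->]]] [x' [y' [rx' sy' ->]]].
    rewrite (_ : x + y + (x' + y') = (x + x') + (y + y')); last by ring.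
    by rewrite !decE//; [apply: rD | apply: sD].
  - move=> c _ _ [x [y [rx sy ->]]]; rewrite mulrDr !decE//; [exact: rM | exact: sM].
have tneg : negligible p d (fun e => dq sg (addsp (J e setT) [set be b * a | a in setT]) setT).
  have idb : is_ideal [set be b * a | a in setT] by apply: mulset_subsp.
  have idV e : is_ideal (addsp (J e setT) [set be b * a | a in setT]).
    by apply: addsp_subsp => //; apply: J_ideal.
  apply: (tor_negligible (de' := b) (nu := w)) => //.
  - by move=> e; apply: ideal_subsp.
  - by move=> e x _; exists 0, x; rewrite add0r; split => //; have [] := idV e.
  - by move=> e x z xX zw; apply/addspl; [exists 0; rewrite ?mulr0 | apply: J_X].
  - by move=> e z zw; apply: addspr; [exact: pmul_zero | exists z].
have psiJ e a : J e setT a -> J e setT (psi a).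
  apply: (@pmul_map _ _ _ setT setT psi) => //.
    by have := psiZ 0 0 Logic.I; rewrite rmorph0 !mul0r.
  by move=> u m a' _ _ _; rewrite psiD// psiC//; apply: Cq.
pose Vb e := addsp (J e setT) [set be b * a | a in setT].
suff main e : exists2 D, (D <= dq sg (Vb e) setT)%N &
    (g [set 0%R] e + g (addsp r s) e = g r e + g s e + D)%N.
  split; last by move=> e; have [D _ ->] := main e; apply: leq_addr.
  by apply: negligible_le tneg => e; have [D DV ->] := main e; rewrite addKn.
have idJ := J_ideal e; have [J0 JD JM] := idJ.
set Je := J e setT in idJ J0 JD JM *.
have sg_id V : is_ideal V -> subsp sg V by exact: ideal_subsp.
pose jr := addsp r Je; pose js := addsp s Je; pose jrs := addsp (addsp r s) Je.
have idjr : is_ideal jr by apply: addsp_subsp.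
have idjs : is_ideal js by apply: addsp_subsp.
have idjrs : is_ideal jrs by apply: addsp_subsp.
have idE : is_ideal (js `&` jr) by apply: setI_subsp.
have Jjr : Je `<=` jr by apply: addspr.
have Jjs : Je `<=` js by apply: addspr.
have JE : Je `<=` js `&` jr by move=> a Ja; split; [apply: Jjs | apply: Jjr].
have fJ : fin_over sg Je setT := J_finT e.
have fsub (V W : set A) : Je `<=` V -> fin_over sg V W by move=> JV; apply: fin_sub fJ.
have e1 : g [set 0%R] e = (dq sg Je jr + g r e)%N.
  rewrite /g (_ : addsp [set 0] (J e setT) = Je); first by apply: dq_add => //; exact: sg_id.
  apply/seteqP; split => [_ [u [v [-> Vv ->]]]|v Vv]; first by rewrite add0r.
  by exists 0, v; rewrite add0r.
have jsjrs : js `<=` jrs.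
  move=> _ [u [v [su Jv ->]]]; exists u, v; split => //; exact: addspr.
have e2 : g s e = (dq sg js jrs + g (addsp r s) e)%N.
  by apply: dq_add; [exact: sg_id | exact: sg_id | by [] | by [] | by [] | exact: fsub].
have e3 : dq sg js jrs = dq sg (js `&` jr) jr.
  rewrite (_ : jrs = addsp js jr); first by apply: dq_addsp; [exact: sg_id | exact: sg_id | exact: fsub].
  apply/seteqP; split.
    move=> _ [_ [v [[x [y [rx sy ->]]] Jv ->]]]; exists (y + v), x; split; last by ring.
      by exists y, v.
    exact: addspl.
  move=> _ [_ [_ [[y [v [sy Jv ->]]] [x [v' [rx Jv' ->]]] ->]]].
  by exists (x + y), (v + v'); split; [exists x, y | apply: JD | ring].
have e4 : dq sg Je jr = (dq sg Je (js `&` jr) + dq sg (js `&` jr) jr)%N.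
  by apply: dq_add; [exact: sg_id | exact: sg_id | exact: sg_id | by [] | by move=> a [] | exact: fsub].
(* If v = x + i = y + i' with x in r, y in s and i, i' in J_e, then x - y is in J_e; its image under
   [psi] is b x, so b v is in J_e. *)
exists (dq sg Je (js `&` jr)); last by rewrite e1 e2 e3 e4; lia.
pose Kr := [set x | setT x /\ Je (be b * x)].
have <- : dq sg Je Kr = dq sg (Vb e) setT.
  apply: dq_ker_coker => //; first exact: sg_id.
  - by move=> x y _ _; rewrite mulrDr.
  - by move=> c x _; rewrite mulrCA.
  - by move=> x; apply: JM.
have idK : is_ideal Kr.
  split; first by split => //; rewrite mulr0.
    by move=> x y [_ Jx] [_ Jy]; split => //; rewrite mulrDr; apply: JD.
  by move=> c x [_ Jx]; split => //; rewrite mulrCA; apply: JM.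
have EK : js `&` jr `<=` Kr.
  move=> v [[y [i' [sy Ji' vE']]] [x [i [rx Ji vE]]]]; split => //.
  have xy : Je (x - y).
    rewrite (_ : x - y = i' - i); first exact: (subspB idJ).
    by apply/eqP; rewrite subr_eq addrAC -subr_eq opprK addrC -vE vE'; apply/eqP; ring.
  rewrite vE mulrDr; apply: JD; last exact: JM.
  have <- : psi (x - y) = be b * x; last exact: psiJ.
  have sNy : s (- y) by apply: (subspN ids).
  by rewrite psiE ?decE//; exists x, (- y).
rewrite (@dq_add _ _ sg Je (js `&` jr) Kr)//; [exact: leq_addr | exact: sg_id | exact: sg_id | exact: sg_id | exact: fsub].
Qed.

End FixLevel.
Hypothesis Ix : exists2 x1, x1 \in X & forall j, exists c, forall e a,
  I (e + j)%N a -> pmul (I e) (p ^ j) setT (be x1 ^+ c * a).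

Theorem asym_limit : exists j0 (G : nat -> nat),
  [/\ negligible p d (fun e => G e - dq sg (I (e + j0)%N) setT)%N,
     negligible p d (fun e => dq sg (I (e + j0)%N) setT - G e)%N &
     negligible p d (fun e => G e.+1 - p ^ d * G e)%N].
Proof.
have [x1 x1X x1P] := Ix.
have [j0 [de [de0 deP]]] := frob_span_stab domB pA gen.
have [c cP] := x1P j0.
by exists j0; apply: (total_limit de0 deP x1X cP).
Qed.

Theorem asym_add (r s : set A) : is_ideal r -> is_ideal s -> (forall a, r a -> s a -> a = 0) ->
  let f U e := dq sg (addsp U (I e)) setT in
  exists j0, negligible p d (fun e => (f [set 0%R] (e + j0) + f (addsp r s) (e + j0)) -
      (f r (e + j0) + f s (e + j0)))%N /\
    negligible p d (fun e => (f r (e + j0) + f s (e + j0)) -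
      (f [set 0%R] (e + j0) + f (addsp r s) (e + j0)))%N.
Proof.
move=> idr ids rs0 f; have [x1 x1X x1P] := Ix.
have [j0 [de [de0 deP]]] := frob_span_stab domB pA gen.
have [c cP] := x1P j0.
by exists j0; apply: (total_add de0 deP x1X cP).
Qed.

End Asymptotics.

Lemma asym_bound (k A B : comNzRingType) (sg : {rmorphism k -> A}) (io : {rmorphism k -> B})
    (be : {rmorphism B -> A}) (X : seq B) (w : seq A) (V : set A) n :
  (forall c, be (io c) = sg c) -> regular_like io X -> (forall a, inspan be w a) ->
  is_ideal V -> (forall x, x \in X -> V (be x ^+ n)) ->
  exists t, size t = (size w * n ^ size X)%N /\ spans sg V setT t.
Proof.
move=> bi regX gen idV VX.
have [|x y xX _|t [st ts]] := @est_box _ _ _ sg io be bi X regX n V w.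
- exact: ideal_subsp.
- by apply: (is_idealMr _ idV); apply: VX.
- by exists t; split => // a _; apply: ts.
Qed.

(** * Noetherian local rings *)

Section IdealPowers.
Variable A : comNzRingType.
Implicit Types I J : set A.

Lemma pmul_ideal I q J : is_ideal J -> is_ideal (pmul I q J).
Proof.
move=> idJ; split; [exact: pmul_zero | exact: pmulD | move=> c x].
by apply: pmulZ => m; apply: is_idealMl.
Qed.

(** For q = 1, [pmul] is the ordinary product of an ideal with a module. *)
Fixpoint ipow I n : set A := if n is n'.+1 then pmul I 1 (ipow I n') else setT.

Lemma ipow_ideal I n : is_ideal (ipow I n).
Proof. by elim: n => [//|n IH]; apply: pmul_ideal. Qed.

Lemma ipow_mul I n a b : I a -> ipow I n b -> ipow I n.+1 (a * b).
Proof. by move=> Ia Ib; rewrite -[a]expr1; apply: pmul_mul. Qed.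

Lemma ipow1 I : is_ideal I -> ipow I 1 `<=` I.
Proof.
move=> idI; have [I0 ID IM] := idI; move=> a; apply: pmul_subl => // u m Iu _.
by rewrite expr1; apply: is_idealMr.
Qed.

Lemma ipow_sub1 I : is_ideal I -> I `<=` ipow I 1.
Proof. by move=> idI a Ia; rewrite -[a]mulr1; apply: ipow_mul. Qed.

Lemma ipowS I J n : I `<=` J -> ipow I n `<=` ipow J n.
Proof.
move=> IJ; elim: n => [//|n IH] a; apply: pmul_subl; first by have [] := ipow_ideal J n.+1.
  by have [_ + _] := ipow_ideal J n.+1; apply.
by move=> u m /IJ Ju /IH Jm; rewrite expr1; apply: ipow_mul.
Qed.

Lemma ipowM I m n a b : ipow I m a -> ipow I n b -> ipow I (m + n) (a * b).
Proof.
move=> + Ib; elim: m a => [|m IH] a; first by move=> _; apply: (is_idealMl _ (ipow_ideal I n)).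
rewrite addSn; apply: (@pmul_subl _ _ _ _ [set a | ipow I (m + n).+1 (a * b)]).
- by rewrite /= mul0r; have [] := ipow_ideal I (m + n).+1.
- by move=> x y Ix Iy; rewrite /= mulrDl; have [_ + _] := ipow_ideal I (m + n).+1; apply.
- by move=> u c Iu /IH Ic; rewrite /= expr1 -mulrA; apply: ipow_mul.
Qed.

Lemma ipow_le I m n : (m <= n)%N -> ipow I n `<=` ipow I m.
Proof.
move=> /subnK <-; elim: (n - m)%N => [//|d IH] a; rewrite addSn => h; apply: IH.
move: h; rewrite /=; apply: pmul_subl; first by have [] := ipow_ideal I (d + m).
  by have [_ + _] := ipow_ideal I (d + m); apply.
by move=> u b _ Ib; apply: (is_idealMl _ (ipow_ideal I (d + m))).
Qed.

Lemma ipowX I n a : I a -> ipow I n (a ^+ n).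
Proof. by move=> Ia; elim: n => [//|n IH]; rewrite exprS; apply: ipow_mul. Qed.

(* (I + zA)^n is generated by the z^i I^(n-i). *)
Lemma ipow_add_principal I (z : A) n J : is_ideal J ->
  (forall i a, (i <= n)%N -> ipow I (n - i)%N a -> J (z ^+ i * a)) ->
  ipow (addsp I (lideal [:: z])) n `<=` J.
Proof.
elim: n J => [|n IH] J idJ zJ; have [J0 JD JM] := idJ.
  by move=> a _; have := zJ 0%N a isT Logic.I; rewrite mul1r.
move=> a; apply: pmul_subl => // u b [i [_ [Ii /lideal1E[t ->] ->]]] zb; rewrite expr1 mulrDl.
apply: (JD).
  apply: (IH [set b | J (i * b)] _ _ b zb).
    split; rewrite /= ?mulr0//; first by move=> x y ? ?; rewrite mulrDr; apply: JD.
    by move=> c x ?; rewrite mulrCA; apply: JM.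
  move=> l c ln Ic; rewrite /= mulrCA; apply: zJ; first exact: leqW.
  by rewrite subSn//; apply: ipow_mul.
rewrite -mulrA; apply: (JM).
apply: (IH [set b | J (z * b)] _ _ b zb).
  split; rewrite /= ?mulr0//; first by move=> x y ? ?; rewrite mulrDr; apply: JD.
  by move=> c x ?; rewrite mulrCA; apply: JM.
by move=> l c ln Ic; rewrite /= mulrA -exprS; apply: zJ.
Qed.

Lemma lideal_cons (z : A) (s : seq A) : lideal (z :: s) `<=` addsp (lideal s) (lideal [:: z]).
Proof.
move=> x [a xa]; exists (x - a * z), (a * z); split => //; last by rewrite subrK.
by exists a; rewrite subrr.
Qed.

(** In a monomial of degree q (n + [size s]), taking the exponents modulo q loses less than q for
    each generator, so what remains is the q-th power of a monomial of degree at least n. *)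
Lemma lideal_pow_frob (s : seq A) q n : (0 < q)%N ->
  ipow (lideal s) (q * (n + size s)) `<=` pmul (ipow (lideal s) n) q setT.
Proof.
move=> q0; elim: s n => [|z s IH] n.
  rewrite addn0; case: n => [|n].
    by move=> a _; rewrite -[a]mul1r -(expr1n A q); apply: pmul_mul.
  have -> : (q * n.+1 = (q * n.+1).-1.+1)%N by rewrite prednK// muln_gt0 q0.
  move=> a; apply: pmul_subl; [exact: pmul_zero | exact: pmulD |].
  by move=> u m -> _; rewrite expr1 mul0r; apply: pmul_zero.
set L := lideal (z :: s).
have idF : is_ideal (pmul (ipow L n) q setT) by apply: pmul_ideal.
have zL : L z by apply/inspan_mem/mem_head.
have sL : lideal s `<=` L by move=> a; apply: inspan_cons.
move=> a /(ipowS (@lideal_cons z s)); apply: ipow_add_principal => // i b iN sb.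
have iE := divn_eq i q; have rq : (i %% q < q)%N by apply: ltn_pmod.
set t := (i %/ q)%N in iE; set r := (i %% q)%N in iE rq.
(* For t > n the power of z alone suffices. Otherwise z supplies t of the n factors, and the
   remaining generators supply n - t by induction. *)
have [tn|nt] := leqP t n; last first.
  rewrite -(@subnK (n * q) i) ?exprD; last by rewrite iE; nia.
  rewrite [_ * z ^+ (n * q)]mulrC -mulrA exprM; apply: pmul_mul => //.
  exact: ipowX.
have := IH (n - t)%N b; set F := pmul _ _ _.
have Fb : F b.
  apply: IH; apply: ipow_le sb.
  by rewrite /=; nia.
move=> _; rewrite iE exprD mulrC mulrA mulrC.
apply: (is_idealMl _ idF).
elim: Fb => [|u m c su _ _ IHc]; first by rewrite mul0r; apply: pmul_zero.
rewrite mulrDl; apply: pmulD => //.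
rewrite exprM mulrAC -exprMn; apply: pmul_mul => //.
by rewrite -(subnK tn); apply: ipowM; [apply: ipowS su | apply: ipowX].
Qed.

Lemma lideal_pow_sub (s : seq A) J : is_ideal J -> (forall y, y \in s -> exists n, J (y ^+ n)) ->
  exists c, ipow (lideal s) c `<=` J.
Proof.
move=> idJ; have [J0 JD JM] := idJ.
elim: s => [|z s IH] sJ.
  exists 1%N => a; apply: pmul_subl => // u m -> _; by rewrite expr1 mul0r.
have [c cJ] := IH (fun y ys => sJ y (mem_behead (s := z :: s) ys)).
have [b bJ] := sJ z (mem_head _ _).
exists (c + b)%N => a /(ipowS (@lideal_cons z s)); apply: ipow_add_principal => // i x iN sx.
have [bi|ib] := leqP b i.
  by rewrite -(subnK bi) exprD; apply: (is_idealMr _ idJ); apply: JM.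
by apply: JM; apply: cJ; apply: ipow_le sx; lia.
Qed.

End IdealPowers.

(** * Primes in Noetherian rings *)

Section Noetherian.
Variable A : comNzRingType.
Implicit Types I J : set A.

Definition noeth : Prop := forall J : nat -> set A, (forall n, is_ideal (J n)) ->
  (forall n, J n `<=` J n.+1) -> exists n, forall i, (n <= i)%N -> J i `<=` J n.

Hypothesis noethA : noeth.

Lemma noeth_max (Q : set (set A)) : (forall J, Q J -> is_ideal J) -> (exists J, Q J) ->
  exists J, Q J /\ forall J', Q J' -> J `<=` J' -> J' `<=` J.
Proof.
move=> Qid [J0 QJ0]; apply: contrapT => nomax.
have st (J : set A) : exists J', Q J -> [/\ Q J', J `<=` J' & ~ J' `<=` J].
  case: (pselect (Q J)) => [QJ|]; last by exists J.
  apply: contrapT => h; apply: nomax; exists J; split => // J' QJ' JJ'.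
  by apply: contrapT => nJ; apply: h; exists J'.
have [f fP] := choice st.
pose J n := iter n f J0.
have QJ n : Q (J n) by elim: n => [//|n IH]; have [] := fP _ IH.
have Jle n : J n `<=` J n.+1 by have [] := fP _ (QJ n).
have [n nP] := noethA (fun n => Qid _ (QJ n)) Jle.
by have [_ _] := fP _ (QJ n); apply; apply: (nP n.+1).
Qed.

(** The finite list is taken inside the given generating set; [hat_pmul] needs generators that are
    q-th powers. *)
Lemma noeth_gen (G J : set A) : is_ideal J -> G `<=` J ->
  (forall J', is_ideal J' -> G `<=` J' -> J `<=` J') ->
  exists s : seq A, (forall y, y \in s -> G y) /\ J `<=` lideal s.
Proof.
move=> idJ GJ Jmin.
pose Q K := exists s : seq A, (forall y, y \in s -> G y) /\ K = lideal s.
have [||K [[s [sG KE]] smax]] := @noeth_max Q.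
- by move=> _ [s [_ ->]]; exact: lideal_ideal.
- by exists (lideal [::]), [::].
rewrite {}KE in smax.
exists s; split => //; apply: Jmin; first exact: lideal_ideal.
move=> g Gg; apply: (smax (lideal (g :: s))).
- by exists (g :: s); split => // y; rewrite inE => /orP[/eqP->//|/sG].
- by move=> x; apply: inspan_cons.
- exact/inspan_mem/mem_head.
Qed.

Lemma noeth_fg J : is_ideal J -> exists s : seq A, (forall y, y \in s -> J y) /\ J `<=` lideal s.
Proof. by move=> idJ; apply: noeth_gen. Qed.

Definition prime_set (Q : set A) : Prop :=
  [/\ is_ideal Q, ~ Q 1 & forall a b, Q (a * b) -> Q a \/ Q b].

Lemma add_principal J (a : A) : is_ideal J -> is_ideal (addsp J (lideal [:: a])).
Proof. by move=> idJ; apply: addsp_subsp => //; apply: lideal_ideal. Qed.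

(** An ideal maximal among those containing J and no power of y is prime. *)
Lemma prime_avoid_powers J y : is_ideal J -> (forall n, ~ J (y ^+ n)) ->
  exists Q, [/\ prime_set Q, J `<=` Q & ~ Q y].
Proof.
move=> idJ Jy.
pose F K := [/\ is_ideal K, J `<=` K & forall n, ~ K (y ^+ n)].
have [||Q [[idQ JQ Qy] Qmax]] := @noeth_max F; [by move=> K [] | by exists J; split |].
exists Q; split => //; last by have := Qy 1%N; rewrite expr1.
split => //; first by have := Qy 0%N; rewrite expr0.
have pow a : ~ Q a -> exists n t, Q (y ^+ n - t * a).
  move=> Qa; apply: contrapT => h; apply: Qa.
  apply: (Qmax (addsp Q (lideal [:: a]))).
  - split; [exact: add_principal | by move=> x /JQ; apply: addspl; apply: inspan0|].
    move=> n [u [_ [Qu /lideal1E[t ->] yE]]]; apply: h; exists n, t.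
    by rewrite yE addrK.
  - by apply: addspl; apply: inspan0.
  - by apply: addspr; [have [] := idQ | apply/inspan_mem/mem_head].
move=> a b Qab; apply: contrapT => /not_orP[/pow[n [t Qn]] /pow[n' [t' Qn']]].
apply: (Qy (n + n')%N); have [_ QD QM] := idQ.
have -> : y ^+ (n + n') = y ^+ n' * (y ^+ n - t * a) + t * a * (y ^+ n' - t' * b) + t * t' * (a * b).
  by rewrite exprD; ring.
by apply: (QD); [apply: (QD); apply: (QM) | apply: (QM)].
Qed.

(** Noetherian induction: a maximal counterexample is proper and not prime, so it contains a product
    a b without a or b. The finite families for J + (a) and J + (b) together serve for J. *)
Lemma finite_minimal_primes J : is_ideal J -> exists n (q : nat -> set A),
  (forall i, (i < n)%N -> prime_set (q i) /\ J `<=` q i) /\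
  forall Q, prime_set Q -> J `<=` Q -> exists2 i, (i < n)%N & q i `<=` Q.
Proof.
move=> idJ0; apply: contrapT => bad0.
pose bad J := is_ideal J /\ ~ exists n (q : nat -> set A),
  (forall i, (i < n)%N -> prime_set (q i) /\ J `<=` q i) /\
  forall Q, prime_set Q -> J `<=` Q -> exists2 i, (i < n)%N & q i `<=` Q.
have [||{J idJ0 bad0}J [[idJ Jbad] Jmax]] := @noeth_max bad; [by move=> K [] | by exists J; split |].
have J1 : ~ J 1.
  move=> J1; apply: Jbad; exists 0%N, (fun=> J); split => // Q [_ Q1 _] JQ.
  by case: Q1; apply: JQ.
have nprime : ~ prime_set J.
  move=> pJ; apply: Jbad; exists 1%N, (fun=> J); split=> [i _|Q _ JQ]; first by split.
  by exists 0%N.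
have [a [b [Jab Ja Jb]]] : exists a b, [/\ J (a * b), ~ J a & ~ J b].
  apply: contrapT => h; apply: nprime; split => // a b Jab.
  by apply: contrapT => /not_orP[Ja Jb]; apply: h; exists a, b.
have good c : ~ J c -> exists n (q : nat -> set A),
  (forall i, (i < n)%N -> prime_set (q i) /\ addsp J (lideal [:: c]) `<=` q i) /\
  forall Q, prime_set Q -> addsp J (lideal [:: c]) `<=` Q -> exists2 i, (i < n)%N & q i `<=` Q.
  move=> Jc; apply: contrapT => h; apply: Jc.
  apply: (Jmax (addsp J (lideal [:: c]))); first by split => //; apply: add_principal.
    by apply: addspl; apply: inspan0.
  by apply: addspr; [have [] := idJ | apply/inspan_mem/mem_head].
have [n [q [qP qmin]]] := good a Ja; have [n' [q' [q'P q'min]]] := good b Jb.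
have JJ c : J `<=` addsp J (lideal [:: c]) by apply: addspl; apply: inspan0.
apply: Jbad; exists (n + n')%N, (fun i => if (i < n)%N then q i else q' (i - n)%N); split.
  move=> i ilt; case: ltnP => ni.
    by have [? h] := qP _ ni; split => // x /(JJ a)/h.
  have [|? h] := q'P (i - n)%N; first by lia.
  by split => // x /(JJ b)/h.
move=> Q pQ JQ; have [idQ _ Qp] := pQ; have [_ QD QM] := idQ.
have sub c : Q c -> addsp J (lideal [:: c]) `<=` Q.
  by move=> Qc _ [u [_ [/JQ Qu /lideal1E[t ->] ->]]]; apply: QD => //; apply: QM.
have [/sub/(qmin Q pQ)[i il iQ]|/sub/(q'min Q pQ)[i il iQ]] := Qp _ _ (JQ _ Jab).
  by exists i; [apply: ltn_addr | rewrite il].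
by exists (n + i)%N; [rewrite ltn_add2l | rewrite ltnNge leq_addr/= addKn].
Qed.

Lemma prime_avoidance J n (q : nat -> set A) : is_ideal J ->
  (forall i, (i < n)%N -> prime_set (q i)) -> (forall i, (i < n)%N -> exists2 x, J x & ~ q i x) ->
  exists2 x, J x & forall i, (i < n)%N -> ~ q i x.
Proof.
move=> idJ; have [J0 JD JM] := idJ; elim: n q => [|n IH] q pq Jq; first by exists 0.
have [[i0 i0n sub]|nsub] := pselect (exists2 i, (i < n)%N & q i `<=` q n).
  (* A prime contained in q_n is avoided as soon as q_n is, so q_n takes its place. *)
  have [i il|i il|x Jx xq] := IH (fun i => if i == i0 then q n else q i).
  - by case: ifP => _; apply: pq => //; apply: ltnW.
  - by case: ifP => _; apply: Jq => //; apply: ltnW.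
  have xn : ~ q n x by have := xq i0 i0n; rewrite eqxx.
  exists x => // i; rewrite ltnS leq_eqVlt => /orP[/eqP->//|il].
  have := xq i il; case: ifP => [/eqP-> _ /sub|//]; exact: xn.
have [i il|i il|x Jx xq] := IH q; [by apply: pq; apply: ltnW | by apply: Jq; apply: ltnW|].
have [qx|nqx] := pselect (q n x); last first.
  by exists x => // i; rewrite ltnS leq_eqVlt => /orP[/eqP->|/xq].
have [idq q1 qp] := pq n (leqnn _).
have [y Jy qy] := Jq n (leqnn _).
have ex i : exists z, (i < n)%N -> q i z /\ ~ q n z.
  case: (ltnP i n) => [il|]; last by exists 0.
  apply: contrapT => h; apply: nsub; exists i => // z qz.
  by apply: contrapT => nz; apply: h; exists z.
have [z zP] := choice ex.
have zprod m : (m <= n)%N -> ~ q n (\prod_(i < m) z i).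
  elim: m => [|m IHm] mn; first by rewrite big_ord0.
  rewrite big_ord_recr /= => /qp[]; first exact/IHm/ltnW.
  by have [] := zP m mn.
(* The correction term lies in every q_i with i < n, where x does not lie, and outside q_n, where x
   lies. *)
exists (x + y * \prod_(i < n) z i).
  by apply: JD => //; apply: (is_idealMr _ idJ).
move=> i; rewrite ltnS leq_eqVlt => /orP[/eqP->|il] h.
  have : q n (y * \prod_(i < n) z i).
    by have := subspB idq h qx; rewrite addrC addKr.
  by move=> /qp[//|]; apply: zprod.
have [idqi _ _] := pq i (ltnW il); have [_ _ qM] := idqi.
apply: (xq i il); have [zi _] := zP i il.
have := subspB idqi h; rewrite (bigD1 (Ordinal il))//= mulrCA => /(_ (z i * (y * \prod_(i0 < n | i0 != Ordinal il) z i0))).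
rewrite addrK; apply; exact: (is_idealMr _ idqi).
Qed.

End Noetherian.

(** * Parameters and an Artin-Rees property *)

Section Local.
Variables (A : comNzRingType) (m : set A).
Hypothesis noethA : noeth A.
Hypothesis idm : is_ideal m.
Hypothesis m1 : ~ m 1.
Hypothesis unitm : forall x, ~ m x -> exists y, x * y = 1.
Implicit Types I J : set A.

Lemma local_sub J : is_ideal J -> ~ J 1 -> J `<=` m.
Proof.
move=> idJ J1 x Jx; apply: contrapT => /unitm[y xy].
by apply: J1; rewrite -xy; apply: (is_idealMr _ idJ).
Qed.

Lemma local_prime : prime_set m.
Proof.
split => // a b mab; have [|/unitm[y ay]] := pselect (m a); first by left.
by right; rewrite -[b]mul1r -ay mulrAC mulrC; apply: is_idealMl.
Qed.

Lemma fg_m : exists s : seq A, (forall y, y \in s -> m y) /\ m `<=` lideal s.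
Proof. exact: noeth_fg. Qed.

Lemma m_pow_sub J : is_ideal J -> (forall y, m y -> exists n, J (y ^+ n)) ->
  exists c, ipow m c `<=` J.
Proof.
move=> idJ Jm; have [s [sm ms]] := fg_m.
have [c cJ] := lideal_pow_sub idJ (fun y ys => Jm y (sm y ys)).
by exists c => a /(ipowS ms)/cJ.
Qed.

Definition prime_chain n (P : nat -> set A) : Prop :=
  (forall i, (i <= n)%N -> prime_set (P i)) /\
  forall i, (i < n)%N -> P i `<=` P i.+1 /\ ~ P i.+1 `<=` P i.

(** Choose x in m outside the primes q_i over J that do not contain m. A chain of positive length
    above J + (x) starts over some such q_i, which can be prepended strictly, so the bound on
    lengths drops by one. If every q_i contains m, x = 0 is taken, which keeps the size of xs equal
    to d. *)
Lemma system_of_parameters d J : is_ideal J ->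
  (forall n P, prime_chain n P -> J `<=` P 0%N -> (n <= d)%N) ->
  exists xs : seq A, [/\ size xs = d, forall x, x \in xs -> m x &
    exists c, ipow m c `<=` addsp J (lideal xs)].
Proof.
elim: d J => [|d IH] J idJ chJ.
  exists [::]; split => //.
  have [c cJ] : exists c, ipow m c `<=` J.
    apply: m_pow_sub => // y my; apply: contrapT => Jy.
    have [n Jn|Q [pQ JQ Qy]] := @prime_avoid_powers _ noethA J y idJ.
      by apply: Jy; exists n.
    have [idQ Q1 _] := pQ.
    have := chJ 1%N (fun i => if i is 0%N then Q else m); rewrite leqNgt => /(_ _ JQ)/negP; apply=> //.
    split=> [[|[|i]]//= _|[|i]//= _]; first exact: local_prime.
    by split; [apply: local_sub | move=> /(_ y my)].
  by exists c => a /cJ; apply: addspl; apply: inspan0.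
have [n [q [qP qmin]]] := finite_minimal_primes noethA idJ.
have [x mx xq] : exists2 x, m x & forall i, (i < n)%N -> ~ m `<=` q i -> ~ q i x.
  have [[i0 i0n mi0]|nq] := pselect (exists2 i, (i < n)%N & ~ m `<=` q i); last first.
    by exists 0; [have [] := idm | move=> i il h; case: nq; exists i].
  pose q' i := if `[< m `<=` q i >] then q i0 else q i.
  have q'n i : (i < n)%N -> exists2 x, m x & ~ q' i x.
    move=> il; have [j mj ->] : exists2 j, ~ m `<=` q j & q' i = q j.
      by rewrite /q'; case: asboolP => h; [exists i0 | exists i].
    by apply: contrapT => h; apply: mj => y my; apply: contrapT => qy; apply: h; exists y.
  have [|x mx xq] := @prime_avoidance A m n q' idm _ q'n.
    by move=> i il; rewrite /q'; case: ifP => _; [have [] := qP i0 i0n | have [] := qP i il].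
  exists x => // i il mi; have := xq i il; rewrite /q'.
  by case: asboolP.
have [||xs [sxs xsm [c cP]]] := IH (addsp J (lideal [:: x])).
- exact: add_principal.
- move=> l P [Pp Pc] JP; rewrite leqNgt; apply/negP => dl.
  have JJ : J `<=` P 0%N by move=> a Ja; apply: JP; apply: addspl Ja; apply: inspan0.
  have Px : P 0%N x.
    by apply: JP; apply: addspr; [have [] := idJ | apply/inspan_mem/mem_head].
  have [i il iP] := qmin _ (Pp 0%N isT) JJ.
  have [mq|nmq] := pselect (m `<=` q i).
    have l0 : (0 < l)%N by apply: leq_ltn_trans dl.
    have [_] := Pc 0%N l0; apply => a Pa; apply/iP/mq.
    have [idP P1 _] := Pp 1%N l0; exact: (local_sub idP P1).
  suff : (l.+1 <= d.+1)%N by rewrite ltnS leqNgt dl.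
  apply: (chJ l.+1 (fun i' => if i' is j.+1 then P j else q i)); last by have [] := qP i il.
  split=> [[|j] jl|[|j] jl]; [by have [] := qP i il | exact: Pp | | exact: Pc].
  by split => // /(_ x Px); apply: xq.
exists (x :: xs); split => //=; first by rewrite sxs.
  by move=> y; rewrite inE => /orP[/eqP->//|/xsm].
exists c => a /cP[_ [v [[u [t [Ju [b tb] ->]]] xv ->]]].
exists u, (t + v); rewrite addrA; split => //; exists b.
by move/eqP: tb; rewrite subr_eq add0r => /eqP ->; rewrite addrC addKr.
Qed.

(** Take J maximal with K inside J and J cap t inside K. For x in m let (J : x^i) be stable. If y =
    j + a x^i lies in t, then x^c y is in K, hence x^(c+i) a and so x^i a are in J, and y is in K.
    By maximality x^i lies in J. *)
Lemma weak_artin_rees (t K : set A) c : is_ideal t -> is_ideal K -> K `<=` t ->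
  (forall a b, ipow m c a -> t b -> K (a * b)) -> exists n, forall a, ipow m n a -> t a -> K a.
Proof.
move=> idt idK Kt mtK.
pose Q J := [/\ is_ideal J, K `<=` J & forall a, J a -> t a -> K a].
have [||J [[idJ KJ JtK] Jmax]] := @noeth_max _ noethA Q; [by move=> J [] | by exists K; split |].
suff [n nJ] : exists n, ipow m n `<=` J by exists n => a /nJ Ja; apply: JtK.
apply: m_pow_sub => // x mx.
have idJx i : is_ideal [set a | J (x ^+ i * a)].
  have [J0 JD JM] := idJ; split; rewrite /= ?mulr0//.
    by move=> a b Ja Jb; rewrite mulrDr; apply: JD.
  by move=> r a Ja; rewrite mulrCA; apply: JM.
have [|i iP] := noethA idJx.
  by move=> i a /= Ja; rewrite exprS -mulrA; apply: is_idealMl.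
exists i; apply: (Jmax (addsp J (lideal [:: x ^+ i]))).
- split; first exact: add_principal.
    by move=> a /KJ; apply: addspl; apply: inspan0.
  move=> y [j [_ [Jj /lideal1E[a ->] yE]]] ty.
  apply: JtK => //; have [_ JD JM] := idJ; rewrite yE; apply: JD => //.
  rewrite mulrC; apply: (iP (c + i)%N (leq_addl _ _)) => /=.
  have -> : x ^+ (c + i) * a = x ^+ c * y - x ^+ c * j by rewrite yE exprD; ring.
  apply: (subspB idJ); last exact: JM.
  by apply/KJ/mtK => //; apply: ipowX.
- by apply: addspl; apply: inspan0.
- by apply: addspr; [have [] := idJ | apply/inspan_mem/mem_head].
Qed.

(** The previous lemma is applied to r + s and its subideal (r cap m^c) + s. The difference x - x'
    of the two r- and s-components lies in a high power of m, hence in that subideal; as r cap s =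
    0, x itself is in m^c. *)
Lemma closure_inter (r s : set A) c : is_ideal r -> is_ideal s -> (forall a, r a -> s a -> a = 0) ->
  exists n, forall y, addsp r (ipow m n) y -> addsp s (ipow m n) y -> ipow m c y.
Proof.
move=> idr ids rs0; have [r0 rD rM] := idr; have [s0 sD sM] := ids.
have idt : is_ideal (addsp r s) by apply: addsp_subsp.
have [p0 pD pM] := ipow_ideal m c.
pose K : set A := [set a | exists x y, [/\ r x, ipow m c x, s y & a = x + y]].
have [|||n nK] := @weak_artin_rees (addsp r s) K c idt.
- split; first by exists 0, 0; rewrite addr0.
    move=> _ _ [x [y [rx px sy ->]]] [x' [y' [rx' px' sy' ->]]]; exists (x + x'), (y + y').
    by split; [apply: rD | apply: pD | apply: sD | ring].
  move=> b _ [x [y [rx px sy ->]]]; exists (b * x), (b * y).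
  by split; [apply: rM | apply: pM | apply: sM | exact: mulrDr].
- by move=> _ [x [y [rx px sy ->]]]; exists x, y.
- move=> a _ pa [x [y [rx sy ->]]]; exists (a * x), (a * y).
  by split; [apply: rM | apply: (is_idealMr _ (ipow_ideal m c)) | apply: sM | ring].
exists (maxn n c) => y [x [u [rx pu yE]]] [x' [u' [sx' pu' yE']]].
have pn v : ipow m (maxn n c) v -> ipow m n v by apply: ipow_le; apply: leq_maxl.
have pc v : ipow m (maxn n c) v -> ipow m c v by apply: ipow_le; apply: leq_maxr.
have e : x - x' = u' - u by apply/eqP; rewrite subr_eq addrAC -subr_eq opprK -yE yE' addrC.
have [||x1 [y1 [rx1 px1 sy1 e1]]] := nK (x - x').
- by rewrite e; apply: (subspB (ipow_ideal m n)); apply: pn.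
- by exists x, (- x'); split => //; apply: (subspN ids).
have e2 : x - x1 = x' + y1.
  apply/eqP; rewrite -subr_eq0; apply/eqP; transitivity ((x - x') - (x1 + y1)); first by ring.
  by rewrite e1 subrr.
have : x - x1 = 0 by apply: rs0; [apply: (subspB idr) | rewrite e2; apply: sD].
by move/eqP; rewrite subr_eq0 yE => /eqP ->; apply: pD => //; apply: pc.
Qed.

End Local.

(** * The ideals m^(ceil (s q)) + m^[q] *)

Section SIdeals.
Variables (A : comNzRingType) (m : set A) (p : nat) (nn : nat -> nat).
Hypothesis idm : is_ideal m.
Hypothesis pA : p \in [pchar A].

(* m^(ceil (s p^e)) + m^[p^e], with nn e in place of ceil (s p^e). *)
Definition s_id e : set A := addsp (ipow m (nn e)) (pmul m (p ^ e) setT).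

Lemma s_id_ideal e : is_ideal (s_id e).
Proof. by apply: addsp_subsp; [apply: ipow_ideal | apply: pmul_ideal]. Qed.

Lemma s_id_pow e x : m x -> s_id e (x ^+ (p ^ e)).
Proof.
move=> mx; apply: addspr; first by have [] := ipow_ideal m (nn e).
by rewrite -[_ ^+ _]mulr1; apply: pmul_mul.
Qed.

Lemma ipow_s_id e : ipow m (nn e) `<=` s_id e.
Proof. by apply: addspl; apply: pmul_zero. Qed.

Lemma ipow_exp I n j (a : A) : ipow I n a -> ipow I (j * n) (a ^+ j).
Proof.
by move=> Ia; elim: j => [//|j IH]; rewrite exprS mulSn; apply: ipowM.
Qed.

Lemma s_id_frob : (forall e, (nn e.+1 <= p * nn e)%N) ->
  forall e u, s_id e u -> s_id e.+1 (u ^+ p).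
Proof.
move=> nnS e u [a [b [pa pb ->]]].
have := frobD 1 a b pA; rewrite expn1 => ->.
exists (a ^+ p), (b ^+ p); split => //.
  by apply: ipow_le (nnS e) _ _; apply: ipow_exp.
elim: pb => [|v c b' mv _ _ IH].
  by rewrite expr0n gtn_eqF ?(prime_gt0 (pcharf_prime pA))//; apply: pmul_zero.
have := frobD 1 (v ^+ (p ^ e) * c) b' pA; rewrite expn1 => ->.
by rewrite exprMn -exprM -expnSr; apply: pmul_add.
Qed.

Lemma ipow_pmul_frob (s : seq A) n q : (0 < q)%N -> (forall y, y \in s -> m y) -> m `<=` lideal s ->
  ipow m (q * (n + size s)) `<=` pmul (ipow m n) q setT.
Proof.
move=> q0 sm ms a /(ipowS ms)/(lideal_pow_frob q0) h.
elim: h => [|u c b su _ _ IH]; first exact: pmul_zero.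
by apply: pmul_add => //; apply: ipowS su; apply: inspan_sub.
Qed.

(** Of the exponent p^j ([size s] + 1), the part p^j [size s] pays for passing from ordinary to
    Frobenius powers, and p^j for the rounding in [nn]. *)
Lemma s_id_shift (s : seq A) x j : (forall y, y \in s -> m y) -> m `<=` lideal s ->
  (forall e, (p ^ j * nn e <= nn (e + j) + p ^ j)%N) -> m x ->
  forall e a, s_id (e + j) a -> pmul (s_id e) (p ^ j) setT (x ^+ (p ^ j * (size s).+1) * a).
Proof.
move=> sm ms nnj mx e a [u [v [pu pv ->]]].
have p0 := prime_gt0 (pcharf_prime pA).
have pj0 : (0 < p ^ j)%N by rewrite expn_gt0 p0.
have idF : is_ideal (pmul (s_id e) (p ^ j) setT) by apply: pmul_ideal.
have [F0 FD FM] := idF.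
rewrite mulrDr; apply: (FD); last first.
  apply: (FM); elim: pv => [//|u' c b mu' _ _ IH]; apply: (FD) => //.
  by rewrite expnD exprM; apply: pmul_mul => //; apply: s_id_pow.
have : ipow m (p ^ j * (nn e + size s)) (x ^+ (p ^ j * (size s).+1) * u).
  have h : ipow m (p ^ j * (size s).+1 + nn (e + j)) (x ^+ (p ^ j * (size s).+1) * u).
    by apply: ipowM => //; apply: ipowX.
  apply: ipow_le h; have := nnj e; nia.
move/(ipow_pmul_frob pj0 sm ms); elim=> [//|u' c b su _ _ IH].
by apply: pmul_add => //; apply: ipow_s_id.
Qed.

Lemma s_id_frob_pow (s : seq A) j e : (forall y, y \in s -> m y) -> m `<=` lideal s ->
  exists N, ipow m N `<=` pmul (s_id e) (p ^ j) setT.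
Proof.
move=> sm ms; exists (p ^ j * (nn e + size s))%N => a.
have pj0 : (0 < p ^ j)%N by rewrite expn_gt0 (prime_gt0 (pcharf_prime pA)).
move/(ipow_pmul_frob pj0 sm ms); elim=> [|u' c b su _ _ IH]; first exact: pmul_zero.
by apply: pmul_add => //; apply: ipow_s_id.
Qed.

End SIdeals.

(** * Completion *)

Section Completion.
Variables (R : comNzRingType) (m : idealr R).

Let mset : set R := [set x | x \in m].

Lemma idealr_is_ideal : is_ideal mset.
Proof.
split; rewrite /mset /=; first exact: idealr0.
  by move=> x y xm ym; apply: rpredD.
by move=> c x xm; apply: ring_quotient.idealMr.
Qed.

Let pw n : is_ideal (ipow mset n). Proof. exact: ipow_ideal. Qed.

(** The completion is the ring of such sequences modulo those with n-th term in m^n, which avoids an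
    inverse limit of quotient rings. *)
Definition coherent : {pred nat -> R} := fun a => `[< forall n, ipow mset n (a n.+1 - a n) >].

Lemma coherent_subring : subring_closed coherent.
Proof.
split.
- by apply/asboolP => n; rewrite subrr; have [] := pw n.
- move=> a b /asboolP ac /asboolP bc; apply/asboolP => n.
  have -> : (a - b) n.+1 - (a - b) n = (a n.+1 - a n) - (b n.+1 - b n).
    by rewrite -[(a - b) n.+1]/(a n.+1 - b n.+1) -[(a - b) n]/(a n - b n); ring.
  exact: (subspB (pw n)).
- move=> a b /asboolP ac /asboolP bc; apply/asboolP => n.
  have -> : (a * b) n.+1 - (a * b) n = (a n.+1 - a n) * b n.+1 + a n * (b n.+1 - b n).
    by rewrite -[(a * b) n.+1]/(a n.+1 * b n.+1) -[(a * b) n]/(a n * b n); ring.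
  by have [_ D _] := pw n; apply: D; [apply: (is_idealMr _ (pw n)) | apply: (is_idealMl _ (pw n))].
Qed.

HB.instance Definition _ :=
  GRing.isSubringClosed.Build (nat -> R) coherent coherent_subring.

Definition coh : Type := {a : nat -> R | coherent a}.
HB.instance Definition _ := [isSub of coh for @sval _ _].
HB.instance Definition _ := [Choice of coh by <:].
HB.instance Definition _ := [SubChoice_isSubComNzRing of coh by <:].

Lemma cohP (u : coh) n : ipow mset n (val u n.+1 - val u n).
Proof. by have /asboolP := valP u. Qed.

Lemma coh_le (u : coh) n l : (n <= l)%N -> ipow mset n (val u l - val u n).
Proof.
have [p0 pD _] := pw n.
move=> /subnK <-; elim: (l - n)%N => [|d IH]; first by rewrite subrr.
have -> : val u (d.+1 + n)%N - val u n = (val u (d + n).+1 - val u (d + n)%N) + (val u (d + n)%N - val u n).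
  by rewrite addSn; ring.
by apply: pD => //; apply: ipow_le (cohP u _); apply: leq_addl.
Qed.

Definition null : {pred coh} := fun u => `[< forall n, ipow mset n (val u n) >].

Lemma null_closed : idealr_closed null.
Proof.
split.
- by apply/asboolP => n; have [] := pw n.
- apply/negP => /asboolP /(_ 1%N) /(ipow1 idealr_is_ideal).
  by rewrite /mset /= [_ \in m]idealr1.
- move=> a u v /asboolP un /asboolP vn; apply/asboolP => n; have [_ D _] := pw n.
  by apply: D => //; apply: (is_idealMl _ (pw n)).
Qed.

HB.instance Definition _ := isIdealr.Build coh null null_closed.

Definition completion : comNzRingType := {ideal_quot null}.
Definition proj : coh -> completion := \pi_({ideal_quot null})%qT.

Lemma projB u v : proj (u - v) = proj u - proj v. Proof. exact: (rmorphB \pi_({ideal_quot null})%qT). Qed.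
Lemma projD u v : proj (u + v) = proj u + proj v. Proof. exact: (rmorphD \pi_({ideal_quot null})%qT). Qed.
Lemma projM u v : proj (u * v) = proj u * proj v. Proof. exact: (rmorphM \pi_({ideal_quot null})%qT). Qed.
Lemma proj1 : proj 1 = 1. Proof. exact: (rmorph1 \pi_({ideal_quot null})%qT). Qed.
Lemma proj0 : proj 0 = 0. Proof. exact: (rmorph0 \pi_({ideal_quot null})%qT). Qed.

Lemma proj_surj (a : completion) : exists u, a = proj u.
Proof. by exists (repr a); rewrite /proj reprK. Qed.

Lemma proj_eq u v : proj u = proj v <-> forall n, ipow mset n (val u n - val v n).
Proof.
split=> [/eqP|h].
  by rewrite -[X in is_true X](Quotient.idealrBE) => /asboolP.
by apply/eqP; rewrite -[X in is_true X](Quotient.idealrBE); apply/asboolP.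
Qed.

Definition cfilt n : set completion := [set a | exists u, a = proj u /\ ipow mset n (val u n)].

Lemma cfiltP n u : cfilt n (proj u) <-> ipow mset n (val u n).
Proof.
split=> [[v [/proj_eq/(_ n) uv vn]]|un]; last by exists u.
by rewrite -[val u n](subrK (val v n)); have [_ D _] := pw n; apply: D.
Qed.

Lemma completion_filtration : complete_filtration cfilt.
Proof.
split.
- move=> n; have [p0 pD _] := pw n; split.
  + by rewrite -proj0; apply/cfiltP.
  + move=> _ _ [u [-> un]] [v [-> vn]]; rewrite -projD; apply/cfiltP; exact: pD.
  + move=> c _ [v [-> vn]]; have [u ->] := proj_surj c; rewrite /= -projM.
    by apply/cfiltP; apply: (is_idealMl _ (pw n)).
- by move=> a; have [u ->] := proj_surj a; apply/cfiltP.
- move=> n _ [u [-> un]]; apply/cfiltP.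
  have [_ pD _] := pw n.
  rewrite -[val u n](subrK (val u n.+1)); apply: pD; last exact: ipow_le un.
  by rewrite -opprB; apply: (subspN (pw n)); apply: cohP.
- move=> n l _ _ [u [-> un]] [v [-> vn]]; rewrite -projM; apply/cfiltP.
  have lift (w : coh) i j : ipow mset i (val w i) -> ipow mset i (val w (i + j)%N).
    move=> wi; rewrite -[val w _](subrK (val w i)); have [_ pD _] := pw i; apply: pD => //.
    by apply: coh_le; apply: leq_addr.
  by apply: ipowM; [apply: lift | rewrite addnC; apply: lift].
- move=> a; have [u ->] := proj_surj a => aF; rewrite -proj0; apply/proj_eq => n.
  by rewrite -[val 0 n]/(0 : R) subr0; apply/cfiltP.
- move=> c cF.
  have [u uE] := choice cF.
  pose S : nat -> R := fun n => \sum_(i < n) val (u i) n.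
  have Sc : coherent S.
    apply/asboolP => n; have [p0 pD _] := pw n; rewrite /S big_ord_recr/=.
    have -> : \sum_(i < n) val (u i) n.+1 + val (u n) n.+1 - \sum_(i < n) val (u i) n =
      \sum_(i < n) (val (u i) n.+1 - val (u i) n) + ((val (u n) n.+1 - val (u n) n) + val (u n) n).
      by rewrite sumrB; ring.
    apply: (pD); first by apply: (subsp_sum _ (pw n)) => i _; apply: cohP.
    by apply: pD; [apply: cohP | have [] := uE n].
  pose Su : coh := exist _ S Sc; exists (proj Su) => n.
  have -> : \sum_(i < n) c i = proj (\sum_(i < n) u i).
    elim: n => [|n IH]; first by rewrite !big_ord0 proj0.
    by rewrite !big_ord_recr/= IH projD; have [-> _] := uE n.
  rewrite -projB; apply/cfiltP.
  have sumE l : val (\sum_(i < l) u i) n = \sum_(i < l) val (u i) n.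
    elim: l => [|l IH]; first by rewrite !big_ord0.
    by rewrite !big_ord_recr/= -IH.
  have -> : val (Su - \sum_(i < n) u i) n = S n - val (\sum_(i < n) u i) n by [].
  by rewrite sumE subrr; have [] := pw n.
Qed.

Lemma const_coherent x : coherent (fun=> x).
Proof. by apply/asboolP => n; rewrite subrr; have [] := pw n. Qed.

Definition const_coh x : coh := exist _ (fun=> x) (const_coherent x).

Theorem completion_exists : exists (A : comNzRingType) (F : nat -> set A) (io : {rmorphism R -> A}),
  [/\ complete_filtration F, forall n x, F n (io x) <-> ipow mset n x &
      forall n a, exists x, F n (a - io x)].
Proof.
pose iof x : completion := proj (const_coh x).
have ioB : zmod_morphism iof.
  by move=> x y; rewrite /iof -projB; apply/proj_eq => n; rewrite /= subrr; have [] := pw n.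
have ioM : monoid_morphism iof.
  split; first by rewrite /iof -proj1; apply/proj_eq => n; rewrite /= subrr; have [] := pw n.
  by move=> x y; rewrite /iof -projM; apply/proj_eq => n; rewrite /= subrr; have [] := pw n.
pose io : {rmorphism R -> completion} := HB.pack iof
  (GRing.isZmodMorphism.Build R completion iof ioB) (GRing.isMonoidMorphism.Build R completion iof ioM).
exists completion, cfilt, io; split; first exact: completion_filtration.
  by move=> n x; split => [/cfiltP|h] //; apply/cfiltP.
move=> n a; have [u ->] := proj_surj a; exists (val u n).
rewrite /io /= /iof -projB; apply/cfiltP.
rewrite -[val (u - _) n]/(val u n - val u n) subrr; by have [] := pw n.
Qed.

End Completion.

(** * Lengths in a local ring *)

Definition ideal_chain (R : comNzRingType) (J : set R) n (N : nat -> set R) : Prop :=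
  [/\ forall i, (i <= n)%N -> is_ideal (N i), J `<=` N 0%N &
      forall i, (i < n)%N -> N i `<=` N i.+1 /\ ~ N i.+1 `<=` N i].

Definition chain_length (R : comNzRingType) (J : set R) l : Prop :=
  (exists N, ideal_chain J l N) /\ forall n N, ideal_chain J n N -> (n <= l)%N.

Section LocalRing.
Variables (R : comNzRingType) (m : idealr R) (k : fieldType) (r : {rmorphism R -> k}) (p : nat).
Let ms : set R := [set x | x \in m].
Hypothesis noethR : noeth R.
Hypothesis unitR : forall x, ~ ms x -> exists y, x * y = 1.
Hypothesis r_surj : forall c, exists x, r x = c.
Hypothesis r_ker : forall x, ms x <-> r x = 0.
Hypothesis pR : p \in [pchar R].

Let idm : is_ideal ms. Proof. exact: idealr_is_ideal. Qed.
Let m1 : ~ ms 1. Proof. by rewrite /ms /= [_ \in m]idealr1. Qed.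

Section Completed.
Variables (A : comNzRingType) (F : nat -> set A) (io : {rmorphism R -> A}).
Hypothesis cF : complete_filtration F.
Hypothesis F_io : forall n x, F n (io x) <-> ipow ms n x.
Hypothesis dense : forall n a, exists x, F n (a - io x).

Let Fsub n x y a : F n (a - io x) -> F n (a - io y) -> ipow ms n (x - y).
Proof.
by move=> ax ay; apply/F_io; rewrite rmorphB; have := cfB cF ay ax; congr (F _ _); ring.
Qed.

Lemma residue_exists : exists rh : {rmorphism A -> k}, [/\ forall x, rh (io x) = r x,
  forall a, rh a = 0 -> F 1%N a & forall a, F 1%N a -> rh a = 0].
Proof.
have [g gE] := choice (dense 1).
pose rh a := r (g a).
have rhE x a : F 1%N (a - io x) -> rh a = r x.
  move=> ax; apply/eqP; rewrite -subr_eq0 -rmorphB; apply/eqP/r_ker/(ipow1 idm).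
  exact: Fsub (gE a) ax.
have rhB : zmod_morphism rh.
  move=> a b; rewrite /rh -rmorphB; apply: rhE; rewrite rmorphB.
  by have := cfB cF (gE a) (gE b); congr (F _ _); ring.
have rhM : monoid_morphism rh.
  split; first by rewrite -(rmorph1 r); apply: rhE; rewrite rmorph1 subrr; apply: (cf0 cF).
  move=> a b; rewrite /rh -rmorphM; apply: rhE; rewrite rmorphM.
  have := cfD cF (cfMr cF b (gE a)) (cfM cF (io (g a)) (gE b)); congr (F _ _); ring.
pose rh' : {rmorphism A -> k} := HB.pack rh (GRing.isZmodMorphism.Build A k rh rhB)
  (GRing.isMonoidMorphism.Build A k rh rhM).
exists rh'; split.
- by move=> x; apply: rhE; rewrite subrr; apply: (cf0 cF).
- move=> a /r_ker ga; rewrite -[a](subrK (io (g a))); apply: (cfD cF) => //.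
  by apply/F_io/(ipow_sub1 idm).
- move=> a Fa; rewrite -(rmorph0 r); apply: rhE; by rewrite rmorph0 subr0.
Qed.

(** An element of m^(n+N) has coefficients in m^n with respect to g. Approximating a step by step
    gives convergent series of coefficients, so the closure of m^N lies in an ideal of A that is
    actually generated by g. *)
Lemma F_gen (g : seq R) N : ipow ms N `<=` lideal g -> F N `<=` lideal (map io g).
Proof.
move=> Ng a Fa.
have step n x : ipow ms (n + N) x -> exists h : nat -> R, (forall i, ipow ms n (h i)) /\
    x = \sum_(i < size g) g`_i * h i.
  suff sub : ipow ms (n + N) `<=` [set x | exists h : nat -> R, (forall i, ipow ms n (h i)) /\
    x = \sum_(i < size g) g`_i * h i] by move/sub.
  elim: n => [|n IH].
    move=> y /Ng/inspan_coef[h ->]; exists h; split => //.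
    by apply: eq_bigr => i _; rewrite mulrC.
  rewrite addSn => y; apply: pmul_subl.
  - exists (fun=> 0); split; first by move=> i; have [] := ipow_ideal ms n.+1.
    by rewrite big1// => i _; rewrite mulr0.
  - move=> _ _ [h [hn ->]] [h' [h'n ->]]; exists (fun i => h i + h' i); split.
      by move=> i; have [_ D _] := ipow_ideal ms n.+1; apply: D.
    by rewrite -big_split; apply: eq_bigr => i _; rewrite mulrDr.
  - move=> u z mu /IH[h [hn ->]]; exists (fun i => u * h i); split.
      by move=> i; apply: ipow_mul.
    by rewrite expr1 mulr_sumr; apply: eq_bigr => i _; rewrite mulrCA.
have st (nb : nat * A) : exists h : nat -> R, F (nb.1 + N)%N nb.2 ->
    (forall i, ipow ms nb.1 (h i)) /\
    F (nb.1 + N).+1 (nb.2 - \sum_(i < size g) io g`_i * io (h i)).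
  case: nb => n b /=; case: (pselect (F (n + N)%N b)) => [Fb|]; last by exists (fun=> 0).
  have [x bx] := dense (n + N).+1 b.
  have [|h [hn xE]] := step n x.
    apply/F_io; have := cfB cF Fb (cf_succ cF bx); congr (F _ _); ring.
  exists h => _; split => //.
  by move: bx; rewrite xE rmorph_sum (eq_bigr _ (fun i _ => rmorphM io _ _)).
have [H HP] := choice st.
pose b := fix b n := if n is n'.+1 then b n' - \sum_(i < size g) io g`_i * io (H (n', b n') i) else a.
have bF n : F (n + N)%N (b n).
  by elim: n => [//|n IH]; have [_] := HP (n, b n) IH.
have hF i n : F n (io (H (n, b n) i)).
  by have [h _] := HP (n, b n) (bF n); apply/F_io.
have [S SE] := choice (fun i => cf_sum cF (hF i)).
have -> : a = \sum_(i < size (map io g)) S i * (map io g)`_i.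
  apply: (cf_eq cF) => n.
  have aE : a = b n + \sum_(j < n) \sum_(i < size g) io g`_i * io (H (nat_of_ord j, b j) i).
    elim: n => [|n IH]; first by rewrite big_ord0 addr0.
    by rewrite big_ord_recr/= {1}IH; ring.
  rewrite {1}aE exchange_big size_map -addrA -sumrB.
  apply: (cfD cF); first by apply: cf_le (bF n) => //; apply: leq_addr.
  apply: (cf_sumr cF) => i _; rewrite (nth_map 0)// -mulr_sumr mulrC -mulrBl; apply: (cfMr cF).
  by rewrite -opprB; apply: (cfN cF); apply: SE.
exact: (inspan_sum idfun (map io g) S).
Qed.

(* The closure of the ideal generated by J in the completion. *)
Definition hat (J : set R) : set A := [set a | forall n, exists x, J x /\ F n (a - io x)].

Lemma hat_ideal J : is_ideal J -> is_ideal (hat J).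
Proof.
move=> [J0 JD JM]; split.
- by move=> n; exists 0; rewrite rmorph0 subrr; split => //; apply: (cf0 cF).
- move=> a b aJ bJ n; have [x [Jx ax]] := aJ n; have [y [Jy bY]] := bJ n.
  exists (x + y); split; first exact: JD.
  by rewrite rmorphD; have := cfD cF ax bY; congr (F _ _); ring.
- move=> c a aJ n; have [x [Jx ax]] := aJ n; have [z cz] := dense n c.
  exists (z * x); split; first exact: JM.
  by rewrite rmorphM; have := cfD cF (cfM cF c ax) (cfMr cF (io x) cz); congr (F _ _) => /=; ring.
Qed.

Lemma io_hat J x : J x -> hat J (io x).
Proof. by move=> Jx n; exists x; rewrite subrr; split => //; apply: (cf0 cF). Qed.

Lemma hat_mono J K : J `<=` K -> hat J `<=` hat K.
Proof. by move=> JK a aJ n; have [x [/JK Kx ax]] := aJ n; exists x. Qed.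

Lemma hatP J N a : is_ideal J -> ipow ms N `<=` J ->
  (hat J a <-> exists x, J x /\ F N (a - io x)).
Proof.
move=> idJ NJ; split=> [/(_ N)//|[x [Jx ax]] n].
have [y ay] := dense (maxn n N) a.
have ayN := cf_le cF (leq_maxr n N) ay; have ayn := cf_le cF (leq_maxl n N) ay.
exists y; split => //; have [_ JD _] := idJ.
rewrite -[y](subrK x) addrC; apply: JD => //; apply: NJ; exact: Fsub ayN ax.
Qed.

Lemma hat_io J N x : is_ideal J -> ipow ms N `<=` J -> hat J (io x) -> J x.
Proof.
move=> idJ NJ /(hatP _ idJ NJ)[y [Jy]]; rewrite -rmorphB => /F_io/NJ Jxy.
by rewrite -[x](subrK y); have [_ JD _] := idJ; apply: JD.
Qed.

Lemma hat_add J K N : is_ideal J -> is_ideal K -> ipow ms N `<=` K ->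
  hat (addsp J K) = addsp (hat J) (hat K).
Proof.
move=> idJ idK NK; have [J0 JD JM] := idJ; have [K0 KD KM] := idK.
have idJK : is_ideal (addsp J K) by apply: addsp_subsp.
have NJK : ipow ms N `<=` addsp J K by move=> x /NK; apply: addspr.
apply/seteqP; split=> a.
  move=> /(hatP _ idJK NJK)[_ [[x [y [Jx Ky ->]]] axy]].
  exists (io x), (a - io x); split; [exact: io_hat | | by rewrite addrC subrK].
  by apply/(hatP _ idK NK); exists y; split => //; move: axy; rewrite rmorphD; congr (F _ _); ring.
move=> [b [c [bJ /(hatP _ idK NK)[y [Ky cy]] ->]]].
apply/(hatP _ idJK NJK); have [x [Jx bx]] := bJ N.
exists (x + y); split; first by exists x, y.
by rewrite rmorphD; have := cfD cF bx cy; congr (F _ _); ring.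
Qed.

(** Finitely many q-th powers of elements of J generate J^[q]; by [F_gen] they also generate its
    closure. *)
Lemma hat_pmul J q N : is_ideal J -> ipow ms N `<=` pmul J q setT ->
  hat (pmul J q setT) `<=` pmul (hat J) q setT.
Proof.
move=> idJ NK a; set K := pmul J q setT in NK *.
have idK : is_ideal K by apply: pmul_ideal.
have [g [gG Kg]] : exists s : seq R, (forall y, y \in s -> exists2 u, J u & y = u ^+ q) /\ K `<=` lideal s.
  apply: (noeth_gen noethR (G := [set y | exists2 u, J u & y = u ^+ q])) => //.
    by move=> _ [u Ju ->]; rewrite -[_ ^+ _]mulr1; apply: pmul_mul.
  move=> J' idJ' GJ' x; have [J'0 J'D J'M] := idJ'; apply: pmul_subl => // u c Ju _.
  by apply: (is_idealMr _ idJ'); apply: GJ'; exists u.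
move/(hatP _ idK NK) => [x [/Kg gx ax]].
have Fg := F_gen (subset_trans NK Kg).
have : lideal (map io g) a.
  rewrite -[a](subrK (io x)); apply: inspanD; first exact: Fg.
  have : inspan io (map io g) (io x) by apply: (inspan_rmorph (io := idfun)) gx.
  apply: inspan_sub; first exact/ideal_subsp/lideal_ideal.
  by move=> y; apply: inspan_mem.
apply: inspan_sub; first exact: pmul_ideal.
move=> _ /mapP[y /gG[u Ju ->] ->]; rewrite rmorphXn -[_ ^+ _]mulr1; apply: pmul_mul => //.
exact: io_hat.
Qed.

(** Closures could acquire a common element; the Artin-Rees estimate of [closure_inter] excludes
    it. *)
Lemma hat_inter I J : is_ideal I -> is_ideal J -> (forall x, I x -> J x -> x = 0) ->
  forall a, hat I a -> hat J a -> a = 0.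
Proof.
move=> idI idJ IJ a aI aJ; apply: (cf_separated cF) => c.
have [n nP] := closure_inter noethR idm c idI idJ IJ.
have [x [Ix ax]] := aI (maxn n c); have [y [Jy ay]] := aJ (maxn n c).
have [z az] := dense (maxn n c) a.
have zc : ipow ms c z.
  apply: nP.
    exists x, (z - x); split => //; last by ring.
    by apply: ipow_le (leq_maxl n c) _ _; apply: Fsub az ax.
  exists y, (z - y); split => //; last by ring.
  by apply: ipow_le (leq_maxl n c) _ _; apply: Fsub az ay.
rewrite -[a](subrK (io z)); apply: (cfD cF); last exact/F_io.
exact: cf_le (leq_maxr n c) az.
Qed.

Section Length.
Variables (rh : {rmorphism A -> k}) (sg : {rmorphism k -> A}).
Hypothesis rh_io : forall x, rh (io x) = r x.
Hypothesis rh_ker : forall a, rh a = 0 -> F 1%N a.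
Hypothesis rh_sg : forall c, rh (sg c) = c.

Let sg_io y : F 1%N (sg (r y) - io y).
Proof. by apply: rh_ker; rewrite rmorphB rh_sg rh_io subrr. Qed.

Lemma approx_span c : exists w : seq R, forall a, addsp (F c) (inspan sg (map io w)) a.
Proof.
elim: c => [|c [w wP]].
  by exists [::] => a; exists a, 0; rewrite addr0; split => //; apply: (cf_top cF).
have [g [gc cg]] := noeth_fg noethR (ipow_ideal ms c).
exists (w ++ g) => a; have [b [v [Fb wv ->]]] := wP a.
have [x bx] := dense c.+1 b.
have /cg/inspan_coef[h xE] : ipow ms c x.
  apply/F_io; have := cfB cF Fb (cf_succ cF bx); congr (F _ _); ring.
(* Replacing h_i by the coefficient-field representative of its residue changes x by an element of
   F_1 F_c. *)
pose y := \sum_(i < size g) sg (r (h i)) * io g`_i.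
exists (b - y), (v + y); split; last by ring.
  have -> : b - y = (b - io x) + (io x - y) by ring.
  apply: (cfD cF) => //; rewrite xE rmorph_sum -sumrB; apply: (cf_sumr cF) => i _.
  rewrite rmorphM -mulrBl -add1n; apply: (cf_mul cF).
    by rewrite -opprB; apply: (cfN cF); apply: sg_io.
  by apply/F_io/gc/mem_nth.
rewrite map_cat; apply/inspan_cat; exists v; split => //; rewrite addrC addKr.
apply: (subsp_sum _ (inspan_subsp sg _)) => i _; apply/inspanZ/inspan_mem.
by apply/mapP; exists g`_i => //; apply: mem_nth.
Qed.

Lemma hat_F J N : is_ideal J -> ipow ms N `<=` J -> F N `<=` hat J.
Proof.
move=> idJ NJ a Fa; apply/(hatP _ idJ NJ); exists 0.
by rewrite rmorph0 subr0; split => //; have [] := idJ.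
Qed.

Let sh J : is_ideal J -> subsp sg (hat J).
Proof. by move=> idJ; apply/ideal_subsp/hat_ideal. Qed.

Lemma hat_fin J N : is_ideal J -> ipow ms N `<=` J -> fin_over sg (hat J) setT.
Proof.
move=> idJ NJ; have [w wP] := approx_span N; exists (map io w) => a _.
have [b [v [Fb wv ->]]] := wP a; exists b, v; split => //; exact: hat_F Fb.
Qed.

Definition len J := dq sg (hat J) setT.

(** Elements chosen in the successive differences of the chain are k-independent modulo [hat J]:
    ideals containing m^N are recovered from their closures. *)
Lemma chain_le J N n C : is_ideal J -> ipow ms N `<=` J -> ideal_chain J n C -> (n <= len J)%N.
Proof.
move=> idJ NJ [Cid JC Cs].
have ex i : exists v, (i < n)%N -> C i.+1 v /\ ~ C i v.
  case: (ltnP i n) => [il|]; last by exists 0.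
  have [_ h] := Cs i il; apply: contrapT => nv; apply: h => v Cv.
  by apply: contrapT => nCv; apply: nv; exists v.
have [v vP] := choice ex.
have JCi i : (i <= n)%N -> J `<=` C i.
  elim: i => [//|i IH] il x Jx; have [sub _] := Cs i il; apply/sub/IH => //; exact: ltnW.
have vC i j : (j < i)%N -> (i <= n)%N -> C i (v j).
  move=> + il; have jn (l : nat) : (l <= n)%N -> (j < l)%N -> C l (v j); last exact: jn.
  elim: l => [//|l IH] ln; rewrite ltnS leq_eqVlt => /orP[/eqP ->|jl].
    by have [] := vP l ln.
  by have [sub _] := Cs l ln; apply/sub/IH => //; apply: ltnW.
have indep_v i : (i <= n)%N -> indep sg (hat J) (rev (mkseq (fun j => io (v j)) i)).
  elim: i => [//|i IH] il; rewrite /mkseq -{1}addn1 iotaD map_cat rev_cat /= add0n.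
  split; last by apply: IH; apply: ltnW.
  move=> [a [b [aJ bs abE]]].
  have [_ []] := vP i il; have idC := Cid i (ltnW il).
  have NC : ipow ms N `<=` C i by move=> x /NJ; apply: JCi; apply: ltnW.
  apply: (hat_io idC NC); rewrite abE; have [_ hD _] := hat_ideal idC.
  apply: hD; first by apply: hat_mono aJ; apply: JCi; apply: ltnW.
  apply: (inspan_sub _ _ bs); first exact: sh.
  move=> y; rewrite mem_rev => /mapP[j]; rewrite mem_iota => /andP[_ ji] ->.
  by apply: io_hat; apply: vC => //; apply: ltnW.
have [t [st _ ts _]] := dqP (sh idJ) (subspT sg) (fun _ _ => Logic.I) (hat_fin idJ NJ).
have := steinitz (U := hat J) (t' := t) setT (sh idJ) (indep_v n (leqnn _)).
by rewrite size_rev size_mkseq st; apply=> y _; apply: ts.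
Qed.

(** Adding a socle element z of R/J to J lowers the dimension over k by exactly one. *)
Lemma chain_exists J N : is_ideal J -> ipow ms N `<=` J -> exists C, ideal_chain J (len J) C.
Proof.
move=> idJ NJ; move en : (len J) => n; elim: n J idJ NJ en => [|n IH] J idJ NJ en.
  by exists (fun=> J); split.
have J1 : ~ J 1.
  move=> J1; have hT : hat J = setT.
    apply/seteqP; split => // a _; apply/(hatP _ idJ NJ); have [x ax] := dense N a.
    by exists x; split => //; rewrite -[x]mulr1; apply: is_idealMl.
  by move: en; rewrite /len hT dq_eq0.
have [z [Jz mz]] : exists z, ~ J z /\ forall y, ms y -> J (y * z).
  (* For the least power m^(M+1) inside J, any z in m^M outside J will do. *)
  have exN : exists N, `[< ipow ms N `<=` J >] by exists N; apply/asboolP.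
  case: (ex_minnP exN) => -[|M] /asboolP MJ Mmin; first by case: J1; apply: MJ.
  apply: contrapT => h; suff MJ' : ipow ms M `<=` J.
    by have := Mmin M (introT (asboolP _) MJ'); rewrite ltnn.
  move=> x Mx; apply: contrapT => Jx; apply: h; exists x; split => // y my.
  by apply/MJ/ipow_mul.
pose K := addsp J (lideal [:: z]).
have idK : is_ideal K by apply: add_principal.
have JK : J `<=` K by apply: addspl; apply: inspan0.
have NK : ipow ms N `<=` K by move=> x /NJ/JK.
have Kz : K z by apply: addspr; [have [] := idJ | apply/inspan_mem/mem_head].
have d1 : dq sg (hat J) (hat K) = 1%N.
  apply: (dq_uniq (sh idJ)); exists [:: io z]; split => //.
  - by move=> y; rewrite inE => /eqP->; apply: io_hat.
  - move=> a /(hatP _ idK NK)[_ [[x [_ [Jx /lideal1E[y ->] ->]]] ax]].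
    exists (a - sg (r y) * io z), (sg (r y) * io z); rewrite subrK; split => //; last first.
      by exists (r y); rewrite subrr.
    have [w yw] := dense N (sg (r y)).
    have mwy : ms (w - y).
      have := sg_io y; have N0 : (0 < N)%N.
        by case: N NJ {NK ax yw IH} => // N0; case: J1; apply: N0.
      move=> h; have := cfB cF h (cf_le cF N0 yw).
      have -> : sg (r y) - io y - (sg (r y) - io w) = io (w - y) by rewrite rmorphB; ring.
      by move/F_io/(ipow1 idm).
    apply/(hatP _ idJ NJ); exists (x - (w - y) * z); split.
      by apply: (subspB idJ) => //; apply: mz.
    have := cfB cF ax (cfMr cF (io z) yw).
    by rewrite !rmorphB rmorphD !rmorphM rmorphB; congr (F _ _); ring.
  - split => //; move=> [a [_ [aJ -> ]]]; rewrite addr0 => zE.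
    by apply/Jz/(hat_io idJ NJ); rewrite zE.
have en' : len K = n.
  have := dq_add (sh idJ) (sh idK) (subspT sg) (hat_mono JK) (fun _ _ => Logic.I) (hat_fin idJ NJ).
  by rewrite -/(len J) en d1 -/(len K); lia.
have [C [Cid KC Cs]] := IH K idK NK en'.
exists (fun i => if i is i'.+1 then C i' else J); split => //.
- by case=> [|i] il //; apply: Cid.
- case=> [|i] il; last exact: Cs.
  by split => [x /JK/KC//|]; move=> /(_ z (KC _ Kz)).
Qed.

Lemma len_chain J N : is_ideal J -> ipow ms N `<=` J -> chain_length J (len J).
Proof.
move=> idJ NJ; split; first exact: chain_exists idJ NJ.
by move=> n C; apply: chain_le idJ NJ.
Qed.

End Length.

End Completed.

Variables (nn : nat -> nat) (d : nat).
Hypothesis nnS : forall e, (nn e.+1 <= p * nn e)%N.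
Hypothesis nnj : forall j e, (p ^ j * nn e <= nn (e + j) + p ^ j)%N.
Hypothesis dimR : forall n P, @prime_chain R n P -> (n <= d)%N.

Let sid := s_id ms p nn.

(** Here d is any bound on the lengths of prime chains. The completion is used inside the proof
    only: [len] is characterized by chains of ideals of R. *)
Theorem local_asymptotics : exists len : set R -> nat,
  [/\ forall J N, is_ideal J -> ipow ms N `<=` J -> chain_length J (len J),
      exists K, forall e, (len (sid e) <= K * (p ^ e) ^ d)%N,
      (0 < d)%N -> exists j0 (G : nat -> nat),
        [/\ negligible p d (fun e => G e - len (sid (e + j0)))%N,
           negligible p d (fun e => len (sid (e + j0)) - G e)%N &
           negligible p d (fun e => G e.+1 - p ^ d * G e)%N] &
      (0 < d)%N -> forall I J : set R, is_ideal I -> is_ideal J -> (forall x, I x -> J x -> x = 0) ->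
        let f U e := len (addsp U (sid e)) in
        exists j0, negligible p d (fun e => (f [set 0%R] (e + j0) + f (addsp I J) (e + j0)) -
            (f I (e + j0) + f J (e + j0)))%N /\
          negligible p d (fun e => (f I (e + j0) + f J (e + j0)) -
            (f [set 0%R] (e + j0) + f (addsp I J) (e + j0)))%N].
Proof.
have [A [F [io [cF F_io dense]]]] := completion_exists m.
have [rh [rh_io rh_ker F_rh]] := residue_exists cF F_io dense.
have pk : p \in [pchar k] by exact: (rmorph_pchar r).
have pA : p \in [pchar A] by exact: (rmorph_pchar io).
have [|sg rh_sg] := coefficient_field cF _ rh_ker F_rh pk pA.
  by move=> c; have [x <-] := r_surj c; exists (io x).
have id0 : is_ideal [set 0 : R] by split => // [x y -> ->|c x ->]; rewrite ?addr0 ?mulr0.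
have [xs [sxs xsm [c0 c0P]]] := system_of_parameters noethR idm m1 unitR id0
  (fun n P ch _ => dimR ch).
have {}c0P : ipow ms c0 `<=` lideal xs by move=> a /c0P; rewrite addsp0l.
have [w wP] := approx_span cF F_io dense rh_io rh_ker rh_sg c0.
have [||B [iob [be [X [regX bi bX gen]]]]] := @tower A F cF k sg (map io xs) (map io w) [::].
- by move=> _ /mapP[x xxs ->]; apply/F_io/(ipow_sub1 idm)/xsm.
- move=> a; have [b [v [Fb wv ->]]] := wP a.
  exists 0, (b + v); rewrite add0r; split => //; exists b, v; split => //.
  exact: (F_gen cF F_io dense c0P).
have {}gen a : inspan be (map io w) a by have [_ [v [-> wv ->]]] := gen a; rewrite add0r.
have sX : size X = d by rewrite -sxs -(size_map io xs) -bX size_map.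
have XE x : x \in X -> exists2 y, ms y & be x = io y.
  move=> xX; have : be x \in map io xs by rewrite -bX; apply: map_f.
  by move=> /mapP[y /xsm my ->]; exists y.
pose I e := hat F io (sid e).
have idsid e : is_ideal (sid e) by apply: s_id_ideal.
have idI e : is_ideal (I e) by apply: (hat_ideal cF dense).
have IX e x : x \in X -> I e (be x ^+ (p ^ e)).
  move=> /XE[y my ->]; rewrite -rmorphXn; apply: (io_hat _ cF); exact: s_id_pow.
have Ip e u : I e u -> I e.+1 (u ^+ p).
  move=> Iu n; have [x [sx ux]] := Iu n; exists (x ^+ p); split; first exact: s_id_frob.
  rewrite rmorphXn; have := frobB 1 u (io x) pA; rewrite expn1 => <-.
  by rewrite -(prednK (prime_gt0 (pcharf_prime pA))) exprS; apply: (cfMr cF).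
have Nsid e : ipow ms (nn e) `<=` sid e by apply: ipow_s_id.
have [g [gm mg]] := fg_m noethR idm.
(* A parameter is needed to compare I_(e+j) with I_e^[p^j], which is why d must be positive. *)
have Ix : (0 < d)%N -> exists2 x1, x1 \in X & forall j, exists c, forall e a,
    I (e + j)%N a -> pmul (I e) (p ^ j) setT (be x1 ^+ c * a).
  rewrite -sX; case: X XE {regX bX IX sX} => [//|x1 X'] XE _; exists x1; first exact: mem_head.
  have [y my yE] := XE x1 (mem_head _ _).
  move=> j; exists (p ^ j * (size g).+1)%N => e a Ia.
  have [N NK] := s_id_frob_pow nn idm pR j e gm mg.
  have sub := hat_pmul cF F_io dense (idsid e) NK.
  apply: (sub).
  move=> n; have [x [sx ax]] := Ia n; exists (y ^+ (p ^ j * (size g).+1) * x).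
  split; first by apply: (s_id_shift idm pR gm mg _ my sx).
  by rewrite yE -rmorphXn rmorphM -mulrBr; apply: (cfM cF).
have lenE J : len F io sg J = dq sg (hat F io J) setT by [].
exists (len F io sg); split.
- move=> J N idJ NJ.
  exact: (len_chain cF F_io dense rh_io rh_ker rh_sg idJ NJ).
- exists (size (map io w)) => e; rewrite -sX.
  have [t [<- ts]] := asym_bound bi regX gen (idI e) (IX e).
  by apply: dq_le ts => //; apply/ideal_subsp/idI.
- move=> d0; rewrite -sX; apply: (asym_limit bi regX pA gen idI IX Ip (Ix d0)).
- move=> d0 a b ida idb ab0 f.
  have [j0] := asym_add bi regX pA gen idI IX Ip (Ix d0)
    (hat_ideal cF dense ida) (hat_ideal cF dense idb) (hat_inter cF F_io dense ida idb ab0).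
  rewrite sX => h; exists j0.
  have fE U e : is_ideal U -> dq sg (addsp (hat F io U) (I e)) setT = f U e.
    by move=> idU; rewrite /f /len (hat_add cF F_io dense idU (idsid e) (@Nsid e)).
  have f0 e : dq sg (addsp [set 0] (I e)) setT = f [set 0] e.
    by rewrite addsp0l /f /len addsp0l.
  have fab e : dq sg (addsp (addsp (hat F io a) (hat F io b)) (I e)) setT = f (addsp a b) e.
    rewrite -fE; last exact: addsp_subsp.
    congr (dq sg _ _); rewrite /I -(hat_add cF F_io dense _ (idsid e) (@Nsid e)); last exact: addsp_subsp.
    have Nb : ipow ms (nn e) `<=` addsp b (sid e) by move=> x /Nsid; apply: addspr; have [] := idb.
    rewrite -[in RHS]addspA (hat_add cF F_io dense ida _ Nb); last exact: addsp_subsp.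
    by rewrite (hat_add cF F_io dense idb (idsid e) (@Nsid e)) addspA.
  have [h1 h2] := h; split.
    by apply: negligible_le h1 => e; rewrite f0 fab !fE.
  by apply: negligible_le h2 => e; rewrite f0 fab !fE.
Qed.

End LocalRing.

(** * Limits of normalized lengths *)

Section Limits.
Variables (K : realType) (p d : nat).
Hypothesis p1 : (1 < p)%N.
Let q : K := p%:R.
Let q1 : 1 < q. Proof. by rewrite /q ltr1n. Qed.
Let q0 : 0 < q. Proof. by apply: lt_trans q1. Qed.
Let qX n : 0 < q ^+ n. Proof. exact: exprn_gt0. Qed.

Let qVX n : 0 <= q^-1 ^+ n. Proof. by rewrite exprn_ge0 ?invr_ge0 ?ltW. Qed.

Definition dens (r : nat -> nat) (e : nat) : K := (r e)%:R / p%:R ^+ (e * d).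

Lemma dens_ge0 r e : 0 <= dens r e.
Proof. by rewrite /dens divr_ge0// exprn_ge0. Qed.

Lemma qV_cvg : (fun e => q^-1 ^+ e) @ \oo --> (0 : K).
Proof.
apply: cvg_expr; rewrite ger0_norm ?invr_ge0 ?ltW//.
by rewrite invf_lt1.
Qed.

Lemma dens_le r : negligible p d r -> exists c : K, 0 <= c /\ forall e, dens r e <= c * q^-1 ^+ e.
Proof.
move=> [c cP]; exists c%:R; split => // e.
rewrite /dens ler_pdivrMr//; have := cP e.
rewrite -(ler_nat K) !natrM !natrX -!/q -exprM => h.
by rewrite exprVn mulrAC ler_pdivlMr.
Qed.

Lemma negligible_cvg0 r : negligible p d r -> dens r @ \oo --> (0 : K).
Proof.
move=> /dens_le[c [c0 cP]].
apply: (squeeze_cvgr _ (cvg_cst 0)).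
  by near=> e; rewrite dens_ge0; exact: cP.
by rewrite -[X in _ --> X](mulr0 c); exact: (cvgM (cvg_cst c) qV_cvg).
Unshelve. all: by end_near. Qed.

Lemma bound_negligible r d' : (d' < d)%N -> (exists C, forall e, (r e <= C * (p ^ e) ^ d')%N) ->
  negligible p d r.
Proof.
move=> d'd [C CP]; exists C => e.
apply: leq_trans (leq_mul (CP e) (leqnn _)) _.
rewrite -mulnA leq_mul2l -expnSr leq_pexp2l ?orbT// expn_gt0; lia.
Qed.

(** The densities increase by at most c q^(-e) at each step. Adding the tail c' q^(-e) of the
    geometric series, with c' = c/(1 - 1/q), gives a nonincreasing sequence bounded below by 0. *)
Lemma quasi_monotone_cvg (G : nat -> nat) : (0 < d)%N ->
  negligible p d (fun e => G e.+1 - p ^ d * G e)%N -> cvgn (dens G).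
Proof.
move=> d0 /dens_le[c [c0 cP]].
have step e : dens G e.+1 <= dens G e + c * q^-1 ^+ e.
  have := cP e; rewrite /dens -!/q => h.
  have GE : (G e.+1)%:R <= q ^+ d * (G e)%:R + (G e.+1 - p ^ d * G e)%:R :> K.
    rewrite /q -natrX -natrM -natrD ler_nat; lia.
  rewrite mulSn exprD ler_pdivrMr ?mulr_gt0//.
  apply: (le_trans GE); move: h; rewrite ler_pdivrMr// => h.
  have qd : 1 <= q ^+ d by rewrite exprn_ege1// ltW.
  have -> : ((G e)%:R / q ^+ (e * d) + c * q^-1 ^+ e) * (q ^+ d * q ^+ (e * d)) =
    q ^+ d * (G e)%:R + q ^+ d * (c * q^-1 ^+ e * q ^+ (e * d)).
    by field; rewrite !lt0r_neq0.
  rewrite lerD2l; apply: (le_trans h); apply: ler_peMl => //.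
  by apply: mulr_ge0 (ltW (qX _)); apply: mulr_ge0 (qVX e).
pose c' := c / (1 - q^-1).
have qV1 : 0 < 1 - q^-1 by rewrite subr_gt0 invf_lt1.
have c'E : c = c' - c' * q^-1 by rewrite -[X in X - _]mulr1 -mulrBr /c' divfK// lt0r_neq0.
have cv : cvgn (fun e => dens G e + c' * q^-1 ^+ e).
  apply: nonincreasing_is_cvgn.
    apply/nonincreasing_seqP => e; rewrite exprS.
    have := step e; set x := q^-1 ^+ e; rewrite {1}c'E => h.
    by apply: le_trans (lerD h (lexx _)) _; rewrite le_eqVlt; apply/orP; left; apply/eqP; ring.
  exists 0 => _ [e _ <-]; apply: addr_ge0 (dens_ge0 _ _) _; apply: mulr_ge0 (qVX e).
  by rewrite divr_ge0// ltW.
have cv2 : cvgn (fun e => c' * q^-1 ^+ e).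
  by apply/cvg_ex; exists (c' * 0); exact: cvgM (cvg_cst c') qV_cvg.
have -> : dens G = (fun e => (dens G e + c' * q^-1 ^+ e) - c' * q^-1 ^+ e).
  by apply/funext => e; rewrite addrK.
exact: is_cvgB cv cv2.
Qed.

Lemma dens_shift r j : dens (fun e => r (e + j)%N) =
  (fun e => q ^+ (j * d) * dens r (e + j)%N).
Proof.
apply/funext => e; rewrite /dens -/q mulnDl exprD.
by field; rewrite !lt0r_neq0.
Qed.

Lemma dens_is_cvg (l G : nat -> nat) j : (0 < d)%N ->
  negligible p d (fun e => G e - l (e + j)%N)%N ->
  negligible p d (fun e => l (e + j)%N - G e)%N ->
  negligible p d (fun e => G e.+1 - p ^ d * G e)%N -> cvgn (dens l).
Proof.
move=> d0 /negligible_cvg0 h1 /negligible_cvg0 h2 /(quasi_monotone_cvg d0) hG.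
have : cvgn (dens (fun e => l (e + j)%N)).
  have -> : dens (fun e => l (e + j)%N) = (fun e => dens G e +
      dens (fun e => l (e + j)%N - G e)%N e - dens (fun e => G e - l (e + j)%N)%N e).
    apply/funext => e; rewrite /dens -!mulrDl -mulrBl; congr (_ / _).
    by apply/eqP; rewrite eq_sym subr_eq -!natrD eqr_nat; apply/eqP; lia.
  exact: is_cvgB (is_cvgD hG (cvgP _ h2)) (cvgP _ h1).
rewrite dens_shift => h; set c := q ^+ (j * d) in h.
apply: (cvgP (c^-1 * limn (fun e => c * dens l (e + j)%N))); rewrite -(@cvg_shiftn j) /=.
have -> : (fun e => dens l (e + j)%N) = (fun e => c^-1 * (c * dens l (e + j)%N)).
  by apply/funext => e; rewrite mulKf// lt0r_neq0// /c.
exact: (cvgM (cvg_cst c^-1) h).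
Qed.

Lemma dens_add (a b c t : nat -> nat) j :
  negligible p d (fun e => (a (e + j) + t (e + j)) - (b (e + j) + c (e + j)))%N ->
  negligible p d (fun e => (b (e + j) + c (e + j)) - (a (e + j) + t (e + j)))%N ->
  cvgn (dens a) -> cvgn (dens b) -> cvgn (dens c) -> cvgn (dens t) ->
  limn (dens a) + limn (dens t) = limn (dens b) + limn (dens c).
Proof.
move=> /negligible_cvg0 h1 /negligible_cvg0 h2 ca cb cc ct.
apply/eqP; rewrite -subr_eq0; apply/eqP.
have cv : (fun e => dens a e + dens t e - (dens b e + dens c e)) @ \oo -->
   limn (dens a) + limn (dens t) - (limn (dens b) + limn (dens c)).
  by apply: cvgB; apply: cvgD.
have cv0 : (fun e => dens a e + dens t e - (dens b e + dens c e)) @ \oo --> (0 : K).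
  rewrite -(@cvg_shiftn j).
  have := cvgM (cvg_cst (q ^+ (j * d))^-1) (cvgB h1 h2); rewrite subrr mulr0 => h.
  set f := (X in X x @[x --> _] --> _).
  rewrite (_ : f = (fun e => (q ^+ (j * d))^-1 * (dens (fun e => (a (e + j) + t (e + j)) - (b (e + j) + c (e + j)))%N e -
    dens (fun e => (b (e + j) + c (e + j)) - (a (e + j) + t (e + j)))%N e))); first exact: h.
  apply/funext => e; rewrite /f /=.
  set A := (a (e + j) + t (e + j))%N; set B := (b (e + j) + c (e + j))%N.
  have E : (A - B)%:R - (B - A)%:R = A%:R - B%:R :> K.
    by apply/eqP; rewrite subr_eq addrAC eq_sym subr_eq -!natrD eqr_nat; apply/eqP; lia.
  rewrite /dens -!/q -mulrBl E /A /B !natrD mulnDl exprD.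
  by field; rewrite !lt0r_neq0.
exact: (cvg_unique _ cv cv0).
Qed.

End Limits.

(** * Chains of ideals, of primes and of submodules *)

Section Ceil.
Variables (K : realType) (p : nat) (s : K).
Hypothesis s0 : 0 < s.

Let sX e : 0 <= s * p%:R ^+ e. Proof. by apply: mulr_ge0 (ltW s0) _; rewrite exprn_ge0. Qed.

Definition ceil_pow e : nat := `|Num.ceil (s * p%:R ^+ e)|%N.

Lemma ceil_pow_le e n : (ceil_pow e <= n)%N = (s * p%:R ^+ e <= n%:R).
Proof.
have c0 : 0 <= Num.ceil (s * p%:R ^+ e).
  by rewrite ceil_ge0; exact: lt_le_trans (ltrN10 K) (sX e).
by rewrite /ceil_pow -lez_nat gez0_abs// ceil_le_int.
Qed.

Lemma ceil_pow_ge e : s * p%:R ^+ e <= (ceil_pow e)%:R.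
Proof. by rewrite -ceil_pow_le. Qed.

Lemma ceil_powS e : (ceil_pow e.+1 <= p * ceil_pow e)%N.
Proof. by rewrite ceil_pow_le exprS mulrCA natrM ler_wpM2l// ceil_pow_ge. Qed.

Lemma ceil_pow_lt e : (ceil_pow e)%:R < s * p%:R ^+ e + 1.
Proof.
case E : (ceil_pow e) => [|n].
  by apply: ltr_wpDl.
by rewrite -addn1 natrD ltrD2r ltNge -ceil_pow_le E -ltnNge.
Qed.

(** Rounding up adds less than 1, which multiplication by p^j turns into less than p^j. *)
Lemma ceil_pow_shift j e : (p ^ j * ceil_pow e <= ceil_pow (e + j) + p ^ j)%N.
Proof.
rewrite -(ler_nat K) natrD natrM !natrX.
have pj : 0 <= p%:R ^+ j :> K by rewrite exprn_ge0.
apply: le_trans (ler_wpM2l pj (ltW (ceil_pow_lt e))) _.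
rewrite mulrDr mulr1 lerD2r mulrCA -exprD addnC; exact: ceil_pow_ge.
Qed.

End Ceil.

Lemma max_nat_eq (P : set nat) n : P n -> (forall m, P m -> (m <= n)%N) -> max_nat P = n.
Proof.
move=> Pn nP; rewrite /max_nat; case: xgetP => [m _ [Pm mP]|/(_ n)/= h].
  by apply/eqP; rewrite eqn_leq nP// mP.
by case: h.
Qed.

Lemma max_nat_ub (P : set nat) N : (forall m, P m -> (m <= N)%N) -> forall m, P m -> (m <= max_nat P)%N.
Proof.
move=> NP m Pm; have ex : exists m, `[< P m >] by exists m; apply/asboolP.
have [|n /asboolP Pn nP] := ex_maxnP ex (m := N); first by move=> i /asboolP /NP.
by rewrite (@max_nat_eq P n)// => [|i Pi]; apply: nP; apply/asboolP.
Qed.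

(** The default value is 0, so a positive value certifies that a largest element exists. In this way
    dim R > 0 itself bounds the prime chains of R. *)
Lemma max_nat_gt0 (P : set nat) : (0 < max_nat P)%N ->
  P (max_nat P) /\ forall m, P m -> (m <= max_nat P)%N.
Proof. by rewrite /max_nat; case: xgetP => [n _ []|]. Qed.

Section Links.
Variable A : comNzRingType.

Lemma set_of_ideal (I : ideal A) : is_ideal [set x | x \in I].
Proof.
split=> /= [|x y xI yI|c x xI]; [exact: rpred0 | exact: rpredD | exact: (@rpredZ _ _ I c x xI)].
Qed.

Lemma ideal_of_set (I : set A) : is_ideal I -> exists J : ideal A, forall x, x \in J <-> I x.
Proof.
move=> [I0 ID IM]; pose f : {pred A^o} := fun x => `[< I x >].
have fc : submod_closed f.
  split; first exact/asboolP.
  by move=> a x y /asboolP Ix /asboolP Iy; apply/asboolP/ID => //; apply: IM.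
exists (HB.pack f (GRing.isSubmodClosed.Build A A^o f fc) : ideal A) => x.
by split => [/asboolP//|Ix]; apply/asboolP.
Qed.

Lemma idealr_of_set (I : set A) : is_ideal I -> ~ I 1 -> exists J : idealr A, forall x, x \in J <-> I x.
Proof.
move=> [I0 ID IM] I1; pose f : {pred A} := fun x => `[< I x >].
have fc : idealr_closed f.
  split; [exact/asboolP | by apply/asboolP |].
  by move=> a x y /asboolP Ix /asboolP Iy; apply/asboolP/ID => //; apply: IM.
exists (HB.pack f (isIdealr.Build A f fc) : idealr A) => x.
by split => [/asboolP//|Ix]; apply/asboolP.
Qed.

Lemma prime_idealr_of_set (I : set A) : prime_set I ->
  exists J : prime_idealr A, forall x, x \in J <-> I x.
Proof.
move=> [[I0 ID IM] I1 Ip]; pose f : {pred A} := fun x => `[< I x >].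
have fc : idealr_closed f.
  split; [exact/asboolP | by apply/asboolP |].
  by move=> a x y /asboolP Ix /asboolP Iy; apply/asboolP/ID => //; apply: IM.
have fp : prime_idealr_closed f.
  by move=> u v /asboolP/Ip[] h; apply/orP; [left|right]; apply/asboolP.
exists (HB.pack f (isIdealr.Build A f fc) (isPrimeIdealrClosed.Build A f fp) : prime_idealr A) => x.
by split => [/asboolP//|Ix]; apply/asboolP.
Qed.

Lemma set_of_prime_idealr (I : prime_idealr A) : prime_set [set x | x \in I].
Proof.
split; first exact: idealr_is_ideal.
  by rewrite /= [_ \in I]idealr1.
by move=> a b /=; rewrite prime_idealrM => /orP.
Qed.

Lemma krull_dimE : krull_dim A = max_nat [set n | exists Q, @prime_chain A n Q].
Proof.
congr max_nat; apply/seteqP; split=> n /= [P].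
  move=> ch; exists (fun i => [set x | x \in P i]); split.
    by move=> i _; apply: set_of_prime_idealr.
  by move=> i /ch[].
move=> [Pp Ps].
(* The sets P_i are known to be prime for i <= n only, so the index is capped at n. *)
have ex i : exists J : prime_idealr A, forall x, x \in J <-> P (minn i n) x.
  by apply: prime_idealr_of_set; apply: Pp; apply: geq_minr.
have [J JP] := choice ex; exists J => i il; have [h1 h2] := Ps i il.
have e1 : minn i n = i by apply/minn_idPl/ltnW.
have e2 : minn i.+1 n = i.+1 by apply/minn_idPl.
split; first by move=> x /JP; rewrite e1 => /h1 h; apply/JP; rewrite e2.
by move=> h; apply: h2 => x Px; have := h x; rewrite !JP e1 e2; apply.
Qed.

Lemma noetherian_noeth : noetherian A -> noeth A.
Proof.
move=> nA J Jid Js; have [I IP] := choice (fun n => ideal_of_set (Jid n)).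
have [|n nP] := nA I; first by move=> n x /IP/Js h; apply/IP.
by exists n => i /nP ni x /IP xi; apply/IP; rewrite -ni.
Qed.

(** If x were not a unit, an ideal maximal among the proper ones containing x would be a maximal
    ideal, hence m. *)
Lemma local_unit (m : idealr A) : noeth A ->
  (forall I : idealr A, maximal_ideal I -> I =i m) ->
  forall x, x \notin m -> exists y, x * y = 1.
Proof.
move=> nA maxm x xm; apply: contrapT => nx; move/negP: xm; apply.
have idx : is_ideal (lideal [:: x]) by apply: lideal_ideal.
pose Q (J : set A) := [/\ is_ideal J, ~ J 1 & J x].
have [||J [[idJ J1 Jx] Jmax]] := @noeth_max _ nA Q; first by move=> J [].
  exists (lideal [:: x]); split => //; last exact/inspan_mem/mem_head.
  by move=> /lideal1E[y yx]; apply: nx; exists y; rewrite mulrC.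
have [M MP] := idealr_of_set idJ J1; rewrite -(maxm M); first exact/MP.
move=> N MN y; apply/idP/idP => [Ny|/MN//]; apply/MP.
apply: (Jmax [set z | z \in N]) Ny.
  split; [exact: idealr_is_ideal | by rewrite /= [_ \in N]idealr1 | by apply/MN/MP].
by move=> z /MP/MN.
Qed.

End Links.

Section ModLength.
Variables (X Y : comNzRingType) (f : {rmorphism X -> Y}).
Hypothesis f_surj : forall y, exists x, f x = y.
Variable I : ideal Y.

Let proj0 : quot_proj I 0 = 0.
Proof. by apply: (addrI (quot_proj I 0)); rewrite -quot_projD !addr0. Qed.

(** Along a surjection X -> Y, lengths over Y can be computed with ideals of X. This measures R, S
    and T inside the fiber product, although each length is defined over its own ring. *)
Lemma mod_length_chain l : chain_length [set x | f x \in I] l -> mod_length (quot_mod I) = l.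
Proof.
move=> [[C [Cid JC Cs]] lmax]; apply: max_nat_eq => /=.
  have ex i : exists N : submodClosed (quot_mod I), forall v, v \in N <->
      exists2 x, C (minn i l) x & v = quot_proj I (f x).
    have [C0 CD CM] := Cid _ (geq_minr i l).
    pose N : {pred quot_mod I} := fun v => `[< exists2 x, C (minn i l) x & v = quot_proj I (f x) >].
    have Nc : submod_closed N.
      split; first by apply/asboolP; exists 0 => //; rewrite rmorph0 proj0.
      move=> a u v /asboolP[x Cx ->] /asboolP[y Cy ->]; have [z <-] := f_surj a.
      apply/asboolP; exists (z * x + y); first by apply: CD => //; apply: CM.
      rewrite rmorphD rmorphM quot_projD; congr (_ + _); exact: quot_mod_scale_proj.
    exists (HB.pack N (GRing.isSubmodClosed.Build Y (quot_mod I) N Nc) : submodClosed (quot_mod I)).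
    by move=> v; split=> [/asboolP|h]; last exact/asboolP.
  have [N NP] := choice ex; exists N => i il; have [h1 h2] := Cs i il.
  have e1 : minn i l = i by apply/minn_idPl/ltnW.
  have e2 : minn i.+1 l = i.+1 by apply/minn_idPl.
  split; first by move=> v /NP; rewrite e1 => -[x /h1 Cx ->]; apply/NP; rewrite e2; exists x.
  move=> h; apply: h2 => x Cx.
  have /h/NP : quot_proj I (f x) \in N i.+1 by apply/NP; rewrite e2; exists x.
  rewrite e1 => -[y Cy /quot_proj_eq]; rewrite -rmorphB => xy.
  have [_ CD _] := Cid i (ltnW il); rewrite -[x](subrK y); apply: CD => //.
  have JCi (j : nat) : (j <= l)%N -> C 0%N `<=` C j.
    elim: j => [|j IH] jl z Cz //; have [sub _] := Cs j jl; apply/sub/IH => //; exact: ltnW.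
  by apply: (JCi _ (ltnW il)); apply: JC.
move=> n [N Ns]; apply: (lmax n (fun i => [set x | quot_proj I (f x) \in N i])); split.
- move=> i _; split => /=.
  + by rewrite rmorph0 proj0 rpred0.
  + by move=> x y xN yN; rewrite rmorphD quot_projD rpredD.
  + move=> c x xN; rewrite rmorphM.
    have -> : quot_proj I (f c * f x) = f c *: quot_proj I (f x) by exact/esym/quot_mod_scale_proj.
    exact: rpredZ.
- move=> x /= fxI; rewrite (_ : quot_proj I (f x) = 0) ?rpred0//.
  by rewrite -proj0; apply/quot_proj_eq; rewrite subr0.
- move=> i /Ns[h1 h2]; split; first by move=> x /h1.
  move=> h; apply: h2 => v; have [y ->] := quot_proj_surj v; have [x <-] := f_surj y.
  exact: h.
Qed.

End ModLength.

Section SIdealLink.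
Variables (A : comNzRingType) (m : idealr A).
Let ms : set A := [set x | x \in m].

Lemma ideal_gen_sub (X J : set A) : is_ideal J -> X `<=` J -> [set x | x \in ideal_gen X] `<=` J.
Proof.
move=> idJ XJ x /asboolP h; have [I IP] := ideal_of_set idJ.
by apply/IP/h => y /XJ/IP.
Qed.

Lemma ideal_gen_mem (X : set A) x : X x -> x \in ideal_gen X.
Proof. by move=> Xx; apply/asboolP => I; apply. Qed.

Lemma ideal_powE n : [set x | x \in ideal_pow m n] = ipow ms n.
Proof.
apply/seteqP; split.
  apply: ideal_gen_sub; first exact: ipow_ideal.
  move=> _ [f fm ->]; elim: n f fm => [//|n IH] f fm.
  by rewrite big_ord_recl; apply: ipow_mul; [exact: fm | apply: IH].
elim: n => [|n IH] x /=.
  move=> _; have idJ := set_of_ideal (ideal_pow m 0).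
  rewrite -[x]mulr1; apply: (is_idealMl _ idJ); apply: ideal_gen_mem.
  have f : 'I_0 -> A by case.
  by exists f; [case | rewrite big_ord0].
have idJ := set_of_ideal (ideal_pow m n.+1); have [J0 JD _] := idJ.
apply: (@pmul_subl _ ms 1 (ipow ms n) [set x | x \in ideal_pow m n.+1] x) => // u z mu /IH zn; rewrite expr1.
apply: (@ideal_gen_sub _ [set z | u * z \in ideal_pow m n.+1] _ _ z zn).
  split => /=; first by rewrite mulr0.
  - by move=> a b ua ub; rewrite mulrDr; apply: JD.
  - by move=> c a ua; rewrite mulrCA; apply: (is_idealMl _ idJ).
move=> _ [f fm ->] /=; apply: ideal_gen_mem.
exists (fun i => if unlift ord0 i is Some j then f j else u).
  by move=> i; case: unliftP.
rewrite big_ord_recl unlift_none; congr (_ * _).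
by apply: eq_bigr => i _; rewrite liftK.
Qed.

Lemma frobenius_powE q : [set x | x \in frobenius_pow m q] = pmul ms q setT.
Proof.
apply/seteqP; split.
  apply: ideal_gen_sub; first exact: pmul_ideal.
  by move=> _ [x mx <-]; rewrite -[_ ^+ q]mulr1; apply: pmul_mul.
have idJ := set_of_ideal (frobenius_pow m q); have [J0 JD _] := idJ.
move=> x; apply: (@pmul_subl A ms q setT [set x | x \in frobenius_pow m q] x) => // u z mu _; apply: (is_idealMr _ idJ).
by apply: ideal_gen_mem; exists u.
Qed.

Lemma s_idealE (K : realType) p (s : K) e :
  [set x | x \in s_ideal p s m e] = s_id ms p (ceil_pow p s) e.
Proof.
rewrite /s_id -frobenius_powE -ideal_powE; apply/seteqP.
by split=> [x /asboolP[y [z [yI zJ ->]]]|_ [y [z [yI zJ ->]]]]; [exists y, z | apply/asboolP; exists y, z].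
Qed.

End SIdealLink.

(** * Transfer along surjections *)

Section Surjection.
Variables (X Y : comNzRingType) (f : {rmorphism X -> Y}).
Hypothesis f_surj : forall y, exists x, f x = y.

Definition fker : set X := [set x | f x = 0].

Lemma fker_ideal : is_ideal fker.
Proof.
rewrite /fker; split => /= [|x y xE yE|c x xE].
- exact: rmorph0.
- by rewrite rmorphD xE yE addr0.
- by rewrite rmorphM xE mulr0.
Qed.

Lemma pmul_lift (I M : set X) (J N : set Y) q y :
  J `<=` f @` I -> N `<=` f @` M -> pmul J q N y -> (f @` pmul I q M) y.
Proof.
move=> JI NM; apply: pmul_subl.
- by exists 0; [exact: pmul_zero | exact: rmorph0].
- move=> _ _ [a pa <-] [b pb <-]; exists (a + b); [exact: pmulD | exact: rmorphD].
- move=> _ _ /JI[u Iu <-] /NM[v Mv <-]; exists (u ^+ q * v); first exact: pmul_mul.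
  by rewrite rmorphM rmorphXn.
Qed.

Lemma pmul_push (I M : set X) (J N : set Y) q x :
  (forall u, I u -> J (f u)) -> (forall u, M u -> N (f u)) -> pmul I q M x -> pmul J q N (f x).
Proof.
move=> IJ MN; elim=> [|u v c Iu Mv _ IH]; first by rewrite rmorph0; apply: pmul_zero.
by rewrite rmorphD rmorphM rmorphXn; apply: pmul_add; [exact: IJ | exact: MN |].
Qed.

Variables (mX : set X) (mY : set Y).
Hypothesis mXY : forall x, mX x <-> mY (f x).

Lemma ipow_push n x : ipow mX n x -> ipow mY n (f x).
Proof. by elim: n x => [//|n IH] x /=; apply: pmul_push => // u /mXY. Qed.

Let mYX : mY `<=` f @` mX.
Proof. by move=> y my; have [x fx] := f_surj y; exists x => //; apply/mXY; rewrite fx. Qed.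

Lemma ipow_lift n : ipow mY n `<=` f @` ipow mX n.
Proof.
elim: n => [|n IH] y /=; last exact: pmul_lift.
by move=> _; have [x fx] := f_surj y; exists x.
Qed.

Lemma s_id_preim p nn e : [set x | s_id mY p nn e (f x)] = addsp fker (s_id mX p nn e).
Proof.
have lT : [set: Y] `<=` f @` setT by move=> y _; have [x fx] := f_surj y; exists x.
apply/seteqP; split=> [x [_ [_ [/ipow_lift[a pa <-] /(pmul_lift mYX lT)[b pb <-] xE]]]|].
  exists (x - (a + b)), (a + b); split; last by rewrite subrK.
    by rewrite /fker /= rmorphB xE rmorphD subrr.
  by exists a, b.
move=> _ [c [_ [fc [a [b [pa pb ->]]] ->]]] /=; exists (f a), (f b); split.
- exact: ipow_push.
- by apply: pmul_push pb => // u /mXY.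
- by rewrite !rmorphD fc add0r.
Qed.

Lemma prime_chain_lift n (Q : nat -> set Y) : prime_chain n Q ->
  prime_chain n (fun i => [set x | Q i (f x)]).
Proof.
move=> [Qp Qs]; split=> i il.
  have [[Q0 QD QM] Q1 Qab] := Qp i il; split.
  - split => /= [|x y xQ yQ|c x xQ]; rewrite ?rmorph0 ?rmorphD ?rmorphM//; [exact: QD | exact: QM].
  - by rewrite /= rmorph1.
  - by move=> a b /=; rewrite rmorphM; apply: Qab.
have [h1 h2] := Qs i il; split; first by move=> x /h1.
by move=> h; apply: h2 => y Qy; have [x fx] := f_surj y; have := h x; rewrite /= fx; apply.
Qed.

Lemma ideal_preim_image (I : set X) x : is_ideal I -> fker `<=` I -> (f @` I) (f x) -> I x.
Proof.
move=> [_ ID _] kI [z Iz fz]; rewrite -[x](subrK z) addrC; apply: ID => //; apply: kI.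
by rewrite /fker /= rmorphB fz subrr.
Qed.

Lemma image_ideal (I : set X) : is_ideal I -> is_ideal (f @` I).
Proof.
move=> [I0 ID IM]; split.
- by exists 0 => //; exact: rmorph0.
- by move=> _ _ [x Ix <-] [y Iy <-]; exists (x + y); [exact: ID | exact: rmorphD].
- move=> c _ [x Ix <-]; have [z <-] := f_surj c; exists (z * x); [exact: IM | exact: rmorphM].
Qed.

Lemma prime_chain_push n (Q : nat -> set X) : prime_chain n Q -> fker `<=` Q 0%N ->
  prime_chain n (fun i => f @` Q i).
Proof.
move=> [Qp Qs] kQ.
have kQi (i : nat) : (i <= n)%N -> fker `<=` Q i.
  elim: i => [//|i IH] il z kz; have [h _] := Qs i il; apply/h/IH => //; exact: ltnW.
split=> i il.
  have [idQ Q1 Qab] := Qp i il; have pre := fun x => @ideal_preim_image _ x idQ (kQi i il).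
  split; first exact: image_ideal.
  - by rewrite -(rmorph1 f) => /pre.
  - move=> a b; have [x <-] := f_surj a; have [y <-] := f_surj b; rewrite -rmorphM => /pre/Qab[] h.
      by left; exists x.
    by right; exists y.
have [h1 h2] := Qs i il; split; first by move=> _ [x /h1 Qx <-]; exists x.
move=> h; apply: h2 => x Qx; have [idQ _ _] := Qp i (ltnW il).
by apply: (ideal_preim_image idQ (kQi i (ltnW il))); apply: h; exists x.
Qed.

End Surjection.

Section Local.
Variables (K : realType) (p : nat) (s : K) (k : fieldType).
Hypothesis s0 : 0 < s.

Definition s_len (A : comNzRingType) (m : idealr A) e := mod_length (quot_mod (s_ideal p s m e)).

Record local_ring (A : comNzRingType) (m : idealr A) (r : {rmorphism A -> k}) : Prop := {
  lr_noeth : noeth A;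
  lr_unit : forall x, x \notin m -> exists y, x * y = 1;
  lr_surj : forall c, exists x, r x = c;
  lr_ker : forall x, (x \in m) = (r x == 0);
  lr_char : p \in [pchar A] }.

Lemma noetherian_local_ring (A : comNzRingType) (m : idealr A) (r : {rmorphism A -> k}) :
  noetherian_local m r -> p \in [pchar A] -> local_ring m r.
Proof.
move=> [nA maxm rs rk] pA; have nA' := noetherian_noeth nA; split => //.
by move=> x; apply: (local_unit nA') => I /maxm.
Qed.

Section Asym.
Variables (A : comNzRingType) (m : idealr A) (r : {rmorphism A -> k}) (d : nat).
Hypothesis lA : local_ring m r.
Hypothesis dimA : forall n Q, @prime_chain A n Q -> (n <= d)%N.

Lemma s_len_asymptotics :
  [/\ exists C, forall e, (s_len m e <= C * (p ^ e) ^ d)%N,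
      (0 < d)%N -> cvgn (dens K p d (s_len m)) &
      (0 < d)%N -> forall (R S T : comNzRingType) (mR : idealr R) (mS : idealr S) (mT : idealr T)
        (f : {rmorphism A -> R}) (g : {rmorphism A -> S}) (h : {rmorphism A -> T}),
        (forall y, exists x, f x = y) -> (forall y, exists x, g x = y) -> (forall y, exists x, h x = y) ->
        (forall x, x \in m <-> f x \in mR) -> (forall x, x \in m <-> g x \in mS) ->
        (forall x, x \in m <-> h x \in mT) ->
        (forall x, f x = 0 -> g x = 0 -> x = 0) -> fker h = addsp (fker f) (fker g) ->
        exists j, negligible p d (fun e => (s_len m (e + j) + s_len mT (e + j)) -
             (s_len mR (e + j) + s_len mS (e + j)))%N /\
          negligible p d (fun e => (s_len mR (e + j) + s_len mS (e + j)) -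
             (s_len m (e + j) + s_len mT (e + j)))%N].
Proof.
have p1 : (1 < p)%N by apply/prime_gt1/(pcharf_prime (lr_char lA)).
have unitA x : ~ [set x | x \in m] x -> exists y, x * y = 1 by move=> /negP; apply: (lr_unit lA).
have kerA x : [set x | x \in m] x <-> r x = 0 by rewrite /= (lr_ker lA); split=> /eqP.
have [l [lC lB lL lAdd]] := local_asymptotics (lr_noeth lA) unitA (lr_surj lA) kerA (lr_char lA)
  (ceil_powS p s0) (ceil_pow_shift p s0) dimA.
set sid := s_id _ p (ceil_pow p s) in lB lL lAdd.
have sidN e : ipow [set x | x \in m] (ceil_pow p s e) `<=` sid e by exact: ipow_s_id.
have idsid e : is_ideal (sid e) by exact: s_id_ideal.
have quotE (Y : comNzRingType) (mY : idealr Y) (f : {rmorphism A -> Y}) :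
    (forall y, exists x, f x = y) -> (forall x, x \in m <-> f x \in mY) ->
    forall e, s_len mY e = l (addsp (fker f) (sid e)).
  move=> f_surj fm e; apply: (mod_length_chain f_surj).
  have -> : [set x | f x \in s_ideal p s mY e] = addsp (fker f) (sid e).
    rewrite -(s_id_preim f_surj (mY := [set x | x \in mY]))//.
    by apply/funext => x /=; rewrite -s_idealE.
  apply: (lC _ (ceil_pow p s e)); first by apply: addsp_subsp => //; exact: fker_ideal.
  by move=> x /sidN; apply: addspr; have [] := fker_ideal f.
have lE e : s_len m e = l (sid e).
  rewrite (@quotE _ m idfun)//; last by move=> y; exists y.
  by rewrite (_ : fker idfun = [set 0]) ?addsp0l//.
split.
- by have [C CP] := lB; exists C => e; rewrite lE.
- move=> d0; have [j0 [G [h1 h2 h3]]] := lL d0.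
  apply: (dens_is_cvg p1 d0 (j := j0) _ _ h3).
    by apply: negligible_le h1 => e; rewrite lE.
  by apply: negligible_le h2 => e; rewrite lE.
- move=> d0 R S T mR mS mT f g h fs gs hs fm gm hm fg0 hE.
  have [j [h1 h2]] := lAdd d0 _ _ (fker_ideal f) (fker_ideal g) fg0; exists j.
  split; [apply: negligible_le h1 => e | apply: negligible_le h2 => e].
    by rewrite lE !(quotE _ _ _ fs fm) !(quotE _ _ _ gs gm) !(quotE _ _ _ hs hm) hE addsp0l.
  by rewrite lE !(quotE _ _ _ fs fm) !(quotE _ _ _ gs gm) !(quotE _ _ _ hs hm) hE addsp0l.
Qed.
End Asym.
End Local.

(** * The fiber product *)

Lemma surj_local (p : nat) (k : fieldType) (A B : comNzRingType) (mA : idealr A) (mB : idealr B)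
  (rA : {rmorphism A -> k}) (rB : {rmorphism B -> k}) (f : {rmorphism A -> B}) :
  local_ring p mA rA -> local_ring p mB rB -> (forall y, exists x, f x = y) ->
  forall x, x \in mA <-> f x \in mB.
Proof.
move=> lA lB fs x; split=> [xA|fxB]; last first.
  apply: contraT => /(lr_unit lA)[y xy].
  have := idealr1 mB; rewrite -(rmorph1 f) -xy rmorphM mulrC => /negP[].
  exact: idealMr.
apply: contraT => /(lr_unit lB)[b]; have [y <-] := fs b => xy.
(* This element maps to 0, so it is not a unit; together with x in mA it would put 1 in mA. *)
have zA : 1 - y * x \in mA.
  apply: contraT => /(lr_unit lA)[z /(congr1 f)].
  by rewrite !rmorphM rmorphB rmorphM [f y * _]mulrC xy rmorph1 subrr mul0r => /esym/eqP; rewrite oner_eq0.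
by have := idealr1 mA; rewrite -(subrK (y * x) 1) => /negP[]; rewrite rpredD// idealMr.
Qed.

Section Fiber.
Variables (p : nat) (k : fieldType) (R S T : comNzRingType).
Variables (mR : idealr R) (mS : idealr S) (mT : idealr T).
Variables (rR : {rmorphism R -> k}) (rS : {rmorphism S -> k}) (rT : {rmorphism T -> k}).
Hypothesis lR : local_ring p mR rR.
Hypothesis lS : local_ring p mS rS.
Hypothesis lT : local_ring p mT rT.
Variables (epsR : {rmorphism R -> T}) (epsS : {rmorphism S -> T}).
Hypothesis epsR_surj : forall t : T, exists x : R, epsR x = t.
Hypothesis epsS_surj : forall t : T, exists x : S, epsS x = t.

Local Notation P := (fiber_prod epsR epsS).
Let mP : idealr P := fiber_max epsR epsS mR mS.

Definition fpr1 : {rmorphism P -> R} := GRing.RMorphism.clone _ _ (fst \o (val : P -> (R * S)%type)) _.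
Definition fpr2 : {rmorphism P -> S} := GRing.RMorphism.clone _ _ (snd \o (val : P -> (R * S)%type)) _.

Lemma fprE x : epsR (fpr1 x) = epsS (fpr2 x).
Proof. by apply/eqP; exact: (valP x). Qed.

Lemma fpr_eq x y : fpr1 x = fpr1 y -> fpr2 x = fpr2 y -> x = y.
Proof. by move=> h1 h2; apply: val_inj; rewrite [LHS]surjective_pairing [RHS]surjective_pairing; congr (_, _). Qed.

Lemma fpr_pair a b : epsR a = epsS b -> exists x : P, fpr1 x = a /\ fpr2 x = b.
Proof.
move=> ab; have h : fiber_pred epsR epsS (a, b) by rewrite /fiber_pred/= ab.
by exists (exist _ (a, b) h).
Qed.

Lemma fpr1_surj a : exists x, fpr1 x = a.
Proof. by have [b /esym/fpr_pair[x []]] := epsS_surj (epsR a); exists x. Qed.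

Lemma fpr2_surj b : exists x, fpr2 x = b.
Proof. by have [a /fpr_pair[x []]] := epsR_surj (epsS b); exists x. Qed.

Lemma mem_fiber_max x : (x \in mP) = (fpr1 x \in mR) && (fpr2 x \in mS).
Proof. by []. Qed.

Lemma mem_fiber_max12 x : fpr1 x \in mR <-> fpr2 x \in mS.
Proof.
by rewrite (surj_local lR lT epsR_surj) (surj_local lS lT epsS_surj) fprE.
Qed.

Lemma mem_fiber_max1 x : x \in mP <-> fpr1 x \in mR.
Proof.
rewrite mem_fiber_max; split=> [/andP[]//|h]; rewrite h /=; exact/mem_fiber_max12.
Qed.

Lemma mem_fiber_max2 x : x \in mP <-> fpr2 x \in mS.
Proof. by rewrite mem_fiber_max1 mem_fiber_max12. Qed.

Lemma fiber_local_ring : local_ring p mP (rR \o fpr1).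
Proof.
split.
- move=> J Jid Js.
  have JJ i j : (i <= j)%N -> J i `<=` J j.
    elim: j => [|j IH]; first by rewrite leqn0 => /eqP->.
    by rewrite leq_eqVlt ltnS => /orP[/eqP->//|/IH h x /h/Js].
  have [n1 h1] := lr_noeth lR (fun n => image_ideal fpr1_surj (Jid n)) (fun n => @image_subset _ _ fpr1 _ _ (Js n)).
  (* A chain of ideals is controlled by its images in R and by its parts inside the kernel of
     [fpr1]; the latter are ideals of S because [fpr2] is onto. *)
  pose J2 n : set S := [set b | exists x, [/\ J n x, fpr1 x = 0 & fpr2 x = b]].
  have [||n2 h2] := @lr_noeth _ _ _ _ _ lS J2.
  + move=> n; have [J0 JD JM] := Jid n; split.
    * by exists 0; rewrite !rmorph0.
    * move=> _ _ [x [Jx x0 <-]] [y [Jy y0 <-]]; exists (x + y).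
      by rewrite !rmorphD x0 y0 addr0; split => //; apply: JD.
    * move=> c _ [x [Jx x0 <-]]; have [z <-] := fpr2_surj c; exists (z * x).
      by rewrite !rmorphM x0 mulr0; split => //; apply: JM.
  + by move=> n _ [x [/Js Jx x0 <-]]; exists x.
  exists (maxn n1 n2) => i; rewrite geq_max => /andP[i1 i2] x Jx.
  have [_ JD _] := Jid (maxn n1 n2).
  have [y Jy xy] := h1 i i1 (fpr1 x) (ex_intro2 _ _ x Jx erefl).
  have Jyi : J i y by apply: JJ i1 _ Jy.
  have [|z [Jz z0 zE]] := h2 i i2 (fpr2 (x - y)).
    by exists (x - y); split => //; [exact: (subspB (Jid i)) | rewrite rmorphB xy subrr].
  have -> : x = y + z.
    by apply: fpr_eq; rewrite rmorphD ?z0 ?addr0// zE rmorphB addrC subrK.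
  by apply: JD; [apply: JJ Jy; exact: leq_maxl | apply: JJ Jz; exact: leq_maxr].
- move=> x xm.
  have /(lr_unit lR)[a xa] : fpr1 x \notin mR by apply: contra xm => /mem_fiber_max1.
  have /(lr_unit lS)[b xb] : fpr2 x \notin mS by apply: contra xm => /mem_fiber_max2.
  have [|y [y1 y2]] := @fpr_pair a b.
    have ta : epsR (fpr1 x) * epsR a = 1 by rewrite -rmorphM xa rmorph1.
    have tb : epsR (fpr1 x) * epsS b = 1 by rewrite fprE -rmorphM xb rmorph1.
    by rewrite -[LHS]mulr1 -tb mulrCA mulrA ta mul1r.
  by exists y; apply: fpr_eq; rewrite rmorphM rmorph1 ?y1 ?y2.
- by move=> c; have [a <-] := lr_surj lR c; have [x <-] := fpr1_surj a; exists x.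
- by move=> x; rewrite -(lr_ker lR); apply/idP/idP => /mem_fiber_max1.
- rewrite inE (pcharf_prime (lr_char lR)) /=; apply/eqP/fpr_eq; rewrite rmorph_nat rmorph0.
    exact: (pcharf0 (lr_char lR)).
  exact: (pcharf0 (lr_char lS)).
Qed.

(** The kernels of the two projections have product 0, so the smallest prime of the chain contains
    one of them, and the chain descends to R or to S. *)
Lemma fiber_prime_chain n Q : @prime_chain P n Q ->
  (exists Q', @prime_chain R n Q') \/ (exists Q', @prime_chain S n Q').
Proof.
move=> ch; have [Qp _] := ch; have [[Q0 QD QM] Q1 Qab] := Qp 0%N (leq0n _).
case: (pselect (fker fpr1 `<=` Q 0%N)) => [k1|k1].
  by left; exists (fun i => fpr1 @` Q i); apply: prime_chain_push ch k1; exact: fpr1_surj.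
right; exists (fun i => fpr2 @` Q i); apply: prime_chain_push ch _; first exact: fpr2_surj.
move=> y y0; apply: contrapT => Qy; apply: k1 => x x0.
have xy : x * y = 0 by apply: fpr_eq; rewrite rmorphM rmorph0 ?x0 ?y0 ?mul0r ?mulr0.
by have [] : Q 0%N x \/ Q 0%N y by apply: Qab; rewrite xy.
Qed.

Lemma fiber_kernel : fker (epsR \o fpr1) = addsp (fker fpr1) (fker fpr2).
Proof.
apply/seteqP; split.
  move=> x /= x0; have [y [y1 y2]] := @fpr_pair 0 (fpr2 x) (etrans (rmorph0 _) (etrans (esym x0) (fprE x))).
  by exists y, (x - y); rewrite (addrC y) subrK; split => //; apply: (etrans (rmorphB fpr2 x y)); rewrite y2 subrr.
move=> _ [x [y [x0 y0 ->]]]; have fx : fpr1 x = 0 := x0; have fy : fpr2 y = 0 := y0.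
change (epsR (fpr1 (x + y)) = 0); by rewrite fprE (rmorphD fpr2) fy addr0 -fprE fx rmorph0.
Qed.

End Fiber.

Lemma krull_dim_ub (A : comNzRingType) N : (forall n Q, @prime_chain A n Q -> (n <= N)%N) ->
  forall n Q, @prime_chain A n Q -> (n <= krull_dim A)%N.
Proof.
move=> NA n Q ch; rewrite krull_dimE; apply: (@max_nat_ub _ N); last by exists Q.
by move=> i [Q' /NA].
Qed.

Lemma krull_dim_gt0 (A : comNzRingType) : (0 < krull_dim A)%N ->
  (exists Q, @prime_chain A (krull_dim A) Q) /\
  forall n Q, @prime_chain A n Q -> (n <= krull_dim A)%N.
Proof.
rewrite krull_dimE => /max_nat_gt0[h1 h2]; split => // n Q ch.
by apply: h2; exists Q.
Qed.

Lemma dens_s_len (K : realType) (p : nat) (s : K) (k : fieldType) (A : comNzRingType) (m : idealr A)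
  (r : {rmorphism A -> k}) (d dA : nat) : 0 < s -> local_ring p m r ->
  (forall n Q, @prime_chain A n Q -> (n <= dA)%N) -> (0 < d)%N -> (dA <= d)%N ->
  cvgn (dens K p d (s_len p s m)) /\ ((dA < d)%N -> limn (dens K p d (s_len p s m)) = 0).
Proof.
move=> s0 lA dimA d0 dAd; have p1 : (1 < p)%N by apply/prime_gt1/(pcharf_prime (lr_char lA)).
have [B L _] := s_len_asymptotics s0 lA dimA.
have C0 : (dA < d)%N -> dens K p d (s_len p s m) @ \oo --> (0 : K).
  by move=> lt; apply: negligible_cvg0 => //; apply: bound_negligible lt B.
split; last by move=> /C0 h; apply: cvg_lim.
move: dAd; rewrite leq_eqVlt => /orP[/eqP E|/C0 /cvgP//].
by rewrite -E; apply: L; rewrite E.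
Qed.

Section Main.
Variables (K : realType) (p : nat) (s : K) (k : fieldType) (R S T : comNzRingType).
Variables (mR : idealr R) (mS : idealr S) (mT : idealr T).
Variables (rR : {rmorphism R -> k}) (rS : {rmorphism S -> k}) (rT : {rmorphism T -> k}).
Hypothesis lR : local_ring p mR rR.
Hypothesis lS : local_ring p mS rS.
Hypothesis lT : local_ring p mT rT.
Variables (epsR : {rmorphism R -> T}) (epsS : {rmorphism S -> T}).
Hypothesis epsR_surj : forall t : T, exists x : R, epsR x = t.
Hypothesis epsS_surj : forall t : T, exists x : S, epsS x = t.
Hypothesis s0 : 0 < s.
Hypothesis dimS : (0 < krull_dim S)%N.
Hypothesis dimSR : (krull_dim S <= krull_dim R)%N.

Let P := fiber_prod epsR epsS.
Let mP : idealr P := fiber_max epsR epsS mR mS.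
Let d := krull_dim R.
Let lim_dens (A : comNzRingType) (m : idealr A) := limn (dens K p d (s_len p s m)).

(** All four rings are normalized by q^d with d = dim R, whatever their own dimension; those of
    smaller dimension then have limit 0. *)
Lemma fiber_limits :
  [/\ krull_dim P = d,
      lim_dens mP + lim_dens mT = lim_dens mR + lim_dens mS,
      (krull_dim S < d)%N -> lim_dens mS = 0 &
      (krull_dim T < krull_dim S)%N -> lim_dens mT = 0].
Proof.
have d0 : (0 < d)%N by exact: leq_trans dimSR.
have [[Q chQ] bR] := krull_dim_gt0 d0.
have [_ bS] := krull_dim_gt0 dimS.
(* The dimension of T may be 0, so prime chains in T are bounded through S. *)
have liftT n Q' : @prime_chain T n Q' -> (n <= krull_dim S)%N.
  by move=> /(prime_chain_lift epsS_surj)/bS.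
have bT := krull_dim_ub liftT.
have bP n Q' : @prime_chain P n Q' -> (n <= d)%N.
  move=> /(fiber_prime_chain epsR_surj epsS_surj)[[Q'' /bR//]|[Q'' /bS h]].
  exact: leq_trans h dimSR.
have dP : krull_dim P = d.
  rewrite krull_dimE; apply: max_nat_eq; last by move=> n [Q' /bP].
  by eexists; apply: prime_chain_lift chQ; exact: (fpr1_surj epsR epsS_surj).
have lP := fiber_local_ring lR lS lT epsR_surj epsS_surj.
have [cP _] := dens_s_len s0 lP bP d0 (leqnn _).
have [cR _] := dens_s_len s0 lR bR d0 (leqnn _).
have [cS S0] := dens_s_len s0 lS bS d0 dimSR.
have [cT T0] := dens_s_len s0 lT (fun n Q' ch => leq_trans (liftT n Q' ch) dimSR) d0 (leqnn _).
split => //; last first.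
  move=> ltT; have ltd := leq_trans ltT dimSR.
  by have [_] := dens_s_len s0 lT bT d0 (ltnW ltd); apply.
have [_ _ /(_ d0) h] := s_len_asymptotics s0 lP bP.
have hm x : x \in mP <-> epsR (fpr1 epsR epsS x) \in mT.
  by rewrite (mem_fiber_max1 lR lS lT epsR_surj epsS_surj) (surj_local lR lT epsR_surj).
have [||||||||j [h1 h2]] := h R S T mR mS mT (fpr1 epsR epsS) (fpr2 epsR epsS) (epsR \o fpr1 epsR epsS).
- exact: fpr1_surj.
- exact: fpr2_surj.
- move=> t; have [a <-] := epsR_surj t; have [x <-] := fpr1_surj epsR epsS_surj a.
  by exists x.
- exact: (mem_fiber_max1 lR lS lT epsR_surj epsS_surj).
- exact: (mem_fiber_max2 lR lS lT epsR_surj epsS_surj).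
- exact: hm.
- by move=> x x1 x2; apply: fpr_eq; rewrite ?x1 ?x2 rmorph0.
- exact: fiber_kernel.
have p1 : (1 < p)%N by apply/prime_gt1/(pcharf_prime (lr_char lR)).
exact: (dens_add p1 h1 h2 cP cR cS cT).
Qed.

End Main.

Unset Implicit Arguments.

Theorem corollary3p5 (K : realType) (p : nat) (s : K)
    (k : fieldType) (R S T : comNzRingType)
    (mR : idealr R) (mS : idealr S) (mT : idealr T)
    (resR : {rmorphism R -> k}) (resS : {rmorphism S -> k})
    (resT : {rmorphism T -> k})
    (localR : noetherian_local mR resR)
    (localS : noetherian_local mS resS)
    (localT : noetherian_local mT resT)
    (charR : p \in [pchar R]) (charS : p \in [pchar S])
    (charT : p \in [pchar T])
    (epsR : {rmorphism R -> T}) (epsS : {rmorphism S -> T})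
    (epsR_surj : forall t : T, exists x : R, epsR x = t)
    (epsS_surj : forall t : T, exists x : S, epsS x = t)
    (dimR_gt0 : (0 < krull_dim R)%N) (s_gt0 : 0 < s) :
  let P := fiber_prod epsR epsS in
  let mP : idealr P := fiber_max epsR epsS mR mS in
  [/\ krull_dim R = krull_dim S -> krull_dim S = krull_dim T ->
        e_mult p s mP = e_mult p s mR + e_mult p s mS - e_mult p s mT,
      krull_dim R = krull_dim S -> (krull_dim T < krull_dim S)%N ->
        e_mult p s mP = e_mult p s mR + e_mult p s mS
    & (krull_dim S < krull_dim R)%N -> (krull_dim T < krull_dim S)%N ->
        e_mult p s mP = e_mult p s mR].
Proof.
have lR := noetherian_local_ring localR charR.
have lS := noetherian_local_ring localS charS.
have lT := noetherian_local_ring localT charT.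
have lim := fiber_limits lR lS lT epsR_surj epsS_surj s_gt0.
move=> P mP; rewrite /e_mult /h_mult; split.
- move=> RS ST; have [|| dP add _ _] := lim; [by rewrite -RS | by rewrite RS |].
  (* All dimensions agree, so the normalizing factor is common and only the limits are compared. *)
  rewrite -/P dP -ST -RS -mulrDl -mulrBl; congr (_ / _).
  by apply/eqP; rewrite eq_sym subr_eq; apply/eqP/esym.
- move=> RS TS; have [||dP add _ /(_ TS) T0] := lim; [by rewrite -RS | by rewrite RS |].
  by rewrite -/P dP -RS -mulrDl; congr (_ / _); move: add; rewrite T0 addr0.
- move=> SR TS; have [||dP add /(_ SR) S0 /(_ TS) T0] := lim.
  + by case: (krull_dim S) TS.
  + exact: ltnW.
  by rewrite -/P dP; congr (_ / _); move: add; rewrite T0 S0 !addr0.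
Qed.
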